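(* Let $q$ be a complex number with $0<|q|<1$. Then the following two identities hold, where each sum runs over all quadruples $(i,j,k,l)$ of nonnegative integers: \begin{align*} \sum_{i,j,k,l \geq 0} \frac{q^{i^2 + 2j^2 + 2k^2 + 2l^2 - 2ij + 2ik - 2jk - 2jl + 2i - 2j + 2k}}{(q^2; q^2)_i (q^2; q^2)_j (q^2; q^2)_k (q^2; q^2)_l} &= 3 \frac{J_6^3}{J_1 J_2 J_4},\\ \sum_{i,j,k,l \geq 0} \frac{q^{\frac{1}{2}(i^2 + i) + j^2 + k^2 + l^2 - ij + ik - jk - jl - j + k+l}}{(q; q)_i (q; q)_j (q; q)_k (q; q)_l} &= 3 \frac{J_2 J_3^3}{J_1^4}. \end{align*}
   Context: For a complex number $a$, a base $p$ with $|p|<1$ and an integer $n\ge 0$: $(a;p)_n:=\prod_{k=0}^{n-1}(1-ap^k)$ (so $(a;p)_0=1$) and $(a;p)_\infty:=\prod_{k=0}^{\infty}(1-ap^k)$. For a positive integer $m$, $J_m:=(q^m;q^m)_\infty$. *)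

(* Defs.v *)
From HB Require Import structures.
From mathcomp Require Import all_boot all_order all_algebra.
From mathcomp Require Import complex.
From mathcomp Require Import all_classical all_reals all_analysis.
From mathcomp.analysis.showcase Require Import summability.

Set Implicit Arguments.
Unset Strict Implicit.
Unset Printing Implicit Defensive.

Import Order.TTheory GRing.Theory Num.Theory.
Import numFieldNormedType.Exports.

Local Open Scope classical_set_scope.
Local Open Scope ring_scope.

(* The library puts the topology of the modulus on [R[i]^o] only, not on [R[i]]. *)
HB.instance Definition _ (R : realType) := NormedModule.copy R[i] R[i]^o.

Definition qpoch (R : realType) (a p : R[i]) (n : nat) : R[i] :=
  \prod_(k < n) (1 - a * p ^+ k).

(* [lim] takes a default value when the partial products diverge; they converge
   as soon as [`|p| < 1], the only case in which this is used. *)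
Definition qpoch_inf (R : realType) (a p : R[i]) : R[i] :=
  lim (qpoch a p n @[n --> \oo]).

Definition J (R : realType) (q : R[i]) (m : nat) : R[i] :=
  qpoch_inf (q ^+ m) (q ^+ m).

(* Unconditional (equivalently, absolute) convergence to [s] of the family
   [f i j k l] over quadruples of naturals: the limit is taken along the
   finite subsets of [nat ^ 4] ordered by inclusion. *)
Definition has_sum4 (R : realType) (f : nat -> nat -> nat -> nat -> R[i])
    (s : R[i]) : Prop :=
  partial_sum (fun x : nat * nat * nat * nat =>
    let: (i, j, k, l) := x in f i j k l) @ totally --> s.

(* Main.v *)
Require Import Defs.
From HB Require Import structures.
From mathcomp Require Import all_boot all_order all_algebra.
From mathcomp Require Import complex finmap.
From mathcomp Require Import all_classical all_reals all_analysis.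
From mathcomp Require Import zify ring lra.
From mathcomp.analysis.showcase Require Import summability.

Set Implicit Arguments.
Unset Strict Implicit.
Unset Printing Implicit Defensive.

Import Order.TTheory GRing.Theory Num.Theory.
Import numFieldNormedType.Exports.

Local Open Scope ring_scope.

(** Both sides of each identity are, up to elementary infinite products, the cubic theta
    series [c(x) = \sum_(m, n) x^(m^2 + m n + n^2 + m + n)], taken over all integers, whose
    product form is [3 (x^3; x^3)_oo^3 / (x; x)_oo] ([cubic_theta]).  That formula comes from
    cubing the theta series at a primitive cube root of unity.

    All sums are unconditional.  Such a sum may be bracketed along the fibres of any map
    ([sums_to_fibres]) and, when the family is absolutely summable, opened again
    ([sums_to_expand], [sums_to_pair]); the whole argument is a chain of these two moves,
    each fibre being one classical q-series.

    Bracketing the quadruple sums by [m = i + k] and [n = j - l] separates them: the sum over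
    [(i, k)] is the finite q-binomial theorem, and the one over [(j, l)] is a Durfee rectangle
    sum with an additional factor [x^(- m j)], equal to a Laurent polynomial in [x^n] with
    Gaussian binomial coefficients ([durfee_shifted], [sums_to_quadruple]).  Writing out this
    polynomial gives a sum over triples [(r, s, n)] with [r + s = m].

    For the second identity the sum over [s] is Lebesgue's identity ([lebesgue_sum]).  A finite
    Rogers--Szego sum ([sum_gauss_triangular]) then replaces [1 / (q; q)_r] by a sum over
    [a + b = r], and for fixed [b - a] and [a - n] the sum is a confluent q-Gauss sum with a
    value independent of the diagonal ([diagonal_sum]).  What remains is [c(q)].

    For the first identity the sum over [s] has no product form.  Heine's transformation turns
    it into the odd part of Euler's series for [1 / (z; s^2)_oo] at [z = s^(2 r + 1)], where
    [s^2 = - q], that is into an average over the two square roots of [- q]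
    ([odd_lebesgue]).  For each square root the sum over [(r, n)] telescopes to the product
    of [\sum_v s^(v^2)] and of a theta series [\sum_t s^(3 t^2 + 2 t)] evaluated by a Bailey
    pair ([telescoped_sum], [mod_six_sum]).  Averaging keeps the pairs with [t + v] odd, and
    [t = - (m + n + 1)], [v = m - n] carries them onto the lattice of [c(q^2)]
    ([averaged_sum]). *)


(** * Unconditional sums *)

Section UnconditionalSums.
Variable R : realType.
Local Notation C := R[i].

(** The limit along the finite subsets ordered by inclusion, as in [has_sum4], for families
    over any index type. *)
Definition sums_to (I : choiceType) (f : I -> C) (s : C) : Prop :=
  forall e : C, 0 < e -> exists A : {fset I}, forall B : {fset I},
    (A `<=` B)%fset -> `|\sum_(i <- B) f i - s| < e.

Definition abs_summable (I : choiceType) (f : I -> C) : Prop :=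
  exists M : C, forall B : {fset I}, \sum_(i <- B) `|f i| <= M.

Lemma sums_to_uniq (I : choiceType) (f : I -> C) s t :
  sums_to f s -> sums_to f t -> s = t.
Proof.
move=> hs ht; apply/eqP; rewrite -subr_eq0 -normr_le0; apply/negPn/negP.
rewrite -real_ltNge ?real0 ?normr_real // => d0.
have e0 : 0 < `|s - t| / 2 by rewrite divr_gt0.
have [A hA] := hs _ e0; have [B hB] := ht _ e0.
have := hA (A `|` B)%fset (fsubsetUl _ _); have := hB (A `|` B)%fset (fsubsetUr _ _).
set u := \sum_(_ <- _) _ => h1 h2.
have : `|s - t| < `|s - t| / 2 + `|s - t| / 2.
  rewrite [X in `|X| < _](_ : s - t = (u - t) - (u - s)); last by ring.
  by apply: le_lt_trans (ler_normB _ _) _; apply: ltrD.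
by rewrite -splitr ltxx.
Qed.

Lemma eq_sums_to (I : choiceType) (f g : I -> C) s :
  f =1 g -> sums_to f s -> sums_to g s.
Proof.
move=> fg hf e e0; have [A hA] := hf e e0; exists A => B AB.
by rewrite -(eq_bigr _ (fun i _ => fg i)); exact: hA.
Qed.

Lemma sums_toD (I : choiceType) (f g : I -> C) s t :
  sums_to f s -> sums_to g t -> sums_to (fun i => f i + g i) (s + t).
Proof.
move=> hs ht e e0; have e2 : 0 < e / 2 by rewrite divr_gt0.
have [A hA] := hs _ e2; have [A' hA'] := ht _ e2.
exists (A `|` A')%fset => B; rewrite fsubUset => /andP[AB A'B].
rewrite big_split /= opprD addrACA [ltRHS](splitr e).
by apply: le_lt_trans (ler_normD _ _) _; apply: ltrD; [exact: hA|exact: hA'].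
Qed.

Lemma sums_toZ (I : choiceType) (f : I -> C) s c :
  sums_to f s -> sums_to (fun i => c * f i) (c * s).
Proof.
move=> hs e e0.
have c1 : 0 < `|c| + 1 by rewrite ltr_wpDl.
have [A hA] := hs (e / (`|c| + 1)) (divr_gt0 e0 c1).
exists A => B AB; rewrite -mulr_sumr -mulrBr normrM.
apply: le_lt_trans (_ : (`|c| + 1) * `|\sum_(i <- B) f i - s| < e).
  by rewrite ler_wpM2r // lerDl.
by rewrite mulrC -ltr_pdivlMr //; exact: hA.
Qed.

Lemma sums_toZr (I : choiceType) (f : I -> C) s c :
  sums_to f s -> sums_to (fun i => f i * c) (s * c).
Proof.
by move=> hs; rewrite mulrC; apply: eq_sums_to (sums_toZ c hs) => i; exact: mulrC.
Qed.

Lemma sums_toN (I : choiceType) (f : I -> C) s :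
  sums_to f s -> sums_to (fun i => - f i) (- s).
Proof.
by move=> hs; rewrite -mulN1r; apply: eq_sums_to (sums_toZ (-1) hs) => i; rewrite mulN1r.
Qed.

Lemma sums_toB (I : choiceType) (f g : I -> C) s t :
  sums_to f s -> sums_to g t -> sums_to (fun i => f i - g i) (s - t).
Proof. by move=> hs ht; apply: sums_toD => //; exact: sums_toN. Qed.

Lemma sums_to_finite (I : choiceType) (f : I -> C) (A : {fset I}) :
  (forall i, i \notin A -> f i = 0) -> sums_to f (\sum_(i <- A) f i).
Proof.
move=> f0 e e0; exists A => B AB.
rewrite (big_fset_incl _ AB) ?subrr ?normr0 // => i _; exact: f0.
Qed.

Lemma sums_to0 (I : choiceType) : sums_to (fun _ : I => 0) 0.
Proof.
have := @sums_to_finite I (fun=> 0) fset0 (fun _ _ => erefl).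
by rewrite big_seq_fset0.
Qed.

(** The workhorse: an unconditional sum may be bracketed along the fibres of any
    map [p].  A finite set of fibres is exhausted by the part of a large finite
    set lying over it, and that part still contains the set witnessing the
    convergence of the whole family. *)
Lemma sums_to_fibres (I K : choiceType) (f : I -> C) (p : I -> K) (F : K -> C) s :
  sums_to f s ->
  (forall k, sums_to (fun i => if p i == k then f i else 0) (F k)) ->
  sums_to F s.
Proof.
move=> hs hF e e0; have e2 : 0 < e / 2 by rewrite divr_gt0.
have [A hA] := hs _ e2; exists [fset p i | i in A]%fset => K' AK'.
have hK : sums_to (fun i => if p i \in K' then f i else 0) (\sum_(k <- K') F k).
  apply: (@eq_sums_to _ (fun i => \sum_(k <- K') if p i == k then f i else 0)).
    move=> i; case: ifP => [pK'|/negbT pK'].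
      rewrite (big_fsetD1 (p i)) //= eqxx big1_fset ?addr0 // => k.
      by rewrite !inE => /andP[/negPf kp _] _; rewrite eq_sym kp.
    rewrite big1_fset // => k kK' _; case: eqP => // pk.
    by rewrite pk kK' in pK'.
  elim: {AK'} (enum_fset K') => [|k r IH].
    by rewrite big_nil; apply: eq_sums_to (sums_to0 I) => i; rewrite big_nil.
  rewrite big_cons; apply: eq_sums_to (sums_toD (hF k) IH) => i.
  by rewrite big_cons.
have [B hB] := hK _ e2.
pose B' := [fset i in (A `|` B)%fset | p i \in K']%fset.
have AB' : (A `<=` B')%fset.
  apply/fsubsetP => i iA; rewrite !inE iA /=.
  by move/fsubsetP: AK'; apply; apply: in_imfset.
have h1 := hA _ AB'; have h2 := hB _ (fsubsetUr A B).
have E : \sum_(i <- (A `|` B)%fset) (if p i \in K' then f i else 0) =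
         \sum_(i <- B') f i.
  rewrite -[LHS](@big_fset_incl _ _ _ _ B').
  - by apply: eq_big_seq => i; rewrite !inE => /andP[_ ->].
  - by apply/fsubsetP => i; rewrite !inE => /andP[].
  - by move=> i iAB; rewrite !inE in iAB *; rewrite iAB /= => /negPf ->.
rewrite E in h2.
have -> : \sum_(k <- K') F k - s =
  (\sum_(i <- B') f i - s) - (\sum_(i <- B') f i - \sum_(k <- K') F k) by ring.
rewrite [ltRHS](splitr e).
by apply: le_lt_trans (ler_normB _ _) _; apply: ltrD.
Qed.

Lemma sums_to_inj (I J : choiceType) (f : I -> C) (g : J -> I) s :
  injective g -> (forall i, (forall j, i <> g j) -> f i = 0) ->
  sums_to (fun j => f (g j)) s -> sums_to f s.
Proof.
move=> gI f0 hs e e0; have [A hA] := hs e e0.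
exists [fset g j | j in A]%fset => B AB.
have finB : finite_set (g @^-1` [set` B])%classic.
  by apply: finite_preimage => //; move=> x y _ _; exact: gI.
pose A' := fset_set (g @^-1` [set` B])%classic.
have memA' j : (j \in A') = (g j \in B).
  by rewrite in_fset_set //; apply/idP/idP => [/set_mem|] //= h; apply/mem_set.
have AA' : (A `<=` A')%fset.
  apply/fsubsetP => j jA; rewrite memA'; move/fsubsetP: AB; apply.
  exact: in_imfset.
have := hA _ AA'; suff -> : \sum_(j <- A') f (g j) = \sum_(i <- B) f i by [].
have <- : \sum_(i <- [fset g j | j in A']%fset) f i = \sum_(j <- A') f (g j).
  by rewrite big_imfset //= => ? ? _ _; exact: gI.
apply: big_fset_incl => [|i iB ig].
  by apply/fsubsetP => i /imfsetP[j /= jA' ->]; rewrite -memA'.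
apply: f0 => j ij; move/negP: ig; apply; rewrite ij; apply: in_imfset.
by rewrite /= memA' -ij.
Qed.

Lemma sums_to_bij (I J : choiceType) (f : I -> C) (g : J -> I) (g' : I -> J) s :
  cancel g g' -> cancel g' g -> sums_to f s -> sums_to (fun j => f (g j)) s.
Proof.
move=> gK g'K hs; apply: (@sums_to_inj _ _ _ g' _ (can_inj g'K)).
  by move=> j hj; case: (hj (g j)); rewrite gK.
by apply: eq_sums_to hs => i; rewrite g'K.
Qed.

Lemma sums_to_fibre (I J K : choiceType) (f : I -> C) (p : I -> K) k
    (g : J -> I) s :
  injective g -> (forall j, p (g j) = k) -> (forall i, p i = k -> exists j, i = g j) ->
  sums_to (fun j => f (g j)) s -> sums_to (fun i => if p i == k then f i else 0) s.
Proof.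
move=> gI gk kg hs; apply: (sums_to_inj gI).
  by move=> i ig; case: eqP => // /kg[j ij]; case: (ig j).
by apply: eq_sums_to hs => j; rewrite gk eqxx.
Qed.

Lemma norm_sums_to_le (I : choiceType) (f : I -> C) s M :
  (forall B : {fset I}, \sum_(i <- B) `|f i| <= M) -> sums_to f s -> `|s| <= M.
Proof.
move=> fM hs; have M0 : 0 <= M by have := fM fset0; rewrite big_seq_fset0.
rewrite real_leNgt ?normr_real ?ger0_real //; apply/negP => Ms.
have e0 : 0 < `|s| - M by rewrite subr_gt0.
have [A /(_ A (fsubset_refl A))] := hs _ e0; apply/negP.
rewrite -real_leNgt ?normr_real ?gtr0_real //.
rewrite lerBlDr; apply: (le_trans (y := `|\sum_(i <- A) f i - s| + `|\sum_(i <- A) f i|)).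
  rewrite -[X in `|X| <= _](subKr (\sum_(i <- A) f i)) distrC.
  by apply: le_trans (ler_normB _ _) _; rewrite addrC distrC.
by rewrite lerD2l; apply: le_trans (ler_norm_sum _ _ _) (fM A).
Qed.

(** * Absolute summability *)

Lemma abs_summable_le (I : choiceType) (f g : I -> C) :
  (forall i, `|f i| <= `|g i|) -> abs_summable g -> abs_summable f.
Proof.
by move=> fg [M hM]; exists M => B; apply: le_trans (hM B); apply: ler_sum.
Qed.

Lemma eq_abs_summable (I : choiceType) (f g : I -> C) :
  f =1 g -> abs_summable f -> abs_summable g.
Proof. by move=> fg; apply: abs_summable_le => i; rewrite fg. Qed.

Lemma abs_summableD (I : choiceType) (f g : I -> C) :
  abs_summable f -> abs_summable g -> abs_summable (fun i => f i + g i).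
Proof.
move=> [M hM] [N hN]; exists (M + N) => B.
apply: le_trans (lerD (hM B) (hN B)); rewrite -big_split /=.
by apply: ler_sum => i _; exact: ler_normD.
Qed.

Lemma abs_summableN (I : choiceType) (f : I -> C) :
  abs_summable f -> abs_summable (fun i => - f i).
Proof. by apply: abs_summable_le => i; rewrite normrN. Qed.

Definition bounded_family (T : Type) (u : T -> C) := exists M : C, forall i, `|u i| <= M.

Lemma abs_summableM (I : choiceType) (u f : I -> C) :
  bounded_family u -> abs_summable f -> abs_summable (fun i => u i * f i).
Proof.
move=> [N hN] [M hM]; exists (`|N| * M) => B.
apply: le_trans (_ : `|N| * \sum_(i <- B) `|f i| <= _); last by rewrite ler_wpM2l.
rewrite mulr_sumr; apply: ler_sum => i _; rewrite normrM ler_wpM2r //.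
have N0 : 0 <= N by apply: le_trans (hN i).
by rewrite (ger0_norm N0).
Qed.

Lemma bounded_cst (T : Type) (c : C) : bounded_family (fun _ : T => c).
Proof. by exists `|c|. Qed.

Lemma bounded_comp (T U : Type) (u : U -> C) (g : T -> U) :
  bounded_family u -> bounded_family (fun i => u (g i)).
Proof. by move=> [M hM]; exists M => i. Qed.

Lemma boundedM (T : Type) (u v : T -> C) :
  bounded_family u -> bounded_family v -> bounded_family (fun i => u i * v i).
Proof.
by move=> [M hM] [N hN]; exists (M * N) => i; rewrite normrM ler_pM.
Qed.

Lemma abs_summableZ (I : choiceType) (f : I -> C) c :
  abs_summable f -> abs_summable (fun i => c * f i).
Proof. by apply: abs_summableM; exact: bounded_cst. Qed.

Lemma abs_summable_inj (I J : choiceType) (f : I -> C) (g : J -> I) :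
  injective g -> abs_summable f -> abs_summable (fun j => f (g j)).
Proof.
move=> gI [M hM]; exists M => B; apply: le_trans (hM [fset g j | j in B]%fset).
by rewrite big_imfset //= => ? ? _ _; exact: gI.
Qed.

Lemma abs_summable_prod (I J : choiceType) (f : I -> C) (g : J -> C) :
  abs_summable f -> abs_summable g ->
  abs_summable (fun x : I * J => f x.1 * g x.2).
Proof.
move=> [M hM] [N hN]; exists (M * N) => B.
have N0 : 0 <= N by have := hN fset0; rewrite big_seq_fset0.
pose B1 := [fset x.1 | x in B]%fset.
apply: le_trans (_ : (\sum_(i <- B1) `|f i|) * N <= _); last by rewrite ler_wpM2r.
rewrite mulr_suml.
have -> : \sum_(x <- B) `|f x.1 * g x.2| =
    \sum_(i <- B1) \sum_(x <- B | x.1 == i) `|f i| * `|g x.2|.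
  rewrite (exchange_big_dep predT) //=; apply: eq_big_seq => x xB.
  rewrite big_mkcond /= (big_fsetD1 x.1) /=; last exact: in_imfset.
  rewrite eqxx big1_fset ?addr0 ?normrM // => i.
  by rewrite !inE => /andP[/negPf ix _] _; rewrite eq_sym ix.
apply: ler_sum => i _; rewrite -mulr_sumr ler_wpM2l //.
apply: le_trans (hN [fset x.2 | x in [fset x in B | x.1 == i]]%fset).
rewrite big_imfset /=; last first.
  move=> [x1 x2] [y1 y2]; rewrite !inE /= => /andP[_ /eqP ->] /andP[_ /eqP ->].
  by move=> ->.
rewrite -big_fset_condE /=.
by [].
Qed.

(** Re and Im of a complex family are differences of nonnegative real families, and a
    nonnegative family sums to the least upper bound of its finite partial sums. *)
Lemma sums_to_nonneg (I : choiceType) (g : I -> R) M :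
  (forall i, 0 <= g i) -> (forall B : {fset I}, \sum_(i <- B) g i <= M) ->
  exists s, sums_to (fun i => (g i)%:C%C) s.
Proof.
move=> g0 hM.
pose E := [set x | exists B : {fset I}, x = \sum_(i <- B) g i]%classic.
have supE : has_sup E.
  split; first by exists (\sum_(i <- fset0) g i); exists fset0.
  by exists M => x [B ->].
exists (sup E)%:C%C => e e0.
have eR : e = (complex.Re e)%:C%C by rewrite RRe_real ?gtr0_real.
have Re0 : 0 < complex.Re e by rewrite -ltcR -eR.
have [x [A ->] xA] := sup_adherent Re0 supE.
exists A => B AB; rewrite -rmorph_sum -rmorphB /= eR.
have AleB : \sum_(i <- A) g i <= \sum_(i <- B) g i.
  rewrite [leRHS](big_fsetID _ (mem A)) /=.
  have -> : [fset x | x in B & x \in mem A]%fset = A.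
    apply/fsetP => y; rewrite !inE; apply/andP/idP => [[]//|yA]; split=> //.
    by move/fsubsetP: AB; apply.
  by rewrite lerDl; apply: sumr_ge0.
have Bs : \sum_(i <- B) g i <= sup E by apply: ub_le_sup; [case: supE|exists B].
rewrite normc_def /= expr0n /= addr0 sqrtr_sqr ltcR ler0_norm ?subr_le0 //.
lra.
Qed.

Lemma abs_summable_sums_to (I : choiceType) (f : I -> C) :
  abs_summable f -> exists s, sums_to f s.
Proof.
move=> [M hM]; pose nr (z : C) := complex.Re `|z|.
have nrE z : (nr z)%:C%C = `|z| by rewrite RRe_real ?normr_real.
have ReM : forall B : {fset I}, \sum_(i <- B) nr (f i) <= complex.Re M.
  move=> B; have := hM B; rewrite lecE => /andP[_].
  by rewrite -(eq_bigr _ (fun i _ => nrE (f i))) -rmorph_sum.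
have nr0 z : 0 <= nr z by rewrite -ler0c nrE.
have leRe (z : C) : `|complex.Re z| <= nr z by rewrite -lecR nrE; exact: normc_ge_Re.
have leIm (z : C) : `|complex.Im z| <= nr z.
  have := leRe (- 'i%C * z); congr (_ <= _).
    by congr `|_|; case: z => a b; simpc.
  by rewrite /nr normrM normrN [X in X * _](_ : _ = 1) ?mul1r // normc_def /= expr0n /= expr1n add0r sqrtr1.
have [s0 h0] := sums_to_nonneg (fun i => nr0 (f i)) ReM.
have part (u : C -> R) : (forall z, `|u z| <= nr z) ->
    exists s, sums_to (fun i => (u (f i))%:C%C) s.
  move=> hu.
  have [||s hs] := @sums_to_nonneg I (fun i => u (f i) + nr (f i)) (complex.Re M + complex.Re M).
  - by move=> i; have := hu (f i); rewrite ler_norml => /andP[h _]; lra.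
  - move=> B; rewrite big_split /=; apply: lerD (ReM B).
    apply: le_trans (ReM B); apply: ler_sum => i _.
    by apply: le_trans (hu (f i)); exact: ler_norm.
  exists (s - s0); apply: eq_sums_to (sums_toB hs h0) => i.
  by rewrite rmorphD /= addrK.
have [s1 h1] := part (@complex.Re R) leRe; have [s2 h2] := part (@complex.Im R) leIm.
exists (s1 + 'i%C * s2); apply: eq_sums_to (sums_toD h1 (sums_toZ 'i%C h2)) => i.
by rewrite -complexE.
Qed.

Lemma sums_to_prod (I J : choiceType) (f : I -> C) (g : J -> C) s t :
  abs_summable f -> abs_summable g -> sums_to f s -> sums_to g t ->
  sums_to (fun x : I * J => f x.1 * g x.2) (s * t).
Proof.
move=> af ag hf hg.
have [u hu] := abs_summable_sums_to (abs_summable_prod af ag).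
suff -> : s * t = u by [].
apply: (sums_to_uniq (sums_toZr t hf)).
apply: (sums_to_fibres (p := fst) hu) => i.
apply: (@sums_to_fibre _ _ _ _ _ _ (fun j => (i, j))) => //=.
- by move=> j j' [].
- by move=> [i' j] /= ->; exists j.
- exact: sums_toZ.
Qed.

(** Fubini, for two arbitrary ways of bracketing an absolutely summable family. *)
Lemma sums_to_regroup (I K L : choiceType) (f : I -> C) (p : I -> K) (p' : I -> L)
    (F : K -> C) (G : L -> C) s :
  abs_summable f ->
  (forall k, sums_to (fun i => if p i == k then f i else 0) (F k)) ->
  (forall l, sums_to (fun i => if p' i == l then f i else 0) (G l)) ->
  sums_to F s -> sums_to G s.
Proof.
move=> /abs_summable_sums_to[t ht] hF hG hs.
by rewrite (sums_to_uniq hs (sums_to_fibres ht hF)); exact: sums_to_fibres ht hG.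
Qed.

(** Converse of [sums_to_fibres]: this is how a single sum is opened into a multiple one. *)
Lemma sums_to_expand (I K : choiceType) (f : I -> C) (p : I -> K) (F : K -> C) s :
  abs_summable f ->
  (forall k, sums_to (fun i => if p i == k then f i else 0) (F k)) ->
  sums_to F s -> sums_to f s.
Proof.
move=> /abs_summable_sums_to[t ht] hF hs.
by rewrite (sums_to_uniq hs (sums_to_fibres ht hF)).
Qed.

Lemma sums_to_fst (I J : choiceType) (f : I * J -> C) (F : I -> C) s :
  sums_to f s -> (forall i, sums_to (fun j => f (i, j)) (F i)) -> sums_to F s.
Proof.
move=> hs hF; apply: (sums_to_fibres (p := fst) hs) => i.
apply: (@sums_to_fibre _ _ _ _ _ _ (fun j => (i, j))) => //=.
- by move=> j j' [].
- by move=> [i' j] /= ->; exists j.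
Qed.

Lemma sums_to_pair (I J : choiceType) (f : I * J -> C) (F : I -> C) s :
  abs_summable f -> (forall i, sums_to (fun j => f (i, j)) (F i)) ->
  sums_to F s -> sums_to f s.
Proof.
move=> /abs_summable_sums_to[t ht] hF hs.
by rewrite (sums_to_uniq hs (sums_to_fst ht hF)).
Qed.

Lemma sums_to_snd (I J : choiceType) (f : I * J -> C) (F : J -> C) s :
  sums_to f s -> (forall j, sums_to (fun i => f (i, j)) (F j)) -> sums_to F s.
Proof.
move=> hs hF; apply: (sums_to_fibres (p := snd) hs) => j.
apply: (@sums_to_fibre _ _ _ _ _ _ (fun i => (i, j))) => //=.
- by move=> i i' [].
- by move=> [i j'] /= ->; exists i.
Qed.

Lemma sums_to_swap (I J : choiceType) (f : I * J -> C) (F : I -> C) (G : J -> C) s :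
  abs_summable f -> (forall i, sums_to (fun j => f (i, j)) (F i)) ->
  (forall j, sums_to (fun i => f (i, j)) (G j)) -> sums_to F s -> sums_to G s.
Proof.
move=> /abs_summable_sums_to[t ht] hF hG hs.
by rewrite (sums_to_uniq hs (sums_to_fst ht hF)); exact: sums_to_snd ht hG.
Qed.

End UnconditionalSums.

(** * Summability over the naturals and the integers *)

Section QPochhammer.
Variable R : realType.
Local Notation C := R[i].

Lemma ler_sum_fsubset (I : choiceType) (g : I -> C) (A B : {fset I}) :
  (A `<=` B)%fset -> (forall i, 0 <= g i) ->
  \sum_(i <- A) g i <= \sum_(i <- B) g i.
Proof.
move=> AB g0; rewrite [leRHS](big_fsetID _ (mem A)) /=.
have -> : [fset x | x in B & x \in mem A]%fset = A.
  apply/fsetP => y; rewrite !inE; apply/andP/idP => [[]//|yA]; split=> //.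
  by move/fsubsetP: AB; apply.
by rewrite lerDl; apply: sumr_ge0.
Qed.

Lemma mem_fset_iota i N : (i \in [fset j in iota 0 N]%fset) = (i < N)%N.
Proof. by rewrite in_fset /= mem_iota. Qed.

Lemma sum_fset_iota (f : nat -> C) N :
  \sum_(i <- [fset i in iota 0 N]%fset) f i = \sum_(i < N) f i.
Proof.
rewrite -[RHS](big_mkord predT f) /index_iota subn0; apply: perm_big.
by apply: uniq_perm; rewrite ?iota_uniq // => i; rewrite inE.
Qed.

Lemma fsubset_iota (B : {fset nat}) : exists N, (B `<=` [fset i in iota 0 N])%fset.
Proof.
exists (\max_(i <- B) i).+1; apply/fsubsetP => i iB.
rewrite mem_fset_iota ltnS; by rewrite (big_fsetD1 i) //= leq_maxl.
Qed.

Lemma abs_summable_nat (f : nat -> C) M :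
  (forall N, \sum_(i < N) `|f i| <= M) -> abs_summable f.
Proof.
move=> hM; exists M => B; have [N BN] := fsubset_iota B.
apply: le_trans (hM N); rewrite -(sum_fset_iota (fun i => `|f i|)).
exact: ler_sum_fsubset.
Qed.

Lemma sums_to_cvg (f : nat -> C) s :
  sums_to f s -> (\sum_(i < n) f i @[n --> \oo] --> s)%classic.
Proof.
move=> hs; apply/cvgrPdist_lt => e e0; have [A hA] := hs e e0.
have [N AN] := fsubset_iota A; exists N => // n /= Nn.
rewrite distrC -sum_fset_iota; apply: hA; apply: fsubset_trans AN _.
apply/fsubsetP => i ; rewrite !mem_fset_iota => iN.
exact: leq_trans iN Nn.
Qed.

Lemma geometric_le (r : C) n : 0 <= r -> r < 1 -> \sum_(i < n) r ^+ i <= (1 - r)^-1.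
Proof.
move=> r0 r1; have r1' : 0 < 1 - r by rewrite subr_gt0.
rewrite -[leRHS]mul1r ler_pdivlMr // mulrC -[1 - r]opprB mulNr -subrX1 opprB.
by rewrite gerBl exprn_ge0.
Qed.

Lemma abs_summable_geometric (r : C) : `|r| < 1 -> abs_summable (fun n => r ^+ n).
Proof.
move=> r1; apply: (@abs_summable_nat _ (1 - `|r|)^-1) => N.
by under eq_bigr do rewrite normrX; exact: geometric_le.
Qed.

Lemma abs_summable_int (f : int -> C) :
  abs_summable (fun n => f n%:Z) -> abs_summable (fun n => f (- n%:Z)) ->
  abs_summable f.
Proof.
move=> [M hM] [N hN]; exists (M + N) => B.
have [K BK] := fsubset_iota [fset absz n | n in B]%fset.
pose A1 := [fset n%:Z | n in [fset j in iota 0 K]]%fset.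
pose A2 := [fset - n%:Z | n in [fset j in iota 0 K]]%fset.
have BA : (B `<=` A1 `|` A2)%fset.
  apply/fsubsetP => n nB; rewrite inE; apply/orP.
  have nK : absz n \in [fset j in iota 0 K]%fset.
    by apply: (fsubsetP BK); exact: in_imfset.
  case: (lerP 0 n) => n0.
    left; apply/imfsetP; exists (absz n) => //=; by rewrite gez0_abs.
  right; apply/imfsetP; exists (absz n) => //=; by rewrite lez0_abs ?opprK // ltW.
apply: le_trans (ler_sum_fsubset BA (fun i => normr_ge0 _)) _.
apply: le_trans (_ : \sum_(i <- A1) `|f i| + \sum_(i <- A2) `|f i| <= _).
  rewrite (big_fsetID _ (mem A1)) /=; apply: lerD.
    by apply: ler_sum_fsubset => //; apply/fsubsetP => i; rewrite !inE => /andP[].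
  apply: ler_sum_fsubset => //; apply/fsubsetP => i; rewrite !inE.
  by move=> /andP[/orP[->|->]].
apply: lerD.
  apply: le_trans (hM [fset j in iota 0 K]%fset).
  by rewrite big_imfset //= => ? ? _ _ [].
apply: le_trans (hN [fset j in iota 0 K]%fset).
by rewrite big_imfset //= => ? ? _ _ /oppr_inj[].
Qed.

Lemma ler_expz_int (r : C) (m n : int) : 0 < r -> r < 1 -> m <= n -> r ^ n <= r ^ m.
Proof.
move=> r0 r1 mn; rewrite -[n](subrK m) expfzDr ?gt_eqF // mulrC.
have [k ->] : exists k : nat, n - m = k by exists (absz (n - m)); rewrite gez0_abs ?subr_ge0.
rewrite ger_pMr ?exprz_gt0 //; exact: exprn_ile1 (ltW r0) (ltW r1).
Qed.

Lemma norm_expz (x : C) (n : int) : `|x ^ n| = `|x| ^ n.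
Proof. by case: n => n; rewrite /exprz ?normfV normrX. Qed.

(** The exponent is at least [|n| - (|c| + 1)^2], so that two geometric series dominate. *)
Lemma abs_summable_quadratic (h : C) (c : int) :
  0 < `|h| -> `|h| < 1 -> abs_summable (fun n : int => h ^ (n * n + c * n)).
Proof.
move=> h0 h1; pose K : int := (`|c| + 1) * (`|c| + 1).
have key (n : int) (m : nat) : `|n| = m%:Z -> `|h ^ (n * n + c * n)| <= `| `|h| ^ (- K) * `|h| ^+ m|.
  move=> nm; rewrite norm_expz normrM normrX normr_id [X in _ <= X * _]ger0_norm ?exprz_ge0 //.
  rewrite -[X in _ <= _ * X]/(`|h| ^ m%:Z) -expfzDr ?gt_eqF // ler_expz_int // -nm /K.
  have c0 := ler_norm (- c); have c1 := ler_norm c; rewrite normrN in c0.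
  have : n * n = `|n| * `|n| by rewrite -normrM ger0_norm // sqr_ge0.
  have : - (`|c| * `|n|) <= c * n by rewrite -normrM lerNl; apply: le_trans (ler_norm _) _; rewrite normrN.
  have := mulr_ge0 (normr_ge0 n) (normr_ge0 c).
  have : 0 <= (`|n| - (`|c| + 1)) * (`|n| - (`|c| + 1)) by exact: sqr_ge0.
  have := normr_ge0 c; have := normr_ge0 n; nia.
have g := abs_summableZ (`|h| ^ (- K)) (abs_summable_geometric (_ : `| `|h| | < 1)).
have g1 : abs_summable (fun i : nat => `|h| ^ (- K) * `|h| ^+ i).
  by apply: g; rewrite normr_id.
by apply: abs_summable_int; apply: abs_summable_le g1 => n; apply: key; rewrite ?normrN.
Qed.

(** * q-shifted factorials *)

Lemma qpochS (a x : C) n : qpoch a x n.+1 = qpoch a x n * (1 - a * x ^+ n).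
Proof. by rewrite /qpoch big_ord_recr. Qed.

Lemma qpoch0 (a x : C) : qpoch a x 0 = 1.
Proof. by rewrite /qpoch big_ord0. Qed.

Lemma qpochD (a x : C) m n : qpoch a x (m + n) = qpoch a x m * qpoch (a * x ^+ m) x n.
Proof.
elim: n => [|n IH]; first by rewrite addn0 qpoch0 mulr1.
by rewrite addnS !qpochS IH mulrA exprD mulrA.
Qed.

Lemma subr_neq0_norm (u : C) : `|u| < 1 -> 1 - u != 0.
Proof.
by move=> u1; rewrite subr_eq0; apply: contraTneq u1 => <-; rewrite normr1 ltxx.
Qed.

Lemma qpoch_neq0 (a x : C) n : `|a| < 1 -> `|x| <= 1 -> qpoch a x n != 0.
Proof.
move=> a1 x1; apply/prodf_neq0 => k _; apply: subr_neq0_norm.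
by rewrite normrM normrX; apply: le_lt_trans a1; rewrite ler_piMr // exprn_ile1.
Qed.

Lemma prod_1D_le (c r : R) : 0 <= c -> 0 <= r -> r < 1 ->
  exists M : R, forall n, \prod_(k < n) (1 + c * r ^+ k) <= M.
Proof.
move=> c0 r0 r1; exists (expR (c * (1 - r)^-1)) => n.
apply: le_trans (_ : expR (\sum_(k < n) c * r ^+ k) <= _).
  rewrite expR_sum; apply: ler_prod => k _; rewrite expR_ge1Dx.
  by rewrite addr_ge0 // mulr_ge0 // exprn_ge0.
rewrite ler_expR -mulr_sumr ler_wpM2l //.
have r1' : 0 < 1 - r by rewrite subr_gt0.
rewrite -[leRHS]mul1r ler_pdivlMr // mulrC -[1 - r]opprB mulNr -subrX1 opprB.
by rewrite gerBl exprn_ge0.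
Qed.

(** [1 / (1 - u) <= 1 + u / (1 - d)] for [u <= d < 1] turns a lower bound on a
    product into an upper bound of the previous kind. *)
Lemma qpoch_bounds (d : C) : 0 <= d -> d < 1 -> exists M : C,
  forall (a x : C) n, `|a| <= d -> `|x| <= d ->
  `|qpoch a x n| <= M /\ `|(qpoch a x n)^-1| <= M.
Proof.
move=> d0 d1; have dR : d = (complex.Re d)%:C%C by rewrite RRe_real ?ger0_real.
set r := complex.Re d in dR; have r0 : 0 <= r by rewrite -ler0c -dR.
have r1 : r < 1 by rewrite -ltcR -dR.
have r1' : 0 < 1 - r by rewrite subr_gt0.
have [M hM] := prod_1D_le (divr_ge0 r0 (ltW r1')) r0 r1.
exists M%:C%C => a x n ad xd.
have d1' : 0 < 1 - d by rewrite subr_gt0.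
have PE : \prod_(k < n) (1 + d / (1 - d) * d ^+ k) <= M%:C%C.
  rewrite (_ : \prod_(k < n) _ = (\prod_(k < n) (1 + r / (1 - r) * r ^+ k))%:C%C) ?lecR //.
  rewrite rmorph_prod; apply: eq_bigr => k _.
  by rewrite rmorphD rmorph1 !rmorphM rmorphXn fmorphV rmorphB rmorph1 /= -dR.
have uk k : `|a * x ^+ k| <= d * d ^+ k.
  by rewrite normrM normrX ler_pM ?exprn_ge0 // lerXn2r ?nnegrE.
split; apply: le_trans PE; rewrite ?normfV /qpoch normr_prod.
  apply: ler_prod => k _; rewrite normr_ge0 /=.
  apply: le_trans (ler_normB _ _) _; rewrite normr1 lerD2l.
  apply: le_trans (uk k) _; rewrite ler_wpM2r ?exprn_ge0 //.
  by rewrite ler_pdivlMr // ler_piMr // gerBl.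
rewrite -prodfV; apply: ler_prod => k _; rewrite invr_ge0 normr_ge0 /=.
have dk1 : d ^+ k <= 1 by apply: exprn_ile1 => //; exact: ltW.
have dk0 : 0 <= d ^+ k by rewrite exprn_ge0.
have lk : 1 - d * d ^+ k <= `|1 - a * x ^+ k|.
  apply: le_trans (lerB_dist _ _); rewrite normr1 lerD2l lerN2; exact: uk.
have l0 : 0 < 1 - d * d ^+ k by rewrite subr_gt0; apply: le_lt_trans d1; rewrite ler_piMr.
apply: le_trans (_ : (1 - d * d ^+ k)^-1 <= _).
  by rewrite lef_pV2 ?posrE //; apply: lt_le_trans lk.
rewrite -[leLHS]mul1r ler_pdivrMr //.
have -> : (1 + d / (1 - d) * d ^+ k) * (1 - d * d ^+ k) =
   1 + d ^+ 2 / (1 - d) * d ^+ k * (1 - d ^+ k).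
  by field; rewrite gt_eqF.
rewrite lerDl mulr_ge0 ?subr_ge0 // mulr_ge0 // divr_ge0 ?exprn_ge0 //; exact: ltW.
Qed.

Lemma qpoch_bounded (a x : C) : `|x| < 1 -> bounded_family (qpoch a x).
Proof.
move=> x1; pose nr (z : C) := complex.Re `|z|.
have nrE z : (nr z)%:C%C = `|z| by rewrite RRe_real ?normr_real.
have nr0 z : 0 <= nr z by rewrite -ler0c nrE.
have nx1 : nr x < 1 by rewrite -ltcR nrE.
have [M hM] := prod_1D_le (nr0 a) (nr0 x) nx1.
exists M%:C%C => n; rewrite /qpoch normr_prod.
apply: le_trans (_ : (\prod_(k < n) (1 + nr a * nr x ^+ k))%:C%C <= _); last first.
  by rewrite lecR; apply: hM.
rewrite rmorph_prod /=; apply: ler_prod => k _; rewrite normr_ge0 /=.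
rewrite rmorphD rmorph1 rmorphM rmorphXn /= !nrE.
by apply: le_trans (ler_normB _ _) _; rewrite normr1 normrM normrX.
Qed.

(** The increments [- a x^n (a; x)_n] are summable because the products are bounded. *)
Lemma qpoch_cvg (a x : C) : `|x| < 1 ->
  (qpoch a x n @[n --> \oo] --> qpoch_inf a x)%classic.
Proof.
move=> x1.
have sm : abs_summable (fun k => - (a * qpoch a x k) * x ^+ k).
  apply: abs_summableM (abs_summable_geometric x1).
  have [M hM] := boundedM (bounded_cst nat a) (qpoch_bounded a x1).
  by exists M => i; rewrite normrN.
have [s hs] := abs_summable_sums_to sm.
have cv : (qpoch a x n @[n --> \oo] --> 1 + s)%classic.
  have -> : qpoch a x = (fun n => 1 + \sum_(i < n) (- (a * qpoch a x i) * x ^+ i)).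
    apply/funext; elim=> [|n IH]; first by rewrite qpoch0 big_ord0 addr0.
    by rewrite big_ord_recr /= addrA -IH qpochS; ring.
  by apply: cvgD; [exact: cvg_cst|exact: (sums_to_cvg hs)].
by rewrite /qpoch_inf (cvg_lim _ cv) //; exact: norm_hausdorff.
Qed.

Lemma cvg_uniq (u : nat -> C) (l l' : C) :
  (u n @[n --> \oo] --> l -> u n @[n --> \oo] --> l' -> l = l')%classic.
Proof. by apply: cvg_unique; exact: norm_hausdorff. Qed.

Lemma cvg_addn (u : nat -> C) (l : C) m :
  (u n @[n --> \oo] --> l)%classic -> (u (m + n)%N @[n --> \oo] --> l)%classic.
Proof.
move=> /cvgrPdist_lt h; apply/cvgrPdist_lt => e e0; have [N _ hN] := h e e0.
by exists N => // n /= Nn; apply: hN => /=; apply: leq_trans Nn (leq_addl _ _).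
Qed.

Lemma cvg_expr_complex (x : C) : `|x| < 1 -> (x ^+ n @[n --> \oo] --> 0)%classic.
Proof.
move=> x1; have [s hs] := abs_summable_sums_to (abs_summable_geometric x1).
have cs := sums_to_cvg hs; have cs1 := cvg_addn 1 cs.
rewrite -(subrr s) (_ : (fun n => x ^+ n) =
    (fun n => \sum_(i < 1 + n) x ^+ i - \sum_(i < n) x ^+ i)).
  by apply: cvgB; [exact: cs1|exact: cs].
by apply/funext => n; rewrite add1n big_ord_recr /= addrC addrK.
Qed.

Lemma cvg_geometric (x l M : C) (t : nat -> C) : `|x| < 1 ->
  (forall n, `|t n - l| <= M * `|x| ^+ n) -> (t n @[n --> \oo] --> l)%classic.
Proof.
move=> x1 tl; apply/cvgrPdist_lt => e e0.
have M1 : 0 < `|M| + 1 by rewrite ltr_wpDl.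
have := cvg_expr_complex x1; move=> /cvgrPdist_lt/(_ (e / (`|M| + 1)) (divr_gt0 e0 M1)).
case=> N _ hN; exists N => // n /= Nn; have := hN n Nn; rewrite /= sub0r normrN normrX => h.
rewrite distrC; apply: le_lt_trans (tl n) _.
have M0 : 0 <= M.
  by have := le_trans (normr_ge0 _) (tl 0%N); rewrite expr0 mulr1.
apply: le_lt_trans (_ : (`|M| + 1) * `|x| ^+ n < _).
  by rewrite ler_wpM2r ?exprn_ge0 // ger0_norm // lerDl.
by rewrite mulrC -ltr_pdivlMr.
Qed.

Lemma cvg_norm_le (u : nat -> C) (l M : C) :
  (u n @[n --> \oo] --> l)%classic -> (forall n, `|u n| <= M) -> `|l| <= M.
Proof.
move=> ul uM; have M0 : 0 <= M by apply: le_trans (uM 0%N).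
rewrite real_leNgt ?normr_real ?ger0_real //; apply/negP => Ml.
move/cvgrPdist_lt: ul => /(_ (`|l| - M)); rewrite subr_gt0 => /(_ Ml)[N _ /(_ N (leqnn N))] /=.
apply/negP; rewrite -real_leNgt ?normr_real ?realB ?ger0_real //.
by rewrite lerBlDr; apply: le_trans (lerD (lexx _) (uM N)); rewrite -[X in `|X| <= _](subrK (u N)) ler_normD.
Qed.

Lemma cvg_norm_ge (u : nat -> C) (l m : C) : 0 <= m ->
  (u n @[n --> \oo] --> l)%classic -> (forall n, m <= `|u n|) -> m <= `|l|.
Proof.
move=> m0 ul um; rewrite real_leNgt ?normr_real ?ger0_real //; apply/negP => lm.
move/cvgrPdist_lt: ul => /(_ (m - `|l|)); rewrite subr_gt0 => /(_ lm)[N _ /(_ N (leqnn N))] /=.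
apply/negP; rewrite -real_leNgt ?normr_real ?realB ?ger0_real //.
by rewrite lerBlDr; apply: le_trans (um N) _; rewrite -[X in `|X| <= _](subrK l) distrC ler_normD.
Qed.

Lemma qpoch_infD (a x : C) n : `|x| < 1 ->
  qpoch_inf a x = qpoch a x n * qpoch_inf (a * x ^+ n) x.
Proof.
move=> x1; apply: (@cvg_uniq (fun m => qpoch a x (n + m)%N)).
  by apply: cvg_addn; exact: qpoch_cvg.
rewrite (_ : (fun m => _) = (fun m => qpoch a x n * qpoch (a * x ^+ n) x m)).
  by apply: cvgM; [exact: cvg_cst|exact: qpoch_cvg].
by apply/funext => m; rewrite qpochD.
Qed.

Lemma qpoch_inf_bounds (d : C) : 0 <= d -> d < 1 -> exists M : C,
  forall a x : C, `|a| <= d -> `|x| <= d ->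
  [/\ `|qpoch_inf a x| <= M, `|(qpoch_inf a x)^-1| <= M & qpoch_inf a x != 0].
Proof.
move=> d0 d1; have [M hM] := qpoch_bounds d0 d1; exists M => a x ad xd.
have x1 : `|x| < 1 by apply: le_lt_trans d1.
have ul := @qpoch_cvg a x x1.
have M1 : 1 <= M.
  by have [+ _] := hM a x 0%N ad xd; rewrite qpoch0 normr1.
have M0 : 0 < M by apply: lt_le_trans M1.
have ge n : M^-1 <= `|qpoch a x n|.
  have [_] := hM a x n ad xd; rewrite normfV => h.
  have u0 : qpoch a x n != 0 by apply: qpoch_neq0; [exact: le_lt_trans d1|exact: ltW].
  by rewrite -[X in _ <= X]invrK lef_pV2 ?posrE ?invr_gt0 ?normr_gt0.
have lge : M^-1 <= `|qpoch_inf a x|.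
  by apply: cvg_norm_ge ul ge; rewrite invr_ge0 ltW.
have l0 : 0 < `|qpoch_inf a x| by apply: lt_le_trans lge; rewrite invr_gt0.
split; last by rewrite -normr_gt0.
  by apply: cvg_norm_le ul _ => n; have [] := hM a x n ad xd.
by rewrite normfV -[leRHS]invrK lef_pV2 ?posrE ?invr_gt0.
Qed.

Lemma qpoch_split_odd (a y : R[i]) n :
  qpoch a y (2 * n).+1 = qpoch a (y ^+ 2) n.+1 * qpoch (a * y) (y ^+ 2) n.
Proof.
elim: n => [|n IH]; first by rewrite !qpochS !qpoch0 !expr0 !mulr1.
rewrite (_ : 2 * n.+1 = (2 * n).+2)%N; last by lia.
rewrite qpochS [qpoch _ _ (2 * n).+2]qpochS IH (qpochS _ _ n.+1) (qpochS (a * y)).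
rewrite -!(exprM y) !mulnS !exprS; ring.
Qed.

End QPochhammer.

(** * Gaussian binomials *)

Section GaussBinomials.
Variable R : realType.
Local Notation C := R[i].

Lemma sums_to_fin (I : finType) (f : I -> C) : sums_to f (\sum_i f i).
Proof.
have := @sums_to_finite R I f [fset i in enum I]%fset.
rewrite (_ : \sum_(i <- [fset i in enum I]%fset) f i = \sum_i f i).
  by apply=> i; rewrite in_fset /= mem_enum.
rewrite -big_enum; apply: perm_big; apply: uniq_perm => //; first exact: enum_uniq.
by move=> i; rewrite in_fset /=.
Qed.

Lemma sums_to_recl (f : nat -> C) s :
  sums_to (fun n => f n.+1) s -> sums_to f (f 0%N + s).
Proof.
move=> hs; pose f0 n := if n is 0%N then f 0%N else 0.
pose f1 n := if n is k.+1 then f k.+1 else 0.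
have h1 : sums_to f1 s.
  apply: (sums_to_inj succn_inj) => [[|n] hn //|]; last exact: hs.
  by case: (hn n).
have h0 : sums_to f0 (f 0%N).
  have := @sums_to_finite R nat f0 [fset 0%N]%fset; rewrite big_seq_fset1; apply.
  by case=> //; rewrite !inE.
by apply: eq_sums_to (sums_toD h0 h1) => -[|n]; rewrite /= ?addr0 ?add0r.
Qed.

(** A base [x] is written as the square of a nome [h], so that the powers
    [x^(n (n - 1) / 2)] have integral exponents in [h]. *)
Section Nome.
Variable h : C.
Hypotheses (h0 : 0 < `|h|) (h1 : `|h| < 1).
Local Notation x := (h ^+ 2).

Lemma nome_neq0 : h != 0. Proof. by rewrite -normr_gt0. Qed.

Lemma sqr_nomeX n : x ^+ n = h ^ (2 * n%:Z).
Proof. by rewrite -exprM exprnP PoszM. Qed.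

Lemma norm_sqr_nome_lt1 : `|x| < 1.
Proof. by rewrite normrX exprn_ilt1. Qed.

Lemma qfact_neq0 n : qpoch x x n != 0.
Proof. by apply: qpoch_neq0; rewrite ?ltW // norm_sqr_nome_lt1. Qed.

Lemma qfactS n : qpoch x x n.+1 = qpoch x x n * (1 - h ^ (2 * n%:Z + 2)).
Proof.
rewrite qpochS sqr_nomeX; congr (_ * (1 - _)).
by rewrite -[x]/(h ^ 2%:Z) -expfzDr ?nome_neq0 // addrC.
Qed.

Lemma bounded_qfactV : bounded_family (fun n => (qpoch x x n)^-1).
Proof.
have [M hM] := qpoch_bounds (normr_ge0 x) norm_sqr_nome_lt1.
by exists M => n; have [] := hM x x n (lexx _) (lexx _).
Qed.

Lemma bounded_expz (T : Type) (e : T -> int) : (forall i, 0 <= e i) ->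
  bounded_family (fun i => h ^ (e i)).
Proof.
move=> e0; exists 1 => i; rewrite norm_expz -[leRHS](expr0z `|h|).
exact: ler_expz_int.
Qed.

Lemma bounded_expr (T : Type) (z : C) (e : T -> nat) : `|z| <= 1 ->
  bounded_family (fun i => z ^+ e i).
Proof. by move=> z1; exists 1 => i; rewrite normrX exprn_ile1. Qed.

Lemma abs_summable_nome : abs_summable (fun n : nat => h ^ (n%:Z * n%:Z)).
Proof.
have PI : injective Posz by move=> m n [].
have := abs_summable_inj PI (abs_summable_quadratic 0 h0 h1).
by apply: eq_abs_summable => n; rewrite mul0r addr0.
Qed.

Lemma abs_summable_nome_sub : abs_summable (fun n : nat => h ^ (n%:Z * n%:Z - n%:Z)).
Proof.
have PI : injective Posz by move=> m n [].
have := abs_summable_inj PI (abs_summable_quadratic (-1) h0 h1).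
by apply: eq_abs_summable => n; rewrite mulN1r.
Qed.

Definition gauss m k : C := qpoch x x m / (qpoch x x k * qpoch x x (m - k)).

Lemma gauss_pascal m k : (k < m)%N ->
  gauss m.+1 k.+1 = gauss m k.+1 + h ^ (2 * (m%:Z - k%:Z)) * gauss m k.
Proof.
move=> km; rewrite /gauss subSS -(subnSK km) !qfactS.
have := qfact_neq0 k.+1; have := qfact_neq0 (m - k.+1).+1; rewrite !qfactS.
have -> : h ^ (2 * m%:Z + 2) = h ^ (2 * (m - k.+1)%N%:Z + 2) * h ^ (2 * k%:Z + 2).
  by rewrite -expfzDr ?nome_neq0 //; congr (_ ^ _); lia.
have -> : 2 * (m%:Z - k%:Z) = 2 * (m - k.+1)%N%:Z + 2 by lia.
rewrite !mulf_eq0 !negb_or => /andP[v0 Y0] /andP[u0 X0].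
by field; apply/and4P.
Qed.

Lemma sum_gauss_pascal m (phi : nat -> C) :
  \sum_(r < m.+2) gauss m.+1 r * phi r =
  \sum_(r < m.+1) gauss m r * phi r +
  \sum_(r < m.+1) gauss m r * h ^ (2 * (m%:Z - r%:Z)) * phi r.+1.
Proof.
rewrite big_ord_recl [X in _ + X = _]big_ord_recr.
rewrite [X in _ = X + _]big_ord_recl [X in _ = _ + X]big_ord_recr /=.
have g0 n : gauss n 0 = 1.
  by rewrite /gauss subn0 qpoch0 mul1r divff ?qfact_neq0.
have gn n : gauss n n = 1.
  by rewrite /gauss subnn qpoch0 mulr1 divff ?qfact_neq0.
rewrite !g0 !gn subrr mulr0 expr0z !mul1r -!addrA; congr (_ + _).
rewrite addrA; congr (_ + _); rewrite -big_split /=; apply: eq_bigr => k _.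
by rewrite /bump /= add1n gauss_pascal // mulrDl [X in _ + X * _]mulrC.
Qed.

Lemma q_binomial m z :
  sums_to (fun ik : nat * nat => if (ik.1 + ik.2)%N == m then
      h ^ (ik.2%:Z * ik.2%:Z) * z ^+ ik.2 / (qpoch x x ik.1 * qpoch x x ik.2) else 0)
    (qpoch (- (h * z)) x m / qpoch x x m).
Proof.
have T : \sum_(k < m.+1) gauss m k * (h ^ (k%:Z * k%:Z) * z ^+ k) = qpoch (- (h * z)) x m.
  elim: m => [|m IH].
    by rewrite big_ord1 /gauss !qpoch0 expr0z expr0 !(mulr1, divr1).
  rewrite (sum_gauss_pascal _ (fun k => h ^ (k%:Z * k%:Z) * z ^+ k)) qpochS -IH.
  rewrite mulrDr mulr1; congr (_ + _); rewrite mulr_suml; apply: eq_bigr => k _.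
  rewrite sqr_nomeX exprS.
  have -> : h ^ (k.+1%:Z * k.+1%:Z) = h * h ^ (2 * k%:Z) * h ^ (k%:Z * k%:Z).
    by rewrite -{2}[h]expr1z -!expfzDr ?nome_neq0 //; congr (_ ^ _); lia.
  have -> : h ^ (2 * m%:Z) = h ^ (2 * (m%:Z - k%:Z)) * h ^ (2 * k%:Z).
    by rewrite -!expfzDr ?nome_neq0 //; congr (_ ^ _); lia.
  by ring.
rewrite -T mulr_suml.
apply: (@sums_to_fibre _ _ _ _ _ _ _ (fun k : 'I_m.+1 => ((m - k)%N, val k))).
- by move=> k l [_]; exact: val_inj.
- by move=> k /=; rewrite subnK // -ltnS.
- move=> [i k] /= ikm; have km : (k < m.+1)%N by lia.
  by exists (Ordinal km); rewrite /= -ikm addnK.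
apply: eq_sums_to (sums_to_fin _) => k /=.
rewrite /gauss; have := qfact_neq0 k; have := qfact_neq0 (m - k); have := qfact_neq0 m.
by move=> ? ? ?; field; apply/and3P.
Qed.

End Nome.
End GaussBinomials.

(** * Euler's two sums *)

Section EulerSums.
Variables (R : realType) (h : R[i]).
Hypotheses (h0 : 0 < `|h|) (h1 : `|h| < 1).
Local Notation x := (h ^+ 2).
Local Notation x1 := (norm_sqr_nome_lt1 h1).
Local Notation hn0 := (nome_neq0 h0).

Lemma euler_qpoch_inf_termE (z : R[i]) n :
  h ^ (n%:Z * n%:Z) * z ^+ n = (h * z) ^+ n * h ^ (n%:Z * n%:Z - n%:Z).
Proof.
rewrite exprMn mulrAC [h ^+ n]exprnP -expfzDr ?hn0 //.
by congr (_ ^ _ * _); lia.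
Qed.

Lemma abs_summable_euler_qpoch_inf (z : R[i]) : `|h * z| <= 1 ->
  abs_summable (fun n : nat => h ^ (n%:Z * n%:Z) * z ^+ n / qpoch x x n).
Proof.
move=> z1.
have b := boundedM (bounded_expr (id : nat -> nat) z1) (bounded_qfactV h1).
apply: eq_abs_summable (abs_summableM b (abs_summable_nome_sub h0 h1)) => n.
by rewrite euler_qpoch_inf_termE; ring.
Qed.

(** The sum [e z] satisfies [e z = (1 + h z) e (x z)]; iterating this peels off the factors
    of the product, and [e (x^n z)] tends to [1]. *)
Lemma euler_qpoch_inf (z : R[i]) : `|h * z| <= 1 ->
  sums_to (fun n : nat => h ^ (n%:Z * n%:Z) * z ^+ n / qpoch x x n)
    (qpoch_inf (- (h * z)) x).
Proof.
pose t (z : R[i]) (n : nat) := h ^ (n%:Z * n%:Z) * z ^+ n / qpoch x x n.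
have ex z' : exists s, `|h * z'| <= 1 -> sums_to (t z') s.
  have [z1|_] := boolP (`|h * z'| <= 1); last by exists 0.
  by have [s hs] := abs_summable_sums_to (abs_summable_euler_qpoch_inf z1); exists s.
have [e he] := choice ex.
have xz n z' : `|h * z'| <= 1 -> `|h * (x ^+ n * z')| <= 1.
  move=> z1; rewrite mulrCA [ `|_ * (h * _)|]normrM mulr_ile1 ?normr_ge0 //.
  by rewrite [ `|_ ^+ n|]normrX exprn_ile1 // ltW // x1.
have fe z' : `|h * z'| <= 1 -> e z' = (1 + h * z') * e (x * z').
  move=> z1; have xz1 : `|h * (x * z')| <= 1 by rewrite -[x]expr1; exact: xz.
  suff -> : e z' = e (x * z') + (0 + h * z' * e (x * z')) by ring.
  apply: sums_to_uniq (he _ z1) _.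
  apply: (@eq_sums_to _ _ (fun n => t (x * z') n + (if n is k.+1 then h * z' * t (x * z') k else 0))).
    case=> [|k]; rewrite /t ?expr0 ?addr0 // qfactS //.
    have := qfact_neq0 h1 k.+1; rewrite qfactS // mulf_eq0 negb_or => /andP[u0' v0].
    have -> : h ^ (k.+1%:Z * k.+1%:Z) = h ^ (k%:Z * k%:Z) * h ^ (2 * k%:Z) * h.
      by rewrite -{4}[h]expr1z -!expfzDr ?hn0 //; congr (_ ^ _); lia.
    have E : h ^ (2 * k%:Z + 2) = h ^ (2 * k%:Z) * x by rewrite expfzDr ?hn0.
    rewrite E in v0 *; rewrite (exprMn k.+1 x z') (exprMn k x z') [x ^+ k.+1]exprS sqr_nomeX (exprS z' k).
    by field; rewrite u0' v0.
  apply: sums_toD; first exact: he.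
  by apply: (@sums_to_recl _ (fun n => if n is k.+1 then _ else 0)); apply: sums_toZ; exact: he.
have fn n z' : `|h * z'| <= 1 -> e z' = qpoch (- (h * z')) x n * e (x ^+ n * z').
  move=> z1; elim: n => [|n IH]; first by rewrite qpoch0 expr0 !mul1r.
  by rewrite IH fe ?xz // qpochS (mulrA x) -exprS mulrA; congr (_ * _); ring.
have [M hM] := abs_summableM (bounded_qfactV h1) (abs_summable_nome_sub h0 h1).
have e1 z' : `|h * z'| <= 1 -> `|e z' - 1| <= `|h * z'| * M.
  move=> z1; apply: norm_sums_to_le (_ : sums_to (fun n => if n is k.+1 then t z' k.+1 else 0) _); last first.
    have := sums_toB (he _ z1) (@sums_to_finite _ _ (fun n => if n is 0%N then 1 else 0) [fset 0%N]%fset _).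
    rewrite big_seq_fset1 => h'; apply: eq_sums_to (h' _); last by case=> //; rewrite !inE.
    by case=> [|n]; rewrite ?subr0 // /t !expr0z expr0 qpoch0 !mul1r invr1 subrr.
  move=> B; apply: le_trans (_ : `|h * z'| * \sum_(i <- B) `|(qpoch x x i)^-1 * h ^ (i%:Z * i%:Z - i%:Z)| <= _); last by rewrite ler_wpM2l.
  rewrite mulr_sumr; apply: ler_sum => -[|n] _; first by rewrite normr0 mulr_ge0.
  rewrite /t euler_qpoch_inf_termE -mulrA [X in _ * X]mulrC [leLHS]normrM.
  apply: ler_wpM2r => //; rewrite exprS normrM.
  by rewrite ler_piMr // normrX exprn_ile1.
move=> z1; have -> : qpoch_inf (- (h * z)) x = e z; last exact: he.
apply: (@cvg_uniq _ (fun n => qpoch (- (h * z)) x n * e (x ^+ n * z))).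
  rewrite -[qpoch_inf _ _]mulr1; apply: cvgM; first exact: qpoch_cvg x1.
  apply: (cvg_geometric (M := M) x1) => n; apply: le_trans (e1 _ (xz n _ z1)) _.
  have M0 : 0 <= M by have := hM fset0; rewrite big_seq_fset0.
  rewrite mulrC ler_wpM2l // mulrCA [ `|_ * (h * z)|]normrM [ `|_ ^+ n|]normrX ler_piMr ?exprn_ge0 //.
rewrite (_ : (fun n => _) = fun=> e z); first exact: cvg_cst.
by apply/funext => n; rewrite -fn.
Qed.

Lemma abs_summable_euler_qpoch_infV (z : R[i]) : `|z| < 1 ->
  abs_summable (fun n : nat => z ^+ n / qpoch x x n).
Proof.
move=> z1; apply: eq_abs_summable (abs_summableM (bounded_qfactV h1) (abs_summable_geometric z1)).
by move=> n; rewrite mulrC.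
Qed.

(** Here [(1 - z) e z = e (x z)], with the same limit. *)
Lemma euler_qpoch_infV (z : R[i]) : `|z| < 1 ->
  sums_to (fun n : nat => z ^+ n / qpoch x x n) (qpoch_inf z x)^-1.
Proof.
pose t (z : R[i]) (n : nat) := z ^+ n / qpoch x x n.
have ex z' : exists s, `|z'| < 1 -> sums_to (t z') s.
  have [z1|_] := boolP (`|z'| < 1); last by exists 0.
  by have [s hs] := abs_summable_sums_to (abs_summable_euler_qpoch_infV z1); exists s.
have [e he] := choice ex.
have xz n z' : `|z'| < 1 -> `|x ^+ n * z'| < 1.
  move=> z1; rewrite normrM; apply: le_lt_trans z1; rewrite ler_piMl //.
  by rewrite normrX exprn_ile1 // ltW // x1.
have fe z' : `|z'| < 1 -> (1 - z') * e z' = e (x * z').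
  move=> z1; have xz1 : `|x * z'| < 1 by rewrite -[x]expr1; exact: xz.
  suff h' : e z' = e (x * z') + (0 + z' * e z') by rewrite mulrBl mul1r {1}h'; ring.
  apply: sums_to_uniq (he _ z1) _.
  apply: (@eq_sums_to _ _ (fun n => t (x * z') n + (if n is k.+1 then z' * t z' k else 0))).
    case=> [|k]; rewrite /t ?expr0 ?addr0 // qfactS //.
    have := qfact_neq0 h1 k.+1; rewrite qfactS // mulf_eq0 negb_or => /andP[u0' v0].
    have E : h ^ (2 * k%:Z + 2) = h ^ (2 * k%:Z) * x by rewrite expfzDr ?hn0.
    rewrite E in v0 *; rewrite (exprMn k.+1 x z') [x ^+ k.+1]exprS sqr_nomeX (exprS z' k).
    by field; rewrite u0' v0.
  apply: sums_toD; first exact: he.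
  by apply: (@sums_to_recl _ (fun n => if n is k.+1 then _ else 0)); apply: sums_toZ; exact: he.
have fn n z' : `|z'| < 1 -> qpoch z' x n * e z' = e (x ^+ n * z').
  move=> z1; elim: n => [|n IH]; first by rewrite qpoch0 expr0 !mul1r.
  by rewrite qpochS mulrAC IH mulrC [z' * _]mulrC fe ?xz // mulrA -exprS.
move=> z1; have [M hM] := abs_summable_euler_qpoch_infV z1.
have e1 n : `|e (x ^+ n * z) - 1| <= M * `|x| ^+ n.
  apply: norm_sums_to_le (_ : sums_to (fun m => if m is k.+1 then t (x ^+ n * z) k.+1 else 0) _); last first.
    have := sums_toB (he _ (xz n z z1)) (@sums_to_finite _ _ (fun n => if n is 0%N then 1 else 0) [fset 0%N]%fset _).
    rewrite big_seq_fset1 => h'; apply: eq_sums_to (h' _); last by case=> //; rewrite !inE.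
    by case=> [|m]; rewrite ?subr0 // /t expr0 qpoch0 divr1 subrr.
  move=> B; apply: le_trans (_ : (\sum_(i <- B) `|z ^+ i / qpoch x x i|) * `|x| ^+ n <= _); last by rewrite ler_wpM2r // exprn_ge0.
  rewrite mulr_suml; apply: ler_sum => -[|m] _; first by rewrite normr0 mulr_ge0 ?exprn_ge0.
  rewrite /t exprMn -mulrA normrM mulrC ler_wpM2l // !normrX -exprM mulnC exprM.
  by rewrite -!exprM; apply: ler_wiXn2l => //; [exact: ltW|nia].
have pe : qpoch_inf z x * e z = 1.
  apply: (@cvg_uniq _ (fun n => qpoch z x n * e z)).
    by apply: cvgM; [exact: qpoch_cvg x1|exact: cvg_cst].
  rewrite (_ : (fun n => _) = fun n => e (x ^+ n * z)); first exact: cvg_geometric x1 e1.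
  by apply/funext => n; rewrite fn.
have p0 : qpoch_inf z x != 0.
  by apply/eqP => p0; move/eqP: pe; rewrite p0 mul0r eq_sym oner_eq0.
have -> : (qpoch_inf z x)^-1 = e z by rewrite -[LHS]mulr1 -pe mulKf.
exact: he.
Qed.

End EulerSums.

(** * Durfee rectangles *)

Section DurfeeSums.
Variables (R : realType) (h : R[i]).
Hypotheses (h0 : 0 < `|h|) (h1 : `|h| < 1).
Local Notation x := (h ^+ 2).
Local Notation x1 := (norm_sqr_nome_lt1 h1).
Local Notation hn0 := (nome_neq0 h0).

Lemma expz_exprn (e : int) n : (h ^ e) ^+ n = h ^ (e * n%:Z).
Proof. by rewrite exprnP exprz_exp. Qed.

Lemma nome_shift k : h * x ^+ k = h ^ (1 + 2 * k%:Z).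
Proof. by rewrite sqr_nomeX expfzDr ?hn0 // expr1z. Qed.

Lemma norm_nomeX_le1 (e : int) : 0 <= e -> `|h ^ e| <= 1.
Proof. by move=> e0; rewrite norm_expz -[leRHS](expr0z `|h|) ler_expz_int. Qed.

Lemma qfact_inf_neq0 : qpoch_inf x x != 0.
Proof.
have [M hM] := qpoch_inf_bounds (normr_ge0 x) x1.
by have [] := hM x x (lexx _) (lexx _).
Qed.

Lemma bounded_sign (T : Type) (e : T -> nat) : bounded_family (fun i => (-1 : R[i]) ^+ e i).
Proof. by apply: bounded_expr; rewrite normrN1. Qed.

(** Durfee rectangles: expanding [1 / (x; x)_(l + n)] by Euler's formula and
    collecting [l + u = M] leaves the factor [(x^(1 - M); x)_M], zero unless [M = 0]. *)
Lemma durfee_rectangle n :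
  sums_to (fun l : nat => h ^ (2 * (l%:Z * (l%:Z + n%:Z))) /
      (qpoch x x l * qpoch x x (l + n)))
    (qpoch_inf x x)^-1.
Proof.
pose g (lu : nat * nat) := h ^ (2 * (lu.1%:Z * (lu.1%:Z + n%:Z))) / qpoch x x lu.1 *
  (h ^ (lu.2%:Z * lu.2%:Z) * (- (h * x ^+ (lu.1 + n))) ^+ lu.2 / qpoch x x lu.2).
have gE lu : g lu = (-1) ^+ lu.2 * ((qpoch x x lu.1)^-1 * (qpoch x x lu.2)^-1) *
    h ^ (lu.1%:Z * lu.1%:Z + 2 * (lu.1%:Z * n%:Z) + (1 + 2 * (lu.1%:Z + n%:Z)) * lu.2%:Z) *
    (h ^ (lu.1%:Z * lu.1%:Z) * h ^ (lu.2%:Z * lu.2%:Z)).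
  rewrite /g nome_shift (exprNn (h ^ _)) expz_exprn.
  have -> : 2 * (lu.1%:Z * (lu.1%:Z + n%:Z)) = lu.1%:Z * lu.1%:Z + (lu.1%:Z * lu.1%:Z + 2 * (lu.1%:Z * n%:Z)) by ring.
  by rewrite PoszD !expfzDr ?hn0 //; ring.
have sg : abs_summable g.
  have sq := abs_summable_nome h0 h1.
  apply: eq_abs_summable (fun lu => esym (gE lu)) _.
  apply: abs_summableM (abs_summable_prod sq sq).
  apply: boundedM; last by apply: bounded_expz => // -[l u] /=; nia.
  apply: boundedM; first exact: bounded_sign.
  by apply: boundedM; apply: (bounded_comp _ (bounded_qfactV h1)).
have fibM M : sums_to (fun lu => if (lu.1 + lu.2)%N == M then g lu else 0)
    (if M == 0%N then 1 else 0).
  have := sums_toZ (h ^ (2 * (M%:Z * M%:Z) + 2 * (n%:Z * M%:Z)))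
    (q_binomial h0 h1 M (- h ^ (1 - 2 * M%:Z))).
  have -> : h ^ (2 * (M%:Z * M%:Z) + 2 * (n%:Z * M%:Z)) *
      (qpoch (- (h * - h ^ (1 - 2 * M%:Z))) x M / qpoch x x M) = if M == 0%N then 1 else 0.
    case: M => [|M]; first by rewrite !mulr0 expr0z !qpoch0 divr1 mulr1.
    have Z : - (h * - h ^ (1 - 2 * M.+1%:Z)) * x ^+ M = 1.
      rewrite mulrN opprK mulrAC nome_shift -expfzDr ?hn0 //.
      by rewrite (_ : _ + _ = 0) ?expr0z //; lia.
    by rewrite qpochS Z subrr mulr0 mul0r mulr0.
  apply: eq_sums_to => -[l u] /=; case: eqP => [<-|_]; last by rewrite mulr0.
  rewrite gE /= (exprNn (h ^ _)) expz_exprn.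
  have E : h ^ (2 * ((l + u)%N%:Z * (l + u)%N%:Z) + 2 * (n%:Z * (l + u)%N%:Z)) *
      h ^ (u%:Z * u%:Z) * h ^ ((1 - 2 * (l + u)%N%:Z) * u%:Z) =
      h ^ (l%:Z * l%:Z + 2 * (l%:Z * n%:Z) + (1 + 2 * (l%:Z + n%:Z)) * u%:Z) *
      h ^ (l%:Z * l%:Z) * h ^ (u%:Z * u%:Z).
    by rewrite -!expfzDr ?hn0 //; congr (_ ^ _); rewrite !PoszD; ring.
  transitivity ((-1) ^+ u * ((qpoch x x l)^-1 / qpoch x x u) *
     (h ^ (2 * ((l + u)%N%:Z * (l + u)%N%:Z) + 2 * (n%:Z * (l + u)%N%:Z)) *
      h ^ (u%:Z * u%:Z) * h ^ ((1 - 2 * (l + u)%N%:Z) * u%:Z))).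
    by rewrite invfM; ring.
  by rewrite E; ring.
have fibl l : sums_to (fun u => g (l, u))
    (h ^ (2 * (l%:Z * (l%:Z + n%:Z))) / qpoch x x l * qpoch_inf (x * x ^+ (l + n)) x).
  have z1 : `|h * - (h * x ^+ (l + n))| <= 1.
    by rewrite nome_shift mulrN normrN [ `|_|]normrM mulr_ile1 ?norm_nomeX_le1 // ltW.
  have := sums_toZ (h ^ (2 * (l%:Z * (l%:Z + n%:Z))) / qpoch x x l) (euler_qpoch_inf h0 h1 z1).
  rewrite (_ : - (h * - (h * x ^+ (l + n))) = x * x ^+ (l + n)) //.
  by rewrite mulrN opprK mulrA.
have [t ht] := abs_summable_sums_to sg.
have t1 : t = 1.
  have d1 := @sums_to_finite R nat (fun M => if M == 0%N then 1 else 0) [fset 0%N]%fset.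
  rewrite big_seq_fset1 eqxx in d1.
  apply: sums_to_uniq (sums_to_fibres ht fibM) (d1 _) => i.
  by rewrite !inE => /negPf ->.
have := sums_toZ (qpoch_inf x x)^-1 (sums_to_fst ht fibl); rewrite t1 mulr1.
apply: eq_sums_to => l; rewrite (qpoch_infD x (l + n) x1) invfM.
have q0 : qpoch_inf (x * x ^+ (l + n)) x != 0.
  have := qfact_inf_neq0; rewrite (qpoch_infD x (l + n) x1).
  by rewrite mulf_eq0 negb_or => /andP[].
have qn := qfact_neq0 h1 (l + n); have ql := qfact_neq0 h1 l.
by field; apply/and3P.
Qed.

Lemma durfee_int (n : int) :
  sums_to (fun jl : nat * nat => if jl.1%:Z - jl.2%:Z == n then
      h ^ (2 * (jl.1%:Z * jl.2%:Z)) / (qpoch x x jl.1 * qpoch x x jl.2) else 0)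
    (qpoch_inf x x)^-1.
Proof.
case: (lerP 0 n) => n0.
  apply: (@sums_to_fibre _ _ _ _ _ _ _ (fun l : nat => ((l + absz n)%N, l))).
  - by move=> l l' [].
  - by move=> l /=; lia.
  - by move=> [j l] /= jl; exists l; congr (_, _); lia.
  apply: eq_sums_to (durfee_rectangle (absz n)) => l /=.
  by rewrite PoszD [_ * l%:Z]mulrC [qpoch x x (l + _) * _]mulrC.
apply: (@sums_to_fibre _ _ _ _ _ _ _ (fun l : nat => (l, (l + absz n)%N))).
- by move=> l l' [].
- by move=> l /=; lia.
- by move=> [j l] /= jl; exists j; congr (_, _); lia.
by apply: eq_sums_to (durfee_rectangle (absz n)) => l /=; rewrite PoszD.
Qed.

(** A Stieltjes--Wigert polynomial at [- x^(- m - n)], without its normalising factor. *)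
Definition durfee_poly m (n : int) : R[i] :=
  \sum_(r < m.+1) gauss h m r * h ^ (2 * (r%:Z * r%:Z - m%:Z * r%:Z - n * r%:Z)).

Lemma durfee_polyS m n :
  durfee_poly m.+1 n = durfee_poly m (n + 1) + h ^ (- (2 * n)) * durfee_poly m n.
Proof.
rewrite /durfee_poly (sum_gauss_pascal h0 h1 _ (fun r => h ^ (2 * (r%:Z * r%:Z - m.+1%:Z * r%:Z - n * r%:Z)))).
congr (_ + _); first by apply: eq_bigr => r _; congr (_ * _ ^ _); lia.
rewrite mulr_sumr; apply: eq_bigr => r _.
rewrite mulrCA -mulrA; congr (_ * _).
by rewrite -!expfzDr ?hn0 //; congr (_ ^ _); lia.
Qed.

(** The extra factor from [m] to [m + 1] is [x^(- j) = x^(- n) (1 + x^(- l) (1 - x^l))] on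
    the diagonal [j - l = n], and [1 - x^l] lowers [l] in [(x; x)_l]: the sums obey
    the recursion [durfee_polyS]. *)
Lemma durfee_shifted m (n : int) :
  sums_to (fun jl : nat * nat => if jl.1%:Z - jl.2%:Z == n then
      h ^ (2 * (jl.1%:Z * jl.2%:Z) - 2 * (m%:Z * jl.1%:Z)) /
      (qpoch x x jl.1 * qpoch x x jl.2) else 0)
    ((qpoch_inf x x)^-1 * durfee_poly m n).
Proof.
elim: m n => [|m IH] n.
  have -> : durfee_poly 0 n = 1.
    rewrite /durfee_poly big_ord_recl big_ord0 addr0 /gauss !qpoch0 mulr1 invr1 !mul1r.
    by rewrite (_ : 2 * _ = 0) ?expr0z //=; ring.
  rewrite mulr1.
  by apply: eq_sums_to (durfee_int n) => -[j l] /=; rewrite mul0r mulr0 subr0.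
rewrite durfee_polyS mulrDr.
pose f m n (jl : nat * nat) := if jl.1%:Z - jl.2%:Z == n then
      h ^ (2 * (jl.1%:Z * jl.2%:Z) - 2 * (m%:Z * jl.1%:Z)) /
      (qpoch x x jl.1 * qpoch x x jl.2) else 0.
pose f' (jl : nat * nat) := if jl.2 is l.+1 then f m (n + 1) (jl.1, l) else 0.
have hf' : sums_to f' ((qpoch_inf x x)^-1 * durfee_poly m (n + 1)).
  apply: (@sums_to_inj _ _ _ _ (fun jl : nat * nat => (jl.1, jl.2.+1))); last exact: IH.
    by move=> [j l] [j' l'] [-> ->].
  by move=> [j [|l]] // /(_ (j, l)).
have := sums_toD hf' (sums_toZ (h ^ (- (2 * n))) (IH n)).
rewrite mulrCA; apply: eq_sums_to => -[j [|l]]; rewrite /f' /f /= ?add0r.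
  case: eqP => [<-|_]; last by rewrite mulr0.
  by rewrite [LHS]mulrA; congr (_ / _); rewrite -expfzDr ?hn0 //; congr (_ ^ _); lia.
have -> : (j%:Z - l%:Z == n + 1) = (j%:Z - l.+1%:Z == n) by apply/eqP/eqP; lia.
case: eqP => [jl|_]; last by rewrite mulr0 addr0.
have := qfact_neq0 h1 l.+1; have := qfact_neq0 h1 j; rewrite qfactS // mulf_eq0 negb_or.
move=> qj /andP[ql X0].
have E1 : h ^ (- (2 * n)) * h ^ (2 * (j%:Z * l.+1%:Z) - 2 * (m%:Z * j%:Z)) =
   h ^ (2 * (j%:Z * l%:Z) - 2 * (m%:Z * j%:Z)) * h ^ (2 * l%:Z + 2).
  by rewrite -!expfzDr ?hn0 //; congr (_ ^ _); rewrite -jl; lia.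
have E2 : h ^ (2 * (j%:Z * l.+1%:Z) - 2 * (m.+1%:Z * j%:Z)) =
   h ^ (2 * (j%:Z * l%:Z) - 2 * (m%:Z * j%:Z)).
  by congr (_ ^ _); lia.
rewrite E2 [X in _ + X]mulrA E1.
by field; apply/and3P.
Qed.

End DurfeeSums.

(** * Heine's transformation and a q-Gauss sum *)

Section HeineGauss.
Variables (R : realType) (h : R[i]).
Hypotheses (h0 : 0 < `|h|) (h1 : `|h| < 1).
Local Notation x := (h ^+ 2).
Local Notation x1 := (norm_sqr_nome_lt1 h1).
Local Notation hn0 := (nome_neq0 h0).

Lemma qpoch_inf_neq0 (a y : R[i]) : `|a| < 1 -> `|y| < 1 -> qpoch_inf a y != 0.
Proof.
move=> a1 y1; have [ay|ya] := real_leP (normr_real a) (normr_real y).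
  have [M hM] := qpoch_inf_bounds (normr_ge0 y) y1.
  by have [] := hM a y ay (lexx _).
have [M hM] := qpoch_inf_bounds (normr_ge0 a) a1.
by have [] := hM a y (lexx _) (ltW ya).
Qed.

Lemma norm_mulX_lt1 (a : R[i]) s : `|a| < 1 -> `|a * x ^+ s| < 1.
Proof.
move=> a1; rewrite normrM; apply: le_lt_trans a1; rewrite ler_piMr //.
by rewrite [ `|_ ^+ s|]normrX exprn_ile1 // ltW // x1.
Qed.

(** Heine's transformation in a confluent case: expand [(a; x)_s] as
    [(a; x)_oo / (a x^s; x)_oo] and sum over [s] first. *)
Lemma heine_euler (a z S : R[i]) : `|a| < 1 -> `|h * z| <= 1 -> `|z| <= 1 ->
  sums_to (fun u => a ^+ u * qpoch_inf (- (h * (z * x ^+ u))) x / qpoch x x u) S ->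
  sums_to (fun s => qpoch a x s * (h ^ (s%:Z * s%:Z) * z ^+ s) / qpoch x x s)
    (qpoch_inf a x * S).
Proof.
move=> a1 hz1 z1 hS.
pose g (us : nat * nat) := a ^+ us.1 / qpoch x x us.1 *
  (h ^ (us.2%:Z * us.2%:Z) * (z * x ^+ us.1) ^+ us.2 / qpoch x x us.2).
have gE us : g us = ((qpoch x x us.1)^-1 * (qpoch x x us.2)^-1) * (z ^+ us.2 * x ^+ (us.1 * us.2)) *
   (a ^+ us.1 * h ^ (us.2%:Z * us.2%:Z)).
  by rewrite /g (exprMn us.2 z) (exprM x); ring.
have sg : abs_summable g.
  apply: eq_abs_summable (fun us => esym (gE us)) _.
  apply: abs_summableM (abs_summable_prod (abs_summable_geometric a1) (abs_summable_nome h0 h1)).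
  apply: boundedM; first by apply: boundedM; apply: (bounded_comp _ (bounded_qfactV h1)).
  by apply: boundedM; apply: bounded_expr => //; rewrite ltW // x1.
have fibu u : sums_to (fun s => g (u, s))
    (a ^+ u * qpoch_inf (- (h * (z * x ^+ u))) x / qpoch x x u).
  have zu : `|h * (z * x ^+ u)| <= 1.
    by rewrite mulrA [ `|_ * x ^+ u|]normrM mulr_ile1 // [ `|_ ^+ u|]normrX exprn_ile1 // ltW // x1.
  have := sums_toZ (a ^+ u / qpoch x x u) (euler_qpoch_inf h0 h1 zu).
  by rewrite mulrAC.
have fibs s : sums_to (fun u => g (u, s))
    (h ^ (s%:Z * s%:Z) * z ^+ s / qpoch x x s * (qpoch_inf (a * x ^+ s) x)^-1).
  have := sums_toZ (h ^ (s%:Z * s%:Z) * z ^+ s / qpoch x x s) (euler_qpoch_infV h0 h1 (norm_mulX_lt1 s a1)).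
  by apply: eq_sums_to => u; rewrite gE /= (exprMn u a) mulnC (exprM x); ring.
have := sums_toZ (qpoch_inf a x) (sums_to_swap sg fibu fibs hS).
apply: eq_sums_to => s; rewrite (qpoch_infD a s x1).
have q0 := qpoch_inf_neq0 (norm_mulX_lt1 s a1) x1.
by have qs := qfact_neq0 h1 s; field; apply/andP.
Qed.

(** A confluent q-Gauss sum: a Durfee sum inside Euler's sum over [l], bracketed
    by [l + k = a] instead, where the q-binomial theorem applies. *)
Lemma durfee_binomial (j : nat) (y : R[i]) : y != 0 -> `|y| <= 1 ->
  sums_to (fun a => y ^+ a * qpoch (- (h ^+ j.+1 / y)) x a * h ^ (a%:Z * (a%:Z + j%:Z)) /
      (qpoch x x a * qpoch x x (a + j)))
    (qpoch_inf (- (h ^+ j.+1 * y)) x / qpoch_inf x x).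
Proof.
move=> yn0 y1.
pose g (lk : nat * nat) := h ^ (lk.1%:Z * lk.1%:Z) * (h ^+ j * y) ^+ lk.1 / qpoch x x lk.1 *
  (h ^ (2 * (lk.2%:Z * (lk.2%:Z + (lk.1 + j)%N%:Z))) /
      (qpoch x x lk.2 * qpoch x x (lk.2 + (lk.1 + j)))).
have sg : abs_summable g.
  have sq := abs_summable_nome h0 h1.
  have B := bounded_qfactV h1.
  apply: (@eq_abs_summable _ _ (fun lk : nat * nat => (h ^+ j * y) ^+ lk.1 *
     ((qpoch x x lk.1)^-1 * ((qpoch x x lk.2)^-1 * (qpoch x x (lk.2 + (lk.1 + j)))^-1)) *
     h ^ (lk.2%:Z * (lk.2%:Z + 2 * (lk.1 + j)%N%:Z)) *
     (h ^ (lk.1%:Z * lk.1%:Z) * h ^ (lk.2%:Z * lk.2%:Z)))).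
    move=> [l k]; rewrite /g /= invfM.
    have -> : 2 * (k%:Z * (k%:Z + (l + j)%N%:Z)) = k%:Z * (k%:Z + 2 * (l + j)%N%:Z) + k%:Z * k%:Z.
      by ring.
    by rewrite expfzDr ?hn0 //; ring.
  apply: abs_summableM (abs_summable_prod sq sq).
  apply: boundedM; last by apply: bounded_expz => // -[l k] /=; nia.
  apply: boundedM.
    by apply: bounded_expr; rewrite normrM normrX mulr_ile1 ?exprn_ge0 // exprn_ile1 // ltW.
  by apply: boundedM; [|apply: boundedM]; apply: (bounded_comp _ B).
have fibl l : sums_to (fun k => g (l, k))
    (h ^ (l%:Z * l%:Z) * (h ^+ j * y) ^+ l / qpoch x x l * (qpoch_inf x x)^-1).
  by have := sums_toZ (h ^ (l%:Z * l%:Z) * (h ^+ j * y) ^+ l / qpoch x x l) (durfee_rectangle h0 h1 (l + j)).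
have E1 : sums_to (fun l : nat => h ^ (l%:Z * l%:Z) * (h ^+ j * y) ^+ l / qpoch x x l * (qpoch_inf x x)^-1)
    (qpoch_inf (- (h ^+ j.+1 * y)) x / qpoch_inf x x).
  have z1 : `|h * (h ^+ j * y)| <= 1.
    by rewrite mulrA -exprS normrM normrX mulr_ile1 ?exprn_ge0 // exprn_ile1 // ltW.
  have := sums_toZr (qpoch_inf x x)^-1 (euler_qpoch_inf h0 h1 z1).
  by rewrite (mulrA h) -exprS.
apply: (sums_to_fibres (p := fun lk => (lk.1 + lk.2)%N) (sums_to_pair sg fibl E1)).
move=> a.
have := sums_toZ (y ^+ a * h ^ (a%:Z * (a%:Z + j%:Z)) / qpoch x x (a + j))
    (q_binomial h0 h1 a (h ^+ j / y)).
rewrite (_ : _ * (qpoch _ x a / _) = y ^+ a * qpoch (- (h ^+ j.+1 / y)) x a * h ^ (a%:Z * (a%:Z + j%:Z)) /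
      (qpoch x x a * qpoch x x (a + j))); last first.
  by rewrite (mulrA h) -exprS invfM; ring.
apply: eq_sums_to => -[l k] /=; case: eqP => [<-|_]; last by rewrite mulr0.
rewrite /g /= (exprMn l) (exprMn k) -!exprM.
have -> : y ^+ (l + k) = y ^+ l * y ^+ k by rewrite exprD.
have E : h ^ ((l + k)%N%:Z * ((l + k)%N%:Z + j%:Z)) * (h ^ (k%:Z * k%:Z) * h ^+ (j * k)) =
   h ^ (l%:Z * l%:Z) * h ^+ (j * l) * h ^ (2 * (k%:Z * (k%:Z + (l + j)%N%:Z))).
  by rewrite !exprnP -!expfzDr ?hn0 //; congr (_ ^ _); rewrite !PoszM !PoszD; ring.
rewrite exprVn.
transitivity (y ^+ l * y ^+ k * (y ^+ k)^-1 * (qpoch x x (l + k + j))^-1 * ((qpoch x x l)^-1 * (qpoch x x k)^-1) *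
  (h ^ ((l + k)%N%:Z * ((l + k)%N%:Z + j%:Z)) * (h ^ (k%:Z * k%:Z) * h ^+ (j * k)))).
  by rewrite invfM; ring.
rewrite E mulfK ?expf_neq0 // (_ : (k + (l + j))%N = (l + k + j)%N); last by lia.
by rewrite invfM; ring.
Qed.

End HeineGauss.

(** * The triple product, diagonal sums and Lebesgue's identity *)

Section DiagonalSums.
Variables (R : realType) (h : R[i]).
Hypotheses (h0 : 0 < `|h|) (h1 : `|h| < 1).
Local Notation x := (h ^+ 2).
Local Notation x1 := (norm_sqr_nome_lt1 h1).
Local Notation hn0 := (nome_neq0 h0).

(** The product of two Euler sums, bracketed by [j - l = n]: each bracket is a Durfee sum. *)
Lemma jacobi_triple (w : R[i]) : w != 0 -> `|h * w| <= 1 -> `|h / w| <= 1 ->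
  sums_to (fun n : int => h ^ (n * n) * w ^ n)
    (qpoch_inf x x * qpoch_inf (- (h * w)) x * qpoch_inf (- (h / w)) x).
Proof.
move=> w0 hw hw'.
have hp := sums_to_prod (abs_summable_euler_qpoch_inf h0 h1 hw) (abs_summable_euler_qpoch_inf h0 h1 hw')
  (euler_qpoch_inf h0 h1 hw) (euler_qpoch_inf h0 h1 hw').
have := sums_toZ (qpoch_inf x x) hp; rewrite mulrA => {hp} hp.
apply: (sums_to_fibres (p := fun jl => jl.1%:Z - jl.2%:Z) hp) => n.
have := sums_toZ (qpoch_inf x x * (h ^ (n * n) * w ^ n)) (durfee_int h0 h1 n).
rewrite mulrAC divff ?qfact_inf_neq0 // mul1r.
apply: eq_sums_to => -[j l] /=; case: eqP => [<-|_]; last by rewrite mulr0.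
have E : h ^ ((j%:Z - l%:Z) * (j%:Z - l%:Z)) * h ^ (2 * (j%:Z * l%:Z)) =
    h ^ (j%:Z * j%:Z) * h ^ (l%:Z * l%:Z).
  by rewrite -!expfzDr ?hn0 //; congr (_ ^ _); ring.
have Ew : w ^ (j%:Z - l%:Z) = w ^+ j * w^-1 ^+ l by rewrite expfzDr // -exprz_inv.
rewrite Ew invfM.
transitivity (qpoch_inf x x * (w ^+ j * w^-1 ^+ l) * ((qpoch x x j)^-1 * (qpoch x x l)^-1) *
  (h ^ ((j%:Z - l%:Z) * (j%:Z - l%:Z)) * h ^ (2 * (j%:Z * l%:Z)))); first by ring.
by rewrite E; ring.
Qed.

Lemma norm_Nh_lt1 n : (0 < n)%N -> `|- h ^+ n| < 1.
Proof. by move=> n0; rewrite normrN normrX exprn_ilt1 // -lt0n. Qed.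

(** [durfee_binomial] at [y = 1]; the factor depending on [a + b] in the denominator is what
    makes the sum independent of [j]. *)
Lemma diagonal_sum (j : int) :
  sums_to (fun ab : nat * nat => if ab.2%:Z - ab.1%:Z == j then
      h ^ (ab.1%:Z * ab.2%:Z) /
      (qpoch x x ab.1 * qpoch x x ab.2 * qpoch_inf (- h ^+ (ab.1 + ab.2).+1) x) else 0)
    (qpoch_inf x x)^-1.
Proof.
have D (k : nat) : sums_to (fun a : nat => h ^ (a%:Z * (a%:Z + k%:Z)) /
    (qpoch x x a * qpoch x x (a + k) * qpoch_inf (- h ^+ (a + (a + k)).+1) x)) (qpoch_inf x x)^-1.
  have := durfee_binomial h0 h1 k (oner_neq0 _) (_ : `|1 : R[i]| <= 1).
  rewrite normr1 lexx => /(_ isT) /(sums_toZ (qpoch_inf (- h ^+ k.+1) x)^-1).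
  have k0 : qpoch_inf (- h ^+ k.+1) x != 0 by apply: qpoch_inf_neq0; rewrite ?norm_Nh_lt1 ?x1.
  rewrite mulr1 mulKf //; apply: eq_sums_to => a.
  rewrite divr1 expr1n mul1r (qpoch_infD _ a x1) invfM.
  have E : - h ^+ k.+1 * x ^+ a = - h ^+ (a + (a + k)).+1.
    by rewrite mulNr -exprM -exprD; congr (- _ ^+ _); lia.
  rewrite E; move: k0; rewrite (qpoch_infD _ a x1) E mulf_eq0 negb_or => /andP[u0 v0].
  have qa := qfact_neq0 h1 a; have qb := qfact_neq0 h1 (a + k).
  by field; apply/and4P.
case: (lerP 0 j) => j0.
  apply: (@sums_to_fibre _ _ _ _ _ _ _ (fun a : nat => (a, (a + absz j)%N))).
  - by move=> l l' [].
  - by move=> l /=; lia.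
  - by move=> [a b] /= jl; exists a; congr (_, _); lia.
  by apply: eq_sums_to (D (absz j)) => a /=; rewrite PoszD.
apply: (@sums_to_fibre _ _ _ _ _ _ _ (fun a : nat => ((a + absz j)%N, a))).
- by move=> l l' [].
- by move=> l /=; lia.
- by move=> [a b] /= jl; exists b; congr (_, _); lia.
apply: eq_sums_to (D (absz j)) => a /=.
by rewrite PoszD [_ * a%:Z]mulrC [qpoch x x (a + _) * _]mulrC [((a + _) + a)%N]addnC.
Qed.

(** [durfee_binomial] at [y = h]. *)
Lemma diagonal_sum_shift (j : int) : j != 0 ->
  sums_to (fun ab : nat * nat => if ab.2%:Z - ab.1%:Z == j then
      h ^ (ab.1%:Z * ab.2%:Z + ab.1%:Z) /
      (qpoch x x ab.1 * qpoch x x ab.2 * qpoch_inf (- h ^+ (ab.1 + ab.2)) x) else 0)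
    (qpoch_inf x x * (1 + h ^ j))^-1.
Proof.
have D (k : nat) : (0 < k)%N -> sums_to (fun a : nat => h ^ (a%:Z * (a%:Z + k%:Z) + a%:Z) /
    (qpoch x x a * qpoch x x (a + k) * qpoch_inf (- h ^+ (a + (a + k))) x))
    (qpoch_inf x x * (1 + h ^+ k))^-1.
  move=> k1.
  have := durfee_binomial h0 h1 k (hn0) (ltW h1).
  move=> /(sums_toZ (qpoch_inf (- h ^+ k) x)^-1).
  have k0 : qpoch_inf (- h ^+ k) x != 0 by apply: qpoch_inf_neq0; rewrite ?norm_Nh_lt1 ?x1.
  have E1 : - (h ^+ k.+1 * h) = - h ^+ k * x ^+ 1.
    by rewrite expr1 mulNr -exprSr -exprD; congr (- _ ^+ _); lia.
  have E2 : - (h ^+ k.+1 / h) = - h ^+ k by rewrite exprS mulrC mulKf ?hn0.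
  have P1 : qpoch_inf (- h ^+ k) x = (1 + h ^+ k) * qpoch_inf (- h ^+ k * x ^+ 1) x.
    by rewrite (qpoch_infD _ 1 x1) qpochS qpoch0 mul1r expr0 mulr1 opprK.
  rewrite E1 E2; set u := qpoch_inf (- h ^+ k * x ^+ 1) x in P1 *.
  have [hk0 u0] : 1 + h ^+ k != 0 /\ u != 0.
    by move: k0; rewrite P1 mulf_eq0 negb_or => /andP[].
  have xi0 := qfact_inf_neq0 h1.
  rewrite [X in sums_to _ X](_ : _ = (qpoch_inf x x * (1 + h ^+ k))^-1); last first.
    by rewrite P1; field; apply/and3P.
  apply: eq_sums_to => a.
  have E : - h ^+ k * x ^+ a = - h ^+ (a + (a + k)).
    by rewrite mulNr -exprM -exprD; congr (- _ ^+ _); lia.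
  move: k0; rewrite (qpoch_infD _ a x1) E mulf_eq0 negb_or => /andP[k0 v0].
  have qa := qfact_neq0 h1 a; have qb := qfact_neq0 h1 (a + k).
  rewrite [h ^ (_ + a%:Z)]expfzDr ?hn0 // -[h ^ a%:Z]/(h ^+ a).
  by field; apply/and4P.
have hk (k : nat) : (0 < k)%N -> 1 + h ^+ k != 0.
  by move=> k0; rewrite -[h ^+ k]opprK subr_neq0_norm // norm_Nh_lt1.
move=> j0; case: (lerP 0 j) => js.
  have jE : j = absz j by rewrite gez0_abs.
  have := D (absz j) _; rewrite absz_gt0 => /(_ j0).
  rewrite [h ^ j](_ : _ = h ^+ absz j); last by rewrite {1}jE.
  move=> D'; apply: (@sums_to_fibre _ _ _ _ _ _ _ (fun a : nat => (a, (a + absz j)%N))).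
  - by move=> l l' [].
  - by move=> l /=; lia.
  - by move=> [a b] /= jl; exists a; congr (_, _); lia.
  by apply: eq_sums_to D' => a /=; rewrite PoszD.
have := D (absz j) _; rewrite absz_gt0 => /(_ j0) /(sums_toZ (h ^+ absz j)) D'.
apply: (@sums_to_fibre _ _ _ _ _ _ _ (fun a : nat => ((a + absz j)%N, a))).
- by move=> l l' [].
- by move=> l /=; lia.
- by move=> [a b] /= jl; exists b; congr (_, _); lia.
have -> : (qpoch_inf x x * (1 + h ^ j))^-1 = h ^+ absz j * (qpoch_inf x x * (1 + h ^+ absz j))^-1.
  have -> : h ^ j = (h ^+ absz j)^-1 by rewrite exprnP invr_expz; congr (_ ^ _); lia.
  have a0 : (0 < absz j)%N by rewrite absz_gt0.
  have xi0 := qfact_inf_neq0 h1; have hk0 := hk _ a0.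
  have hj0 : h ^+ absz j != 0 by rewrite expf_neq0 ?hn0.
  have hk1 : h ^+ absz j + 1 != 0 by rewrite addrC.
  by field; apply/and3P.
apply: eq_sums_to D' => a /=.
rewrite mulrA -[h ^+ absz j]/(h ^ (absz j)%:Z) -expfzDr ?hn0 //.
rewrite [qpoch x x (a + _) * _]mulrC [((a + _) + a)%N]addnC; congr (_ ^ _ / _).
by rewrite PoszD; ring.
Qed.

Lemma qpoch_sqr (a y : R[i]) n : qpoch a y n * qpoch (- a) y n = qpoch (a ^+ 2) (y ^+ 2) n.
Proof.
rewrite /qpoch -big_split /=; apply: eq_bigr => k _.
by rewrite -(exprM y 2 k) mulnC exprM; ring.
Qed.

Lemma qpoch_inf_sqr (a y : R[i]) : `|y| < 1 ->
  qpoch_inf a y * qpoch_inf (- a) y = qpoch_inf (a ^+ 2) (y ^+ 2).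
Proof.
move=> y1; have y21 : `|y ^+ 2| < 1 by rewrite normrX exprn_ilt1.
apply: (@cvg_uniq _ (fun n => qpoch (a ^+ 2) (y ^+ 2) n)); last exact: qpoch_cvg.
under eq_fun do rewrite -qpoch_sqr.
by apply: cvgM; exact: qpoch_cvg.
Qed.

(** Lebesgue's sum: after Heine's transformation, [(x; x)_u (- x; x)_u] merges into
    [(x^2; x^2)_u] and Euler's second sum applies. *)
Lemma lebesgue_sum (r : nat) :
  sums_to (fun s => qpoch (- x) x (r + s) * h ^ (s%:Z * s%:Z + s%:Z) / qpoch x x s)
    (qpoch_inf (- x) x ^+ 2 / qpoch_inf (- x ^+ r.+1) (x ^+ 2)).
Proof.
have xx1 : `|x ^+ 2| < 1 by rewrite normrX exprn_ilt1 // x1.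
have a1 : `|- x ^+ r.+1| < 1 by rewrite normrN normrX exprn_ilt1 // x1.
have mx1 : `|- x| < 1 by rewrite normrN x1.
have E2 := euler_qpoch_infV (h := x) (_ : 0 < `|x|) x1 a1.
have x0 : 0 < `|x| by rewrite normrX exprn_gt0.
have {}E2 := sums_toZ (qpoch_inf (- x) x) (E2 x0).
have hh1 : `|h * h| <= 1 by rewrite -expr2 ltW // x1.
have HS : sums_to (fun u => (- x ^+ r.+1) ^+ u * qpoch_inf (- (h * (h * x ^+ u))) x / qpoch x x u)
    (qpoch_inf (- x) x / qpoch_inf (- x ^+ r.+1) (x ^+ 2)).
  apply: eq_sums_to E2 => u.
  have -> : - (h * (h * x ^+ u)) = - x * x ^+ u by rewrite mulrA mulNr.
  rewrite (qpoch_infD _ u x1) -qpoch_sqr.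
  have qu := qfact_neq0 h1 u.
  have qmu : qpoch (- x) x u != 0 by apply: qpoch_neq0; rewrite ?mx1 // ltW // x1.
  by field; apply/andP.
have := sums_toZ (qpoch (- x) x r) (heine_euler h0 h1 a1 hh1 (ltW h1) HS).
have Ex : - x * x ^+ r = - x ^+ r.+1 by rewrite mulNr -exprS.
have -> : (qpoch (- x) x r * (qpoch_inf (- x ^+ r.+1) x *
   (qpoch_inf (- x) x / qpoch_inf (- x ^+ r.+1) (x ^+ 2)))) =
   qpoch_inf (- x) x ^+ 2 / qpoch_inf (- x ^+ r.+1) (x ^+ 2).
  by rewrite mulrA -Ex -(qpoch_infD _ r x1) expr2 mulrA.
apply: eq_sums_to => s; rewrite qpochD Ex expfzDr ?hn0 //.
by rewrite -[h ^ s%:Z]/(h ^+ s); ring.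
Qed.

End DiagonalSums.

(** * Finite sums of Gaussian binomials *)

Section GaussReflection.
Variables (R : realType) (h : R[i]).
Hypotheses (h0 : 0 < `|h|) (h1 : `|h| < 1).
Local Notation x := (h ^+ 2).
Local Notation x1 := (norm_sqr_nome_lt1 h1).
Local Notation hn0 := (nome_neq0 h0).

Lemma norm_sqr_nome_gt0 : 0 < `|x|.
Proof. by rewrite normrX exprn_gt0. Qed.

Lemma sqr_nomez (z : int) : x ^ z = h ^ (2 * z).
Proof. by rewrite -[x]/(h ^ 2%:Z) exprz_exp. Qed.

Lemma sum_gauss_rev m (phi : nat -> R[i]) :
  \sum_(k < m.+1) gauss h m k * phi k = \sum_(k < m.+1) gauss h m k * phi (m - k)%N.
Proof.
rewrite (reindex_inj rev_ord_inj) /=; apply: eq_bigr => k _.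
have km : (k <= m)%N := ltn_ord k.
by rewrite subSS /gauss subKn // [qpoch x x k * _]mulrC.
Qed.

Lemma sum_gauss_absorb m (phi : nat -> R[i]) :
  \sum_(k < m.+2) gauss h m.+1 k * ((1 - h ^ (2 * k%:Z)) * phi k) =
  (1 - h ^ (2 * m%:Z + 2)) * \sum_(k < m.+1) gauss h m k * phi k.+1.
Proof.
rewrite big_ord_recl /= mulr0 expr0z subrr mul0r mulr0 add0r mulr_sumr.
apply: eq_bigr => k _; rewrite /bump /= add1n /gauss subSS.
have := qfact_neq0 h1 k.+1; rewrite !qfactS // mulf_eq0 negb_or => /andP[u0 v0].
have -> : 2 * k.+1%:Z = 2 * k%:Z + 2 by lia.
have qm := qfact_neq0 h1 (m - k).
by field; apply/and3P.
Qed.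

End GaussReflection.

Section GaussSums.
Variables (R : realType) (h : R[i]).
Hypotheses (h0 : 0 < `|h|) (h1 : `|h| < 1).
Local Notation x := (h ^+ 2).
Local Notation x1 := (norm_sqr_nome_lt1 h1).
Local Notation x0 := (norm_sqr_nome_gt0 h0).
Local Notation hn0 := (nome_neq0 h0).

(** A Rogers--Szego sum: the two halves of Pascal's rule are the same sum up to the
    reflection [k -> N - k] and a factor [x^(N + 1)]. *)
Lemma sum_gauss_triangular m :
  \sum_(k < m.+1) gauss x m k * h ^ ((2 * k%:Z - m%:Z) * (2 * k%:Z - m%:Z + 1)) =
  qpoch (- x) x m.
Proof.
elim: m => [|m IH].
  rewrite big_ord_recl big_ord0 addr0 /gauss !qpoch0 mulr1 invr1 !mul1r.
  by rewrite (_ : (_ * _ : int) = 0) ?expr0z //=; ring.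
rewrite (sum_gauss_pascal x0 x1 _ (fun k => h ^ ((2 * k%:Z - m.+1%:Z) * (2 * k%:Z - m.+1%:Z + 1)))).
rewrite (sum_gauss_rev x _ (fun k => h ^ ((2 * k%:Z - m.+1%:Z) * (2 * k%:Z - m.+1%:Z + 1)))).
rewrite qpochS mulrDr mulr1 -IH; congr (_ + _).
  by apply: eq_bigr => k _; congr (_ * _ ^ _); have km : (k <= m)%N := ltn_ord k; nia.
rewrite mulNr opprK mulr_suml; apply: eq_bigr => k _.
rewrite sqr_nomez -exprS sqr_nomeX -[LHS]mulrA -[RHS]mulrA; congr (_ * _).
by rewrite -!expfzDr ?hn0 //; congr (_ ^ _); lia.
Qed.

(** Pascal's rule expresses each of the alternating sums of even and of odd order
    by the other. *)
Let even_sum r := \sum_(k < (2 * r).+1) gauss h (2 * r) k *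
  ((-1) ^+ k * h ^ (2 * ((r%:Z - k%:Z) * (r%:Z - k%:Z)))).
Let odd_sum r := \sum_(k < (2 * r).+2) gauss h (2 * r).+1 k *
  ((-1) ^+ k * h ^ (2 * ((r%:Z - k%:Z) * (r%:Z - k%:Z)))).

(** The reflection [k -> 2 r + 1 - k] changes the sign of [(-1)^k]. *)
Lemma odd_sum_reflect r (f : int -> R[i]) : (forall t, f (- 1 - t) = f t) ->
  \sum_(k < (2 * r).+2) gauss h (2 * r).+1 k * ((-1) ^+ k * f (r%:Z - k%:Z)) = 0.
Proof.
move=> fE; set S := LHS; have SE : S = - S.
  rewrite /S {1}(sum_gauss_rev h _ (fun k => (-1) ^+ k * f (r%:Z - k%:Z))) -sumrN.
  apply: eq_bigr => k _; have km : (k <= (2 * r).+1)%N := ltn_ord k.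
  rewrite -mulrN -mulNr -[in RHS]fE; congr (_ * (_ * f _)); last by lia.
  by rewrite -signr_odd oddB //= oddM /= -[in RHS]signr_odd; case: (odd k); rewrite ?opprK.
by apply/eqP; rewrite -[_ == 0](mulrn_eq0 S 2) /= mulr2n {1}SE addNr.
Qed.

Lemma even_sumS r : even_sum r.+1 = - odd_sum r.
Proof.
rewrite /even_sum (_ : (2 * r.+1)%N = (2 * r).+2); last by lia.
rewrite (sum_gauss_pascal h0 h1 _ (fun k => (-1) ^+ k * h ^ (2 * ((r.+1%:Z - k%:Z) * (r.+1%:Z - k%:Z))))).
have Z1 : \sum_(k < (2 * r).+2) gauss h (2 * r).+1 k * ((-1) ^+ k *
    h ^ (2 * ((r%:Z - k%:Z) * (r%:Z - k%:Z)) + 2 * (r%:Z - k%:Z) + 2 * r%:Z + 2)) = 0.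
  apply: (@odd_sum_reflect r (fun t => h ^ (2 * (t * t) + 2 * t + 2 * r%:Z + 2))) => t.
  by congr (_ ^ _); ring.
have Z2 : \sum_(k < (2 * r).+2) gauss h (2 * r).+1 k * ((-1) ^+ k *
    (h ^ (2 * ((r%:Z - k%:Z + 1) * (r%:Z - k%:Z + 1))) + h ^ (2 * ((r%:Z - k%:Z) * (r%:Z - k%:Z))))) = 0.
  apply: (@odd_sum_reflect r (fun t => h ^ (2 * ((t + 1) * (t + 1))) + h ^ (2 * (t * t)))) => t.
  by rewrite addrC; congr (_ ^ _ + _ ^ _); ring.
apply: (@etrans _ _ (0 - odd_sum r - 0)); last by rewrite sub0r subr0.
rewrite -[X in _ = X - _ - _]Z2 -[X in _ = _ - X]Z1 /odd_sum -!sumrB -big_split /=.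
apply: eq_bigr => k _.
have -> : (r.+1%:Z - k%:Z) = r%:Z - k%:Z + 1 by lia.
have -> : (r.+1%:Z - k.+1%:Z) = r%:Z - k%:Z by lia.
have -> : h ^ (2 * ((r%:Z - k%:Z) * (r%:Z - k%:Z)) + 2 * (r%:Z - k%:Z) + 2 * r%:Z + 2) =
   h ^ (2 * ((2 * r).+1%:Z - k%:Z)) * h ^ (2 * ((r%:Z - k%:Z) * (r%:Z - k%:Z))).
  by rewrite -expfzDr ?hn0 //; congr (_ ^ _); lia.
by rewrite exprS; ring.
Qed.

Lemma odd_sumE r : odd_sum r = (1 - h ^ (4 * r%:Z + 2)) * even_sum r.
Proof.
rewrite /odd_sum (sum_gauss_pascal h0 h1 _ (fun k => (-1) ^+ k * h ^ (2 * ((r%:Z - k%:Z) * (r%:Z - k%:Z))))).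
rewrite -/(even_sum r).
pose psi (k : nat) := (-1) ^+ k * h ^ (2 * ((r%:Z - k%:Z) * (r%:Z - k%:Z))).
have W : \sum_(k < (2 * r).+1) gauss h (2 * r) k * ((1 - h ^ (2 * k%:Z)) * psi k) =
   (1 - h ^ (4 * r%:Z)) * even_sum r.
  rewrite /psi; case: {psi} r => [|r].
    by rewrite big_ord_recl big_ord0 addr0 mulr0 expr0z subrr !mul0r mulr0.
  rewrite even_sumS (_ : (2 * r.+1)%N = (2 * r).+2); last by lia.
  rewrite (sum_gauss_absorb h0 h1 _ (fun k => (-1) ^+ k * h ^ (2 * ((r.+1%:Z - k%:Z) * (r.+1%:Z - k%:Z))))).
  congr ((1 - h ^ _) * _); first by lia.
  rewrite /odd_sum -sumrN; apply: eq_bigr => k _.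
  have -> : (r.+1%:Z - k.+1%:Z) = r%:Z - k%:Z by lia.
  by rewrite exprS; ring.
have {}W : \sum_(k < (2 * r).+1) gauss h (2 * r) k * (h ^ (2 * k%:Z) * psi k) =
   h ^ (4 * r%:Z) * even_sum r.
  rewrite [RHS](_ : _ = even_sum r - (1 - h ^ (4 * r%:Z)) * even_sum r); last by ring.
  by rewrite -W /even_sum -sumrB; apply: eq_bigr => k _; rewrite /psi; ring.
rewrite mulrBl mul1r; congr (_ + _).
rewrite expfzDr ?hn0 // [h ^ _ * h ^ 2]mulrC -mulrA -W mulr_sumr -sumrN.
apply: eq_bigr => k _; rewrite /psi.
have E : h ^ (2 * ((2 * r)%N%:Z - k%:Z)) * h ^ (2 * ((r%:Z - k.+1%:Z) * (r%:Z - k.+1%:Z))) =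
   h ^ 2 * (h ^ (2 * k%:Z) * h ^ (2 * ((r%:Z - k%:Z) * (r%:Z - k%:Z)))).
  by rewrite -!expfzDr ?hn0 //; congr (_ ^ _); lia.
transitivity (gauss h (2 * r) k * - (-1) ^+ k *
  (h ^ (2 * ((2 * r)%N%:Z - k%:Z)) * h ^ (2 * ((r%:Z - k.+1%:Z) * (r%:Z - k.+1%:Z))))).
  by rewrite exprS; ring.
by rewrite E; ring.
Qed.

Lemma sum_gauss_alternating r :
  \sum_(k < (2 * r).+2) gauss h (2 * r).+1 k *
    ((-1) ^+ k * h ^ (2 * ((r%:Z - k%:Z) * (r%:Z - k%:Z)))) =
  (-1) ^+ r * qpoch x (x ^+ 2) r.+1.
Proof.
rewrite -/(odd_sum r); elim: r => [|r IH]; rewrite odd_sumE.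
  rewrite mulr0 add0r expr0 mul1r qpochS qpoch0 mul1r expr0 mulr1.
  rewrite /even_sum big_ord_recl big_ord0 addr0 /gauss !qpoch0 mulr1 invr1 !mul1r.
  by rewrite mulr1.
have X : x * x ^+ 2 ^+ r.+1 = h ^ (4 * r.+1%:Z + 2).
  by rewrite -(exprM x 2) -(exprS x) sqr_nomeX; congr (_ ^ _); lia.
by rewrite even_sumS IH (qpochS _ _ r.+1) X (exprS (-1)); ring.
Qed.

End GaussSums.

(** * A mod 6 theta series *)

Section ModSix.
Variables (R : realType) (h : R[i]).
Hypotheses (h0 : 0 < `|h|) (h1 : `|h| < 1).
Local Notation x := (h ^+ 2).
Local Notation x1 := (norm_sqr_nome_lt1 h1).
Local Notation hn0 := (nome_neq0 h0).

Lemma boundedD (T : Type) (u v : T -> R[i]) :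
  bounded_family u -> bounded_family v -> bounded_family (fun i => u i + v i).
Proof.
by move=> [M hM] [N hN]; exists (M + N) => i; apply: le_trans (ler_normD _ _) (lerD (hM i) (hN i)).
Qed.

Lemma norm_sqr_nome_le : `|x| <= `|h|.
Proof. by rewrite normrX -[leRHS]expr1; apply: ler_wiXn2l => //; exact: ltW. Qed.

Lemma bounded_qpoch_infV (T : Type) (e : T -> nat) : (forall i, (0 < e i)%N) ->
  bounded_family (fun i => (qpoch_inf (- h ^+ e i) x)^-1).
Proof.
move=> e0; have [M hM] := qpoch_inf_bounds (normr_ge0 h) h1; exists M => i.
have hn : `|- h ^+ e i| <= `|h|.
  by rewrite normrN normrX -[leRHS]expr1; apply: ler_wiXn2l => //; exact: ltW.
by have [] := hM _ _ hn norm_sqr_nome_le.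
Qed.

Lemma add1_expz_neq0 (j : int) : j != 0 -> 1 + h ^ j != 0.
Proof.
move=> j0; apply/eqP => /(congr1 (fun u => `|u - 1|)).
rewrite [1 + _]addrC addrK sub0r normrN1 norm_expz => /eqP.
by rewrite pexprz_eq1 // (negPf j0) lt_eqF.
Qed.

Lemma signz_sub (m n : nat) : (-1 : R[i]) ^ (m%:Z - n%:Z) = (-1) ^+ m * (-1) ^+ n.
Proof.
rewrite expfzDr ?oppr_eq0 ?oner_eq0 //; congr (_ * _).
by rewrite -invr_expz -[(-1) ^ _]/((-1) ^+ n) invr_sign.
Qed.

(** The alternating Gaussian sum writes [1 / (x^2; x^2)_r] as a sum over
    [a + b = 2 r + 1]; a vanishing sum is added to it so that the diagonal
    [b - a = 2 t + 1] carries the factor [1 + h^(2 t + 1)] that cancels the one in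
    [diagonal_sum_shift].  In other words, a Bailey pair relative to [x]. *)
Lemma mod_six_sum (T : R[i]) :
  sums_to (fun t : int => (-1) ^ t * h ^ (3 * (t * t) + 2 * t)) T ->
  sums_to (fun r : nat => h ^ (r%:Z * r%:Z + 2 * r%:Z) /
      (qpoch_inf (- h ^+ (2 * r).+1) x * qpoch (x ^+ 2) (x ^+ 2) r))
    (T / qpoch_inf x x).
Proof.
(* If [a + b] is odd, then [a = r - t] and [b = r + t + 1]. *)
pose rr (ab : nat * nat) := (ab.1 + ab.2)./2.
pose tt (ab : nat * nat) : int := (rr ab)%:Z - ab.1%:Z.
pose c (t : int) : R[i] := (-1) ^ t * h ^ (2 * (t * t)) * (1 + h ^ (2 * t + 1)).
pose G (ab : nat * nat) := if odd (ab.1 + ab.2) then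
  h ^ ((rr ab)%:Z * (rr ab)%:Z + 2 * (rr ab)%:Z) * c (tt ab) /
  (qpoch x x ab.1 * qpoch x x ab.2 * qpoch_inf (- h ^+ (2 * rr ab).+1) x) else 0.
have rrE ab : odd (ab.1 + ab.2) -> (ab.1 + ab.2 = (2 * rr ab).+1)%N.
  by move=> o; rewrite -[LHS]odd_double_half o /= add1n mul2n.
have sG : abs_summable G.
  pose u (ab : nat * nat) := (-1) ^+ absz (tt ab) *
    (h ^ ((rr ab)%:Z * (rr ab)%:Z + 2 * (tt ab * tt ab)) +
     h ^ ((rr ab)%:Z * (rr ab)%:Z + (tt ab * tt ab) + (tt ab + 1) * (tt ab + 1))) *
    (h ^ (- 1) * ((qpoch x x ab.1)^-1 * (qpoch x x ab.2)^-1 * (qpoch_inf (- h ^+ (2 * rr ab).+1) x)^-1)).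
  have bu : bounded_family u.
    apply: boundedM.
      apply: boundedM; first exact: bounded_sign.
      apply: boundedD; apply: bounded_expz => // ab; nia.
    apply: boundedM; first exact: bounded_cst.
    apply: boundedM; last by apply: (@bounded_qpoch_infV _ (fun ab => (2 * rr ab).+1)).
    by apply: boundedM; apply: (bounded_comp _ (bounded_qfactV h1)).
  have sgg := abs_summable_prod (abs_summable_geometric h1) (abs_summable_geometric h1).
  apply: abs_summable_le (abs_summableM bu sgg) => ab; rewrite /G.
  case: ifP => [oab|_]; last by rewrite normr0.
  rewrite le_eqVlt; apply/orP; left; apply/eqP; congr `|_|; rewrite /c expN1r /u.
  have -> : h ^+ ab.1 * h ^+ ab.2 = h ^ (2 * (rr ab)%:Z + 1).
    by rewrite -exprD exprnP (rrE _ oab); congr (_ ^ _); lia.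
  set r := rr ab; set t := tt ab.
  have E1 : h ^ (r%:Z * r%:Z + 2 * (t * t)) * (h ^ (- 1) * h ^ (2 * r%:Z + 1)) =
     h ^ (r%:Z * r%:Z + 2 * r%:Z) * h ^ (2 * (t * t)).
    by rewrite -!expfzDr ?hn0 //; congr (_ ^ _); ring.
  have E2 : h ^ (r%:Z * r%:Z + t * t + (t + 1) * (t + 1)) * (h ^ (- 1) * h ^ (2 * r%:Z + 1)) =
     h ^ (r%:Z * r%:Z + 2 * r%:Z) * h ^ (2 * (t * t)) * h ^ (2 * t + 1).
    by rewrite -!expfzDr ?hn0 //; congr (_ ^ _); ring.
  rewrite !invfM.
  transitivity ((-1) ^+ absz t * ((qpoch x x ab.1)^-1 * (qpoch x x ab.2)^-1 * (qpoch_inf (- h ^+ (2 * r).+1) x)^-1) *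
    (h ^ (r%:Z * r%:Z + 2 * (t * t)) * (h ^ (- 1) * h ^ (2 * r%:Z + 1)) +
     h ^ (r%:Z * r%:Z + t * t + (t + 1) * (t + 1)) * (h ^ (- 1) * h ^ (2 * r%:Z + 1)))).
    by rewrite E1 E2; ring.
  by ring.
have fibr r : sums_to (fun ab => if rr ab == r then G ab else 0)
    (h ^ (r%:Z * r%:Z + 2 * r%:Z) /
      (qpoch_inf (- h ^+ (2 * r).+1) x * qpoch (x ^+ 2) (x ^+ 2) r)).
  apply: (@eq_sums_to _ _ (fun ab => if (ab.1 + ab.2)%N == (2 * r).+1 then G ab else 0)).
    move=> ab; case o: (odd (ab.1 + ab.2)); last by rewrite /G o; case: ifP; case: ifP.
    by rewrite (_ : (rr ab == r) = ((ab.1 + ab.2)%N == (2 * r).+1)) // rrE //; apply/eqP/eqP; lia.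
  apply: (@sums_to_fibre _ _ _ _ _ _ _ (fun k : 'I_(2 * r).+2 => (val k, ((2 * r).+1 - k)%N))).
  - by move=> k l [+ _]; exact: val_inj.
  - by move=> k /=; rewrite subnKC // -ltnS.
  - move=> [a b] /= abr; have km : (a < (2 * r).+2)%N by lia.
    by exists (Ordinal km); rewrite /= -abr addKn.
  have S0 : \sum_(k < (2 * r).+2) gauss h (2 * r).+1 k * ((-1) ^+ k *
      h ^ (2 * ((r%:Z - k%:Z) * (r%:Z - k%:Z)) + (2 * (r%:Z - k%:Z) + 1))) = 0.
    have := @odd_sum_reflect _ h h0 h1 r (fun t => h ^ (2 * (t * t) + (2 * t + 1))).
    apply=> t.
    by congr (_ ^ _); ring.
  pose A := h ^ (r%:Z * r%:Z + 2 * r%:Z) * (-1) ^+ r /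
    (qpoch x x (2 * r).+1 * qpoch_inf (- h ^+ (2 * r).+1) x).
  have qi0 : qpoch_inf (- h ^+ (2 * r).+1) x != 0.
    by apply: qpoch_inf_neq0; rewrite ?norm_Nh_lt1 ?x1.
  rewrite [X in sums_to _ X](_ : _ = \sum_(k < (2 * r).+2) G (val k, ((2 * r).+1 - k)%N)).
    exact: sums_to_fin.
  transitivity (A * ((-1) ^+ r * qpoch x (x ^+ 2) r.+1 + 0)).
    have Q := qfact_neq0 h1 (2 * r).+1; move: Q; rewrite /A qpoch_split_odd -expr2.
    rewrite mulf_eq0 negb_or => /andP[Q1 Q2].
    have s0 : (-1 : R[i]) ^+ r * (-1) ^+ r = 1 by rewrite -exprMn mulrNN mulr1 expr1n.
    rewrite -[LHS]mulr1 -[X in _ * X = _]s0 addr0.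
    by field; apply/and3P.
  rewrite -[X in _ * (_ + X) = _]S0 -(sum_gauss_alternating h0 h1) -big_split mulr_sumr /=.
  apply: eq_bigr => k _; have km : (k <= (2 * r).+1)%N := ltn_ord k.
  have rk : rr (val k, ((2 * r).+1 - k)%N) = r.
    have := rrE (val k, ((2 * r).+1 - k)%N); rewrite /= subnKC //= oddM /= => /(_ isT).
    by move=> E; lia.
  rewrite /G /= subnKC //= oddM /= /c /tt rk /= signz_sub /A /gauss.
  rewrite [h ^ (_ + (_ + 1))]expfzDr ?hn0 //.
  have q1 := qfact_neq0 h1 (2 * r).+1; have q2 := qfact_neq0 h1 k.
  have q3 := qfact_neq0 h1 ((2 * r).+1 - k).
  by field; apply/and4P.
have fibt (t : int) : sums_to (fun ab => if tt ab == t then G ab else 0)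
    ((-1) ^ t * h ^ (3 * (t * t) + 2 * t) / qpoch_inf x x).
  have j0 : 2 * t + 1 != 0 by apply/eqP; lia.
  have o0 := add1_expz_neq0 j0; have xi0 := qfact_inf_neq0 h1.
  have := sums_toZ (c t * h ^ (t * t + 2 * t)) (diagonal_sum_shift h0 h1 j0).
  have -> : c t * h ^ (t * t + 2 * t) * (qpoch_inf x x * (1 + h ^ (2 * t + 1)))^-1 =
     (-1) ^ t * h ^ (3 * (t * t) + 2 * t) / qpoch_inf x x.
    have -> : 3 * (t * t) + 2 * t = 2 * (t * t) + (t * t + 2 * t) by ring.
    by rewrite [h ^ (2 * (t * t) + _)]expfzDr ?hn0 // /c; field; apply/andP.
  apply: eq_sums_to => -[a b]; have rE := rrE (a, b); rewrite /= in rE *.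
  rewrite /G /tt /=; case o: (odd (a + b)); last first.
    rewrite if_same; case: eqP => [E|_]; last by rewrite mulr0.
    exfalso; move: o E; clear; move=> o E; have := odd_double_half (a + b)%N.
    rewrite o add0n -mul2n; lia.
  have {rE} := rE o; move: (rr (a, b)) => r E.
  have -> : (r%:Z - a%:Z == t) = (b%:Z - a%:Z == 2 * t + 1).
    by move: E; clear; move=> E; apply/eqP/eqP; lia.
  case: eqP => [abt|_]; last by rewrite mulr0.
  have Er : r%:Z = t + a%:Z by move: E abt; clear; lia.
  have Eb : b%:Z = a%:Z + 2 * t + 1 by move: abt; clear; lia.
  rewrite E.
  have -> : h ^ (r%:Z * r%:Z + 2 * r%:Z) =
     h ^ (t * t + 2 * t) * h ^ (a%:Z * b%:Z + a%:Z).
    by rewrite -expfzDr ?hn0 // Er Eb; congr (_ ^ _); ring.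
  by rewrite Er addrK; ring.
move=> hT; apply: sums_to_regroup sG fibt fibr _.
exact: sums_toZr.
Qed.

End ModSix.

(** * Splitting q-shifted factorials *)

Section QpochSplit.
Variable R : realType.

Lemma qpoch_cube (w a y : R[i]) n : w ^+ 2 + w + 1 = 0 ->
  qpoch a y n * qpoch (w * a) y n * qpoch (w ^+ 2 * a) y n = qpoch (a ^+ 3) (y ^+ 3) n.
Proof.
move=> w0; rewrite /qpoch -!big_split /=; apply: eq_bigr => k _.
rewrite -(exprM y 3 k) mulnC exprM; set u := y ^+ k.
have w1 : w ^+ 2 = - w - 1 by apply/eqP; rewrite -subr_eq0 -w0; apply/eqP; ring.
have w3 : w ^+ 3 = 1 by rewrite exprS w1 mulrBr mulrN -expr2 w1; ring.
transitivity (1 - (w ^+ 2 + w + 1) * (a * u) + (w ^+ 2 + w + w ^+ 3) * (a * u) ^+ 2 - w ^+ 3 * (a * u) ^+ 3).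
  by ring.
by rewrite w3 w0; ring.
Qed.

Lemma qpoch_inf_cube (w a y : R[i]) : w ^+ 2 + w + 1 = 0 -> `|y| < 1 ->
  qpoch_inf a y * qpoch_inf (w * a) y * qpoch_inf (w ^+ 2 * a) y =
  qpoch_inf (a ^+ 3) (y ^+ 3).
Proof.
move=> w0 y1; have y31 : `|y ^+ 3| < 1 by rewrite normrX exprn_ilt1.
apply: (@cvg_uniq _ (fun n => qpoch (a ^+ 3) (y ^+ 3) n)); last exact: qpoch_cvg.
under eq_fun do rewrite -(qpoch_cube _ _ _ w0).
by apply: cvgM; [apply: cvgM|]; exact: qpoch_cvg.
Qed.

Lemma qpoch_split3 (a y : R[i]) n :
  qpoch a y (3 * n) = qpoch a (y ^+ 3) n * qpoch (a * y) (y ^+ 3) n * qpoch (a * y ^+ 2) (y ^+ 3) n.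
Proof.
elim: n => [|n IH]; first by rewrite !qpoch0 !mulr1.
rewrite (_ : 3 * n.+1 = (3 * n).+3)%N; last by lia.
rewrite 3!qpochS IH !(qpochS _ _ n) -!(exprM y 3) !(exprS _ (3 * n)) !exprSr; ring.
Qed.

Lemma cvg_subseq (u : nat -> R[i]) (l : R[i]) k : (0 < k)%N ->
  (u n @[n --> \oo] --> l -> u (k * n)%N @[n --> \oo] --> l)%classic.
Proof.
move=> k0 /cvgrPdist_lt hu; apply/cvgrPdist_lt => e e0; have [N _ hN] := hu e e0.
by exists N => // n /= Nn; apply: hN => /=; apply: leq_trans Nn _; rewrite leq_pmull.
Qed.

Lemma qpoch_inf_split3 (a y : R[i]) : `|y| < 1 ->
  qpoch_inf a y = qpoch_inf a (y ^+ 3) * qpoch_inf (a * y) (y ^+ 3) * qpoch_inf (a * y ^+ 2) (y ^+ 3).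
Proof.
move=> y1; have y31 : `|y ^+ 3| < 1 by rewrite normrX exprn_ilt1.
apply: (@cvg_uniq _ (fun n => qpoch a y (3 * n)%N)).
  by apply: cvg_subseq => //; exact: qpoch_cvg.
under eq_fun do rewrite qpoch_split3.
by apply: cvgM; [apply: cvgM|]; exact: qpoch_cvg.
Qed.

Lemma qpoch_split2 (a y : R[i]) n :
  qpoch a y (2 * n) = qpoch a (y ^+ 2) n * qpoch (a * y) (y ^+ 2) n.
Proof.
elim: n => [|n IH]; first by rewrite !qpoch0 !mulr1.
rewrite (_ : 2 * n.+1 = (2 * n).+2)%N; last by lia.
rewrite 2!qpochS IH !(qpochS _ _ n) -!(exprM y 2) !(exprS _ (2 * n)); ring.
Qed.

Lemma qpoch_inf_split2 (a y : R[i]) : `|y| < 1 ->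
  qpoch_inf a y = qpoch_inf a (y ^+ 2) * qpoch_inf (a * y) (y ^+ 2).
Proof.
move=> y1; have y21 : `|y ^+ 2| < 1 by rewrite normrX exprn_ilt1.
apply: (@cvg_uniq _ (fun n => qpoch a y (2 * n)%N)).
  by apply: cvg_subseq => //; exact: qpoch_cvg.
under eq_fun do rewrite qpoch_split2.
by apply: cvgM; exact: qpoch_cvg.
Qed.

End QpochSplit.

(** * The cubic theta series *)

Section ThetaProduct.
Variables (R : realType) (h : R[i]).
Hypotheses (h0 : 0 < `|h|) (h1 : `|h| < 1).
Local Notation x := (h ^+ 2).
Local Notation x1 := (norm_sqr_nome_lt1 h1).
Local Notation hn0 := (nome_neq0 h0).

Lemma theta_product (y : R[i]) : y != 0 -> `|y| <= 1 -> `|x / y| <= 1 ->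
  sums_to (fun n : int => (- y) ^ n * h ^ (n * n - n))
    (qpoch_inf x x * qpoch_inf y x * qpoch_inf (x / y) x).
Proof.
move=> y0 y1 xy1; pose w := - (y / h).
have w0 : w != 0 by rewrite oppr_eq0 mulf_neq0 ?invr_eq0 ?hn0.
have hw : h * w = - y by rewrite /w mulrN mulrC mulfVK ?hn0.
have hw' : h / w = - (x / y) by rewrite /w invrN mulrN invf_div mulrA -expr2.
have := @jacobi_triple _ _ h0 h1 w w0; rewrite hw hw' !normrN !opprK => /(_ y1 xy1).
apply: eq_sums_to => n; rewrite -hw expfzMl mulrAC -expfzDr ?hn0 //.
by congr (_ ^ _ * _); ring.
Qed.

Lemma mulz_self_ge0 (z : int) : 0 <= z * z.
Proof. by rewrite -expr2 sqr_ge0. Qed.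

Lemma abs_summable_cubic (c : int) :
  abs_summable (fun mn : int * int =>
    h ^ (2 * (mn.1 * mn.1 + mn.1 * mn.2 + mn.2 * mn.2) + c * (mn.1 + mn.2))).
Proof.
have sq := abs_summable_quadratic c h0 h1.
apply: (@eq_abs_summable _ _ (fun mn : int * int => h ^ ((mn.1 + mn.2) * (mn.1 + mn.2)) *
   (h ^ (mn.1 * mn.1 + c * mn.1) * h ^ (mn.2 * mn.2 + c * mn.2)))).
  by move=> mn; rewrite -!expfzDr ?hn0 //; congr (_ ^ _); ring.
by apply: abs_summableM (abs_summable_prod sq sq); apply: bounded_expz => // mn;
  exact: mulz_self_ge0.
Qed.

End ThetaProduct.

Section CubicTheta.
Variables (R : realType) (h : R[i]).
Hypotheses (h0 : 0 < `|h|) (h1 : `|h| < 1).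
Local Notation x := (h ^+ 2).
Local Notation x1 := (norm_sqr_nome_lt1 h1).
Local Notation hn0 := (nome_neq0 h0).

Let h3 := h ^+ 3.
Let h30 : 0 < `|h3|. Proof. by rewrite normrX exprn_gt0. Qed.
Let h31 : `|h3| < 1. Proof. by rewrite normrX exprn_ilt1. Qed.
Let x3E : h3 ^+ 2 = x ^+ 3. Proof. by rewrite /h3 -!exprM. Qed.

Lemma exists_cube_root : exists w : R[i], w ^+ 2 + w + 1 = 0.
Proof.
exists ((-1 + sqrtc (-3)) / 2); have s3 := sqr_sqrtc (-3 : R[i]).
transitivity ((sqrtc (-3) ^+ 2 + 3) / 4 : R[i]); first by field.
by rewrite s3 addNr mul0r.
Qed.

Lemma sums_to_mod3 (F : int -> R[i]) s v0 v1 v2 :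
  sums_to F s -> sums_to (fun t => F (3 * t)) v0 -> sums_to (fun t => F (3 * t + 1)) v1 ->
  sums_to (fun t => F (3 * t + 2)) v2 -> s = v0 + v1 + v2.
Proof.
move=> hF H0 H1 H2.
have cl (i : int) v : 0 <= i -> i < 3 -> sums_to (fun t => F (3 * t + i)) v ->
    sums_to (fun N => if (N %% 3)%Z == i then F N else 0) v.
  move=> i0 i3 hv; apply: (@sums_to_fibre _ _ _ _ _ _ _ (fun t : int => 3 * t + i)) => //.
  - by move=> t u; lia.
  - by move=> t; lia.
  - by move=> N Ni; exists (N %/ 3)%Z; lia.
have {}H0 := cl 0 _ isT isT (eq_sums_to (fun t => congr1 F (esym (addr0 _))) H0).
have {}H1 := cl 1 _ isT isT H1; have {}H2 := cl 2 _ isT isT H2.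
apply: sums_to_uniq hF _; apply: eq_sums_to (sums_toD (sums_toD H0 H1) H2) => N.
have N3 : (N %% 3)%Z = 0 \/ (N %% 3)%Z = 1 \/ (N %% 3)%Z = 2 by lia.
by case: N3 => [->|[->|->]]; rewrite /= ?addr0 ?add0r.
Qed.

(** Around the central triple [(t, t, t)], [(t, t, t + 1)] or [(t + 1, t + 1, t)] of sum
    [N], the exponent of the cube of a theta series is, up to a constant, the quadratic
    form [2 (m^2 + m n + n^2)], with the linear term [2 (m + n)] in the last two cases. *)
Lemma theta_cube_fibre (z A c : R[i]) (N : int) (t := (N %/ 3)%Z) (i := (N %% 3)%Z) :
  z != 0 ->
  sums_to (fun mn : int * int => h ^ (2 * (mn.1 * mn.1 + mn.1 * mn.2 + mn.2 * mn.2) +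
    0 * (mn.1 + mn.2))) A ->
  sums_to (fun mn : int * int => h ^ (2 * (mn.1 * mn.1 + mn.1 * mn.2 + mn.2 * mn.2) +
    2 * (mn.1 + mn.2))) c ->
  sums_to (fun abc : int * int * int => if abc.1.1 + abc.1.2 + abc.2 == N then
      z ^ abc.1.1 * h ^ (abc.1.1 * abc.1.1 - abc.1.1) *
      (z ^ abc.1.2 * h ^ (abc.1.2 * abc.1.2 - abc.1.2)) *
      (z ^ abc.2 * h ^ (abc.2 * abc.2 - abc.2)) else 0)
    (z ^ N * h ^ (3 * (t * t - t) + 2 * t * i) * (if i == 0 then A else c)).
Proof.
move=> zn0 hA hc.
have NE : N = 3 * t + i by rewrite /t /i; lia.
have i3 : i = 0 \/ i = 1 \/ i = 2 by rewrite /i; lia.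
move: NE i3; rewrite -/t -/i; move: t i => t i NE i3.
have fib (g : int * int -> int * int * int) (B : R[i]) (d : int) :
    injective g -> (forall mn, (g mn).1.1 + (g mn).1.2 + (g mn).2 = N) ->
    (forall a b e : int, a + b + e = N -> exists mn, (a, b, e) = g mn) ->
    sums_to (fun mn : int * int => h ^ (2 * (mn.1 * mn.1 + mn.1 * mn.2 + mn.2 * mn.2) +
      d * (mn.1 + mn.2))) B ->
    (forall m n, let: (a, b, e) := g (m, n) in a * a - a + (b * b - b) + (e * e - e) =
       3 * (t * t - t) + 2 * t * i + (2 * (m * m + m * n + n * n) + d * (m + n))) ->
    sums_to (fun abc : int * int * int => if abc.1.1 + abc.1.2 + abc.2 == N then
        z ^ abc.1.1 * h ^ (abc.1.1 * abc.1.1 - abc.1.1) *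
        (z ^ abc.1.2 * h ^ (abc.1.2 * abc.1.2 - abc.1.2)) *
        (z ^ abc.2 * h ^ (abc.2 * abc.2 - abc.2)) else 0)
      (z ^ N * h ^ (3 * (t * t - t) + 2 * t * i) * B).
  move=> gI gN gS hB gE; apply: (sums_to_fibre gI gN) => [[[a b] e] /gS //|].
  have := sums_toZ (z ^ N * h ^ (3 * (t * t - t) + 2 * t * i)) hB.
  apply: eq_sums_to => -[m n].
  have := gN (m, n); have := gE m n; case: (g (m, n)) => -[a b] e /= {}gE {}gN.
  transitivity (z ^ (a + b + e) * h ^ (a * a - a + (b * b - b) + (e * e - e))).
    by rewrite gN gE [h ^ (_ + (_ + _))]expfzDr ?hn0 // mulrA.
  rewrite (@expfzDr _ z (a + b)) // (@expfzDr _ z a) //.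
  rewrite (@expfzDr _ h (a * a - a + (b * b - b))) ?hn0 // (@expfzDr _ h (a * a - a)) ?hn0 //.
  by ring.
case: i3 => [i0|[i1|i2]].
- have -> : (if i == 0 then A else c) = A by rewrite i0.
  apply: (fib (fun mn => (t + mn.1, t + mn.2, t - mn.1 - mn.2)) A 0) => //.
  + by move=> [m n] [m' n'] [] /addrI -> /addrI ->.
  + by move=> [m n] /=; rewrite NE i0; ring.
  + by rewrite NE i0 => a b e abe; exists (a - t, b - t); rewrite -[e](addKr (a + b)) abe /=; congr (_, _, _); ring.
  + by move=> m n; rewrite i0; ring.
- have -> : (if i == 0 then A else c) = c by rewrite i1.
  apply: (fib (fun mn => (t - mn.1, t - mn.2, t + 1 + mn.1 + mn.2)) c 2) => //.
  + by move=> [m n] [m' n'] [] /addrI/oppr_inj -> /addrI/oppr_inj ->.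
  + by move=> [m n] /=; rewrite NE i1; ring.
  + by rewrite NE i1 => a b e abe; exists (t - a, t - b); rewrite -[e](addKr (a + b)) abe /=; congr (_, _, _); ring.
  + by move=> m n; rewrite i1; ring.
- have -> : (if i == 0 then A else c) = c by rewrite i2.
  apply: (fib (fun mn => (t + 1 + mn.1, t + 1 + mn.2, t - mn.1 - mn.2)) c 2) => //.
  + by move=> [m n] [m' n'] [] /addrI -> /addrI ->.
  + by move=> [m n] /=; rewrite NE i2; ring.
  + by rewrite NE i2 => a b e abe; exists (a - t - 1, b - t - 1); rewrite -[e](addKr (a + b)) abe /=; congr (_, _, _); ring.
  + by move=> m n; rewrite i2; ring.
Qed.

Lemma qfact_split3 : qpoch_inf x x =
  qpoch_inf (x ^+ 3) (x ^+ 3) * qpoch_inf x (x ^+ 3) * qpoch_inf (x ^+ 2) (x ^+ 3).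
Proof.
have H (y : R[i]) : `|y| < 1 -> qpoch_inf y y =
    qpoch_inf (y ^+ 3) (y ^+ 3) * qpoch_inf y (y ^+ 3) * qpoch_inf (y ^+ 2) (y ^+ 3).
  by move=> y1; rewrite (qpoch_inf_split3 y y1) -expr2 -exprS; ring.
exact: H x1.
Qed.

(** Cube the theta series at a primitive cube root of unity [w]: its expansion by
    [N = a + b + c] is a cubic theta series on each class of [N] modulo 3.  The class
    of [0] is multiplied by a theta series with a vanishing factor, the other two by
    [(x; x)_oo], which leaves [(1 - w)^3 (x^3; x^3)_oo^3 = (w^2 - w) (x; x)_oo c]. *)
Lemma cubic_theta :
  sums_to (fun mn : int * int => h ^ (2 * (mn.1 * mn.1 + mn.1 * mn.2 + mn.2 * mn.2) +
      2 * (mn.1 + mn.2)))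
    (3 * qpoch_inf (x ^+ 3) (x ^+ 3) ^+ 3 / qpoch_inf x x).
Proof.
have [w w0] := exists_cube_root.
have w2 : w ^+ 2 = - w - 1 by apply/eqP; rewrite -subr_eq0 -w0; apply/eqP; ring.
have w3 : w ^+ 3 = 1 by rewrite exprS w2 mulrBr mulrN -expr2 w2; ring.
have wn0 : w != 0 by apply/eqP => wz; move/eqP: w3; rewrite wz expr0n eq_sym oner_eq0.
have nw : `|w| = 1.
  have /eqP := congr1 (fun u : R[i] => `|u|) w3; rewrite normrX normr1.
  by rewrite pexpr_eq1 // => /eqP.
have [c hc] := abs_summable_sums_to (abs_summable_cubic h0 h1 2).
have [A hA] := abs_summable_sums_to (abs_summable_cubic h0 h1 0).
suff -> : 3 * qpoch_inf (x ^+ 3) (x ^+ 3) ^+ 3 / qpoch_inf x x = c by exact: hc.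
pose X1 := qpoch_inf x x; pose X3 := qpoch_inf (x ^+ 3) (x ^+ 3).
have X10 : X1 != 0 by exact: qfact_inf_neq0.
pose th (n : int) := (- w) ^ n * h ^ (n * n - n).
pose Th := (1 - w) * X3.
have hTh : sums_to th Th.
  have xw1 : `|x / w| <= 1 by rewrite normf_div nw divr1 ltW // x1.
  have w1 : `|w| <= 1 by rewrite nw.
  have := theta_product h0 h1 wn0 w1 xw1.
  have -> : qpoch_inf x x * qpoch_inf w x * qpoch_inf (x / w) x = Th; last by [].
  rewrite /Th /X3 -(qpoch_inf_cube x w0 x1).
  rewrite (@qpoch_infD _ w x 1 x1) qpochS qpoch0 mul1r expr0 mulr1 expr1.
  have wV : w^-1 = w ^+ 2 by apply: (mulfI wn0); rewrite divff // -exprS w3.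
  rewrite wV [x * w ^+ 2]mulrC.
  by ring.
have sth : abs_summable th.
  apply: abs_summable_le (abs_summable_quadratic (-1) h0 h1) => n.
  by rewrite /th normrM norm_expz normrN nw exp1rz mul1r mulN1r.
pose T3 (abc : int * int * int) := th abc.1.1 * th abc.1.2 * th abc.2.
have hT3 : sums_to T3 (Th * Th * Th).
  have h2 := sums_to_prod sth sth hTh hTh.
  exact: sums_to_prod (abs_summable_prod sth sth) sth h2 hTh.
pose S (N : int) := (- w) ^ N * h ^ (3 * ((N %/ 3)%Z * (N %/ 3)%Z - (N %/ 3)%Z) + 2 * (N %/ 3)%Z * (N %% 3)%Z) *
   (if (N %% 3)%Z == 0 then A else c).
have mw0 : - w != 0 by rewrite oppr_eq0.
have hS N := theta_cube_fibre N mw0 hA hc : sums_to (fun abc => if abc.1.1 + abc.1.2 + abc.2 == N then T3 abc else 0) (S N).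
have hST := sums_to_fibres (p := fun abc : int * int * int => abc.1.1 + abc.1.2 + abc.2) hT3 hS.
have mw3 (t : int) : (- w) ^ (3 * t) = (-1) ^ t.
  by rewrite -exprz_exp -[_ ^ 3%:Z]/((- w) ^+ 3) exprNn w3 mulr1 -signr_odd.
have xn0 : x != 0 by rewrite expf_neq0 ?hn0.
have x31 : `|x ^+ 3| < 1 by rewrite normrX exprn_ilt1 // x1.
have hcl (i : nat) v : (i < 3)%N ->
    qpoch_inf (x ^+ 3) (x ^+ 3) * qpoch_inf (x ^+ i) (x ^+ 3) *
      qpoch_inf (x ^+ (3 - i)) (x ^+ 3) = v ->
    sums_to (fun t : int => S (3 * t + i%:Z)) ((- w) ^+ i * (if i == 0%N then A else c) * v).
  move=> i3 <-.
  have xi0 : x ^+ i != 0 by rewrite expf_neq0.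
  have := theta_product h30 h31 xi0.
  rewrite x3E; have -> : x ^+ 3 / x ^+ i = x ^+ (3 - i).
    by rewrite expfB_cond // (negPf xn0) ltnW.
  have le1 k : `|x ^+ k| <= 1 by exact: (@norm_nomeX_le1 _ x (norm_sqr_nome_gt0 h0) x1 k).
  move=> /(_ (le1 _) (le1 _)) /(sums_toZ ((- w) ^+ i * (if i == 0%N then A else c))).
  apply: eq_sums_to => /= t; rewrite /S; have [-> ->] : ((3 * t + i) %/ 3)%Z = t /\ ((3 * t + i) %% 3)%Z = i.
    by clear -i3; split; lia.
  rewrite (@expfzDr _ (- w)) // mw3.
  rewrite -[3 * (t * t - t) + 2 * t * i]/(3 * (t * t - t) + 2 * t * i%:Z).
  have e1 : h ^ (3 * (t * t - t) + 2 * t * i%:Z) = h3 ^ (t * t - t) * (x ^+ i) ^ t.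
    have e0 : (x ^+ i) ^ t = h ^ (2 * t * i%:Z).
      by rewrite (sqr_nomeX h i) exprz_exp; congr (_ ^ _); ring.
    have e0' : h3 ^ (t * t - t) = h ^ (3 * (t * t - t)) by rewrite -[h3]/(h ^ 3%:Z) exprz_exp.
    by rewrite (@expfzDr _ h) ?hn0 // e0 e0'.
  have e2 : (- x ^+ i) ^ t = (-1) ^ t * (x ^+ i) ^ t by rewrite -(mulN1r (x ^+ i)) expfzMl.
  have e3 : (if i%:Z == 0 then A else c) = (if i == 0%N then A else c) by [].
  by rewrite e1 e2 e3 -[(- w) ^ i%:Z]/((- w) ^+ i); ring.
have H0 : sums_to (fun t : int => S (3 * t)) 0.
  have := hcl 0%N 0 isT; rewrite mulr0 => H.
  apply: eq_sums_to (H _) => [t|]; first by rewrite addr0.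
  by rewrite expr0 (@qpoch_infD _ 1 (x ^+ 3) 1 x31) qpochS expr0 mulr1 subrr mulr0 !mul0r mulr0 mul0r.
have X1E : X1 = _ := qfact_split3.
have H1 : sums_to (fun t : int => S (3 * t + 1)) ((- w) ^+ 1 * c * X1).
  exact: (hcl 1%N X1 isT (esym X1E)).
have H2 : sums_to (fun t : int => S (3 * t + 2)) ((- w) ^+ 2 * c * X1).
  by apply: (hcl 2%N X1 isT); rewrite X1E mulrAC.
have E := sums_to_mod3 hST H0 H1 H2.
have w3' : (1 - w) ^+ 3 = 3 * (w ^+ 2 - w).
  transitivity (1 - w ^+ 3 + 3 * (w ^+ 2 - w)); first by ring.
  by rewrite w3 subrr add0r.
have ww : w ^+ 2 - w != 0.
  apply/eqP => ww; have /eqP := w3'; rewrite ww mulr0 expf_eq0 /= subr_eq0 => /eqP w11.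
  have : (3 : R[i]) = 0 by rewrite -w0 -w11; ring.
  by move/eqP; rewrite pnatr_eq0.
apply: (mulIf X10); rewrite divfK //; apply: (mulfI ww).
transitivity (Th * Th * Th); last by rewrite E; ring.
rewrite /Th -/X3; transitivity ((1 - w) ^+ 3 * X3 ^+ 3); last by ring.
by rewrite w3'; ring.
Qed.

End CubicTheta.

(** * Quadruple sums *)

Section Quadruples.
Variables (R : realType) (h : R[i]).
Hypotheses (h0 : 0 < `|h|) (h1 : `|h| < 1).
Local Notation x := (h ^+ 2).
Local Notation x1 := (norm_sqr_nome_lt1 h1).
Local Notation hn0 := (nome_neq0 h0).

Lemma sums_to_antidiagonal (f : nat * nat -> R[i]) m :
  sums_to (fun rs => if (rs.1 + rs.2)%N == m then f rs else 0)
    (\sum_(r < m.+1) f (val r, (m - r)%N)).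
Proof.
apply: (@sums_to_fibre _ _ _ _ _ _ _ (fun r : 'I_m.+1 => (val r, (m - r)%N))).
- by move=> r r' [] /val_inj.
- by move=> r /=; rewrite subnKC // -ltnS.
- move=> [r s] /= rs; have rm : (r < m.+1)%N by rewrite -rs ltnS leq_addr.
  by exists (Ordinal rm); rewrite /= -rs addKn.
exact: sums_to_fin.
Qed.

Lemma sums_to_antidiagonals (f : nat * nat * int -> R[i]) s :
  sums_to f s ->
  sums_to (fun mn : nat * int => \sum_(r < mn.1.+1) f (val r, (mn.1 - r)%N, mn.2)) s.
Proof.
move=> hs; apply: (sums_to_fibres (p := fun z : nat * nat * int => ((z.1.1 + z.1.2)%N, z.2)) hs).
move=> [m n] /=.
apply: (@sums_to_inj _ _ _ _ (fun rs : nat * nat => (rs, n))) => [r r' []//|[rs n'] /= rsn|].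
  case: eqP => // -[] _ n'n; case: (rsn rs); by rewrite n'n.
apply: eq_sums_to (sums_to_antidiagonal (fun rs => f (rs, n)) m) => -[r u] /=.
by rewrite xpair_eqE eqxx andbT.
Qed.

Lemma abs_summable_quadratic3 (a b c : int) :
  abs_summable (fun z : int * int * int => h ^ (z.1.1 * z.1.1 + a * z.1.1 +
    (z.1.2 * z.1.2 + b * z.1.2) + (z.2 * z.2 + c * z.2))).
Proof.
have H := abs_summable_prod (abs_summable_prod (abs_summable_quadratic a h0 h1)
  (abs_summable_quadratic b h0 h1)) (abs_summable_quadratic c h0 h1).
by apply: eq_abs_summable H => z; rewrite -!expfzDr ?hn0.
Qed.

(** The quadratic part common to both exponents is positive definite: it is
    [u^2 + v^2 + k^2 + l^2] with [u = i - j + k] and [v = j - l]. *)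
Lemma abs_summable_quadruple (a b c d : int) :
  abs_summable (fun z : nat * nat * nat * nat => let: (i, j, k, l) := z in
    let u := i%:Z - j%:Z + k%:Z in let v := j%:Z - l%:Z in
    h ^ (u * u + a * u + (v * v + b * v) + (k%:Z * k%:Z + c * k%:Z) + (l%:Z * l%:Z + d * l%:Z)) /
    (qpoch x x i * qpoch x x j * qpoch x x k * qpoch x x l)).
Proof.
have H := abs_summable_prod (abs_summable_quadratic3 a b c) (abs_summable_quadratic d h0 h1).
pose g (z : nat * nat * nat * nat) := let: (i, j, k, l) := z in
  (i%:Z - j%:Z + k%:Z, j%:Z - l%:Z, k%:Z, l%:Z).
have gI : injective g.
  move=> [[[i j] k] l] [[[i' j'] k'] l'] [] e1 e2 e3 e4.
  have -> : l = l' by []. 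
  have -> : k = k' by [].
  have jj : j = j' by lia.
  by rewrite jj; congr (_, _, _, _); lia.
have bV (pr : nat * nat * nat * nat -> nat) : bounded_family (fun z => (qpoch x x (pr z))^-1).
  exact: (bounded_comp pr (bounded_qfactV h1)).
have := abs_summableM (boundedM (boundedM (bV (fun z => z.1.1.1)) (bV (fun z => z.1.1.2)))
  (boundedM (bV (fun z => z.1.2)) (bV (fun z => z.2)))) (abs_summable_inj gI H).
apply: eq_abs_summable => -[[[i j] k] l] /=; rewrite -expfzDr ?hn0 //.
by rewrite !invfM; ring.
Qed.

(** Bracketing by [m = i + k] and [n = j - l] separates the quadruple sum into a finite
    q-binomial sum and a shifted Durfee sum. *)
Lemma sums_to_quadruple (f : nat * nat * nat * nat -> R[i]) (g : nat -> int -> R[i]) z e s :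
  (forall i j k l, f (i, j, k, l) = g (i + k)%N (j%:Z - l%:Z) *
     (h ^ (k%:Z * k%:Z) * z ^+ k / (qpoch x x i * qpoch x x k)) *
     (h ^ (2 * (j%:Z * l%:Z) - 2 * ((i + k + e)%N%:Z * j%:Z)) / (qpoch x x j * qpoch x x l))) ->
  abs_summable f ->
  sums_to (fun mn : nat * int => g mn.1 mn.2 * (qpoch (- (h * z)) x mn.1 / qpoch x x mn.1) *
    ((qpoch_inf x x)^-1 * durfee_poly h (mn.1 + e) mn.2)) s ->
  sums_to f s.
Proof.
move=> fE /abs_summable_sums_to[t ht] hs.
suff : sums_to (fun mn : nat * int => g mn.1 mn.2 *
    (qpoch (- (h * z)) x mn.1 / qpoch x x mn.1) *
    ((qpoch_inf x x)^-1 * durfee_poly h (mn.1 + e) mn.2)) t.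
  by move=> /(sums_to_uniq hs) ->.
pose G (w : nat * nat * int) := g (w.1.1 + w.1.2)%N w.2 *
  (h ^ (w.1.2%:Z * w.1.2%:Z) * z ^+ w.1.2 / (qpoch x x w.1.1 * qpoch x x w.1.2)) *
  ((qpoch_inf x x)^-1 * durfee_poly h (w.1.1 + w.1.2 + e) w.2).
have hG : sums_to G t.
  apply: (sums_to_fibres (p := fun w : nat * nat * nat * nat =>
    let: (i, j, k, l) := w in (i, k, j%:Z - l%:Z)) ht) => -[[i k] n].
  apply: (@sums_to_inj _ _ _ _ (fun jl : nat * nat => (i, jl.1, k, jl.2))) => [||].
  - by move=> [j l] [j' l'] [] -> ->.
  - move=> [[[i' j] k'] l] /= ne; case: eqP => // -[] ii kk _.
    by case: (ne (j, l)); rewrite /= ii kk.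
  - have := sums_toZ (g (i + k)%N n *
      (h ^ (k%:Z * k%:Z) * z ^+ k / (qpoch x x i * qpoch x x k)))
      (durfee_shifted h0 h1 (i + k + e) n).
    apply: eq_sums_to => -[j l]; rewrite [(j, l).1]/= [(j, l).2]/=.
    rewrite xpair_eqE eqxx /=; case: eqP => [<-|]; last by rewrite mulr0.
    by rewrite fE.
apply: (sums_to_fibres (p := fun w : nat * nat * int => ((w.1.1 + w.1.2)%N, w.2)) hG).
move=> [m n]; apply: (@sums_to_inj _ _ _ _ (fun ik : nat * nat => (ik, n))) => [||].
- by move=> ik ik' [].
- move=> [ik n'] /= ne; case: eqP => // -[] _ nn.
  by case: (ne ik); rewrite nn.
- have := sums_toZ (g m n * ((qpoch_inf x x)^-1 * durfee_poly h (m + e) n)) (q_binomial h0 h1 m z).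
  rewrite mulrAC; apply: eq_sums_to => -[i k] /=.
  rewrite xpair_eqE eqxx andbT; case: eqP => [<-|]; last by rewrite mulr0.
  by rewrite /G /= mulrAC.
Qed.

End Quadruples.

(** * The second identity *)

Section SecondSum.
Variables (R : realType) (h : R[i]).
Hypotheses (h0 : 0 < `|h|) (h1 : `|h| < 1).
Local Notation x := (h ^+ 2).
Local Notation x0 := (norm_sqr_nome_gt0 h0).
Local Notation x1 := (norm_sqr_nome_lt1 h1).
Local Notation hn0 := (nome_neq0 h0).

Let c := 3 * qpoch_inf (x ^+ 3) (x ^+ 3) ^+ 3 / qpoch_inf x x.
Let p := x ^+ 2.

(** Every coefficient of the cubic theta series is opened by [diagonal_sum] at the nome [x];
    the two summation variables become [b - a] and [a - n]. *)
Lemma cubic_diagonals :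
  sums_to (fun w : nat * nat * int => let: (a, b, n) := w in
      h ^ ((b%:Z - a%:Z) * (b%:Z - a%:Z) + 1 * (b%:Z - a%:Z) +
        ((a%:Z + b%:Z - n) * (a%:Z + b%:Z - n) + 1 * (a%:Z + b%:Z - n)) + (n * n + -1 * n)) /
      (qpoch p p a * qpoch p p b * qpoch_inf (- x ^+ (a + b).+1) p))
    (c / qpoch_inf p p).
Proof.
pose g (w : nat * nat * int) := let: (a, b, n) := w in
  (b%:Z - a%:Z, a%:Z + b%:Z - n, n : int).
have gI : injective g.
  move=> [[a b] n] [[a' b'] n'] [] e1 e2 e3; rewrite e3 in e2 *.
  by congr (_, _, _); lia.
have bV (e : nat * nat * int -> nat) : bounded_family (fun z => (qpoch p p (e z))^-1).
  exact: (bounded_comp e (bounded_qfactV x1)).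
have bI : bounded_family (fun w : nat * nat * int => (qpoch_inf (- x ^+ (w.1.1 + w.1.2).+1) p)^-1).
  exact: (bounded_qpoch_infV x1 (e := fun w => ((w.1.1 + w.1.2).+1)%N)).
have asum := abs_summableM (boundedM (boundedM (bV (fun w => w.1.1)) (bV (fun w => w.1.2))) bI)
  (abs_summable_inj gI (abs_summable_quadratic3 h0 h1 1 1 (- 1))).
apply: (sums_to_expand (p := fun w : nat * nat * int => let: (a, b, n) := w in
    (b%:Z - a%:Z, a%:Z - n)) (F := fun mn => h ^ (2 * (mn.1 * mn.1 + mn.1 * mn.2 + mn.2 * mn.2) +
      2 * (mn.1 + mn.2)) / qpoch_inf p p)).
- by apply: eq_abs_summable asum => -[[a b] n] /=; rewrite !invfM; ring.
- move=> [j v]; apply: (@sums_to_inj _ _ _ _ (fun ab : nat * nat => (ab, ab.1%:Z - v))) => [||].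
  + by move=> ab ab' [].
  + move=> [[a b] n] /= ne; case: eqP => // -[] _ e; case: (ne (a, b)); congr (_, _).
    by rewrite -e /=; ring.
  + have := sums_toZ (h ^ (2 * (j * j + j * v + v * v) + 2 * (j + v))) (diagonal_sum x0 x1 j).
    apply: eq_sums_to => -[a b] /=.
    rewrite xpair_eqE subKr eqxx andbT.
    case: eqP => [<-|]; last by rewrite mulr0.
    have -> : h ^ ((b%:Z - a%:Z) * (b%:Z - a%:Z) + 1 * (b%:Z - a%:Z) +
        ((a%:Z + b%:Z - (a%:Z - v)) * (a%:Z + b%:Z - (a%:Z - v)) + 1 * (a%:Z + b%:Z - (a%:Z - v))) +
        ((a%:Z - v) * (a%:Z - v) + -1 * (a%:Z - v))) =
      h ^ (2 * ((b%:Z - a%:Z) * (b%:Z - a%:Z) + (b%:Z - a%:Z) * v + v * v) + 2 * ((b%:Z - a%:Z) + v)) *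
      x ^ (a%:Z * b%:Z).
      by rewrite (sqr_nomez h) -expfzDr ?hn0 //; congr (_ ^ _); ring.
    by rewrite mulrA.
- exact: (sums_toZr _ (cubic_theta h0 h1)).
Qed.

(** The pairs with [a + b = r] collect to [1 / (x; x)_r], by [sum_gauss_triangular]
    and [(x; x)_r (- x; x)_r = (x^2; x^2)_r]. *)
Lemma cubic_pairs :
  sums_to (fun w : nat * int => h ^ ((w.1%:Z - w.2) * (w.1%:Z - w.2) + 1 * (w.1%:Z - w.2) +
        (w.2 * w.2 + -1 * w.2)) / (qpoch x x w.1 * qpoch_inf (- x ^+ w.1.+1) p))
    (c / qpoch_inf p p).
Proof.
apply: eq_sums_to (sums_to_antidiagonals cubic_diagonals) => -[r n]; rewrite [(r, n).1]/= [(r, n).2]/=.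
pose K := h ^ ((r%:Z - n) * (r%:Z - n) + 1 * (r%:Z - n) + (n * n + -1 * n)) / qpoch_inf (- x ^+ r.+1) p.
pose phi (k : nat) := h ^ ((2 * k%:Z - r%:Z) * (2 * k%:Z - r%:Z + 1)).
have E : qpoch (- x) x r = \sum_(a < r.+1) gauss x r a * phi (r - a)%N.
  by rewrite -(sum_gauss_rev _ _ phi) (sum_gauss_triangular h0 h1).
transitivity (K * ((qpoch p p r)^-1 * qpoch (- x) x r)).
  rewrite E !mulr_sumr; apply: eq_bigr => -[a /= ar] _; rewrite ltnS in ar.
  have hb : (r - a)%N%:Z = r%:Z - a%:Z by rewrite subzn.
  rewrite subnKC // /gauss /K /phi hb.
  have -> : h ^ ((r%:Z - a%:Z - a%:Z) * (r%:Z - a%:Z - a%:Z) + 1 * (r%:Z - a%:Z - a%:Z) +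
      ((a%:Z + (r%:Z - a%:Z) - n) * (a%:Z + (r%:Z - a%:Z) - n) + 1 * (a%:Z + (r%:Z - a%:Z) - n)) +
      (n * n + -1 * n)) =
    h ^ ((r%:Z - n) * (r%:Z - n) + 1 * (r%:Z - n) + (n * n + -1 * n)) *
    h ^ ((2 * (r%:Z - a%:Z) - r%:Z) * (2 * (r%:Z - a%:Z) - r%:Z + 1)).
    by rewrite -expfzDr ?hn0 //; congr (_ ^ _); ring.
  have := qfact_neq0 x1 r; rewrite -/p.
  move: (qpoch p p r) (_ * qpoch p p _) (h ^ _) (h ^ _) (qpoch_inf _ _) => P D E1 E2 Q P0.
  transitivity (E2 * E1 / (D * Q) * (P^-1 * P)); first by rewrite mulVf ?mulr1.
  by rewrite !invfM; ring.
have -> : (qpoch p p r)^-1 * qpoch (- x) x r = (qpoch x x r)^-1.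
  rewrite -(qpoch_sqr x x r); have n0 : qpoch (- x) x r != 0.
    by apply: qpoch_neq0 (ltW x1); rewrite normrN; exact: x1.
  have := qfact_neq0 h1 r; move: n0.
  by move: (qpoch (- x) x r) (qpoch x x r) => u v u0 v0; field; rewrite u0 v0.
by rewrite /K; move: (qpoch _ _ _) (qpoch_inf _ _) (h ^ _) => u v w; rewrite invfM; ring.
Qed.

(** The remaining infinite product is opened by Lebesgue's sum over [s]. *)
Lemma cubic_triples :
  sums_to (fun w : nat * nat * int => let: (r, s, n) := w in
      h ^ ((r%:Z - n) * (r%:Z - n) + 1 * (r%:Z - n) + (s%:Z * s%:Z + 1 * s%:Z) + (n * n + -1 * n)) *
      (qpoch (- x) x (r + s) / (qpoch x x r * qpoch x x s)))
    (qpoch_inf (- x) x ^+ 2 * (c / qpoch_inf p p)).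
Proof.
pose f (w : nat * int * nat) := h ^ ((w.1.1%:Z - w.1.2) * (w.1.1%:Z - w.1.2) + 1 * (w.1.1%:Z - w.1.2) +
    (w.2%:Z * w.2%:Z + 1 * w.2%:Z) + (w.1.2 * w.1.2 + -1 * w.1.2)) *
  (qpoch (- x) x (w.1.1 + w.2) / (qpoch x x w.1.1 * qpoch x x w.2)).
suff hf : sums_to f (qpoch_inf (- x) x ^+ 2 * (c / qpoch_inf p p)).
  have := @sums_to_bij _ _ _ _ (fun w : nat * nat * int => (w.1.1, w.2, w.1.2))
    (fun w => (w.1.1, w.2, w.1.2)) _ _ _ hf.
  by move=> /(_ _ _)H; apply: eq_sums_to (H _ _) => -[[]].
apply: (@sums_to_pair _ _ _ _ (fun w : nat * int => qpoch_inf (- x) x ^+ 2 *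
  (h ^ ((w.1%:Z - w.2) * (w.1%:Z - w.2) + 1 * (w.1%:Z - w.2) +
        (w.2 * w.2 + -1 * w.2)) / (qpoch x x w.1 * qpoch_inf (- x ^+ w.1.+1) p)))).
- pose g (w : nat * int * nat) := (w.1.1%:Z - w.1.2, w.2%:Z, w.1.2).
  have gI : injective g.
    move=> [[r n] s] [[r' n'] s'] [] e1 -> e2; rewrite e2 in e1 *.
    by congr (_, _, _); lia.
  have bV (e : nat * int * nat -> nat) : bounded_family (fun z => (qpoch x x (e z))^-1).
    exact: (bounded_comp e (bounded_qfactV h1)).
  have bN : bounded_family (fun w : nat * int * nat => qpoch (- x) x (w.1.1 + w.2)).
    exact: (bounded_comp (fun w : nat * int * nat => (w.1.1 + w.2)%N) (qpoch_bounded (- x) x1)).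
  have := abs_summableM (boundedM bN (boundedM (bV (fun w => w.1.1)) (bV (fun w => w.2))))
    (abs_summable_inj gI (abs_summable_quadratic3 h0 h1 1 1 (- 1))).
  by apply: eq_abs_summable => -[[r n] s]; rewrite /f /= !invfM; ring.
- move=> [r n]; have := sums_toZ (h ^ ((r%:Z - n) * (r%:Z - n) + 1 * (r%:Z - n) +
        (n * n + -1 * n)) / qpoch x x r) (lebesgue_sum h0 h1 r).
  rewrite [(r, n).1]/= [(r, n).2]/=.
  set v := _ * (_ / _); set v' := _ * (_ / _); have -> : v = v'.
    by rewrite /v /v' !invfM; ring.
  apply: eq_sums_to => s; rewrite /f /=.
  have -> : h ^ ((r%:Z - n) * (r%:Z - n) + 1 * (r%:Z - n) + (s%:Z * s%:Z + 1 * s%:Z) + (n * n + -1 * n)) =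
     h ^ ((r%:Z - n) * (r%:Z - n) + 1 * (r%:Z - n) + (n * n + -1 * n)) * h ^ (s%:Z * s%:Z + s%:Z).
    by rewrite -expfzDr ?hn0 //; congr (_ ^ _); ring.
  by rewrite !invfM; ring.
- by have := sums_toZ (qpoch_inf (- x) x ^+ 2) cubic_pairs.
Qed.

(** Collecting [r + s = m] rebuilds the polynomials [durfee_poly], hence the
    quadruple sum. *)
Lemma second_quadruple_sum :
  sums_to (fun w : nat * nat * nat * nat => let: (i, j, k, l) := w in
      h ^ (i%:Z * i%:Z + i%:Z + 2 * (j%:Z * j%:Z + k%:Z * k%:Z + l%:Z * l%:Z
        - i%:Z * j%:Z + i%:Z * k%:Z - j%:Z * k%:Z - j%:Z * l%:Z - j%:Z + k%:Z + l%:Z)) /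
      (qpoch x x i * qpoch x x j * qpoch x x k * qpoch x x l))
    (qpoch_inf (- x) x ^+ 2 * c / (qpoch_inf x x * qpoch_inf p p)).
Proof.
apply: (@sums_to_quadruple _ h h0 h1 _ (fun m n => h ^ (m%:Z * m%:Z + m%:Z + 2 * (n * n - n))) h 0).
- move=> i j k l; rewrite addn0 (exprnP h k) PoszD.
  have -> : h ^ (i%:Z * i%:Z + i%:Z + 2 * (j%:Z * j%:Z + k%:Z * k%:Z + l%:Z * l%:Z
        - i%:Z * j%:Z + i%:Z * k%:Z - j%:Z * k%:Z - j%:Z * l%:Z - j%:Z + k%:Z + l%:Z)) =
      h ^ ((i%:Z + k%:Z) * (i%:Z + k%:Z) + (i%:Z + k%:Z) +
        2 * ((j%:Z - l%:Z) * (j%:Z - l%:Z) - (j%:Z - l%:Z))) *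
      (h ^ (k%:Z * k%:Z) * h ^ k%:Z) * h ^ (2 * (j%:Z * l%:Z) - 2 * ((i%:Z + k%:Z) * j%:Z)).
    by rewrite -!expfzDr ?hn0 //; congr (_ ^ _); ring.
  by rewrite !invfM; ring.
- apply: eq_abs_summable (abs_summable_quadruple h0 h1 1 (- 1) 1 1) => -[[[i j] k] l].
  by congr (h ^ _ / _); ring.
- have := sums_toZ (qpoch_inf x x)^-1 (sums_to_antidiagonals cubic_triples).
  have -> : (qpoch_inf x x)^-1 * (qpoch_inf (- x) x ^+ 2 * (c / qpoch_inf p p)) =
      qpoch_inf (- x) x ^+ 2 * c / (qpoch_inf x x * qpoch_inf p p).
    by move: c (qpoch_inf _ _) (qpoch_inf _ _) (qpoch_inf p p) => c' u v w; rewrite invfM; ring.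
  apply: eq_sums_to => -[m n] /=; rewrite addn0 /durfee_poly.
  rewrite -[h * h]/x !mulr_sumr; apply: eq_bigr => -[r /= rm] _; rewrite ltnS in rm.
  have hb : (m - r)%N%:Z = m%:Z - r%:Z by rewrite subzn.
  rewrite subnKC // hb /gauss.
  have -> : h ^ ((r%:Z - n) * (r%:Z - n) + 1 * (r%:Z - n) + ((m%:Z - r%:Z) * (m%:Z - r%:Z) +
      1 * (m%:Z - r%:Z)) + (n * n + -1 * n)) =
      h ^ (m%:Z * m%:Z + m%:Z + 2 * (n * n - n)) * h ^ (2 * (r%:Z * r%:Z - m%:Z * r%:Z - n * r%:Z)).
    by rewrite -!expfzDr ?hn0 //; congr (_ ^ _); ring.
  have := qfact_neq0 h1 m.
  move: (qpoch x x m) (_ * qpoch x x _) (qpoch_inf _ _) (qpoch (- x) x m) (h ^ _) (h ^ _) => P D Q N E1 E2 P0.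
  transitivity (Q^-1 * (E2 * E1) * N / D * (P^-1 * P)); last by ring.
  by rewrite mulVf //; ring.
Qed.

End SecondSum.

(** * Signs and parities *)

Lemma signz_mod2 (R : realType) (a b k : int) : a = b + 2 * k -> (-1 : R[i]) ^ a = (-1) ^ b.
Proof.
have N1 : (-1 : R[i]) != 0 by rewrite oppr_eq0 oner_neq0.
move=> ->; rewrite (expfzDr b (2 * k) N1) -(exprz_exp (-1 : R[i]) 2 k).
by rewrite -[(-1) ^ 2]/((-1 : R[i]) ^+ 2) sqrrN expr1n exp1rz mulr1.
Qed.

Lemma mulz_self_parity (t : int) : exists k : int, t * t = t + 2 * k.
Proof.
have [u [->|->]] : exists u : int, t = 2 * u \/ t = 2 * u + 1 by exists (t %/ 2)%Z; lia.
- by exists (2 * u * u - u); ring.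
- by exists (2 * u * u + u); ring.
Qed.

Lemma mulz_self_le_pentagonal (t : int) : t * t <= 3 * (t * t) + 2 * t.
Proof.
rewrite -subr_ge0 (_ : _ - _ = 2 * (t * (t + 1))); last by ring.
rewrite mulr_ge0 //; have [t0|t0] := leP 0 t; first by rewrite mulr_ge0 // addr_ge0.
by apply: mulr_le0; lia.
Qed.

Lemma PoszS2 (n : nat) : (2 * n).+1%:Z = 2 * n%:Z + 1.
Proof. by lia. Qed.

Lemma expNz (R : realType) (y : R[i]) (k : int) : (- y) ^ k = (-1) ^ k * y ^ k.
Proof. by rewrite -[- y]mulN1r expfzMl. Qed.

(** * The first identity *)

Section Telescoping.
Variables (R : realType) (y : R[i]).
Hypotheses (y0 : 0 < `|y|) (y1 : `|y| < 1).
Local Notation x := (y ^+ 2).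
Local Notation hn0 := (nome_neq0 y0).

Let w r := (qpoch_inf (y ^+ (2 * r).+1) x * qpoch (x ^+ 2) (x ^+ 2) r)^-1.

Let x0 : 0 < `|x| := norm_sqr_nome_gt0 y0.
Let x1 : `|x| < 1 := norm_sqr_nome_lt1 y1.

Let wS r : w r.+1 * (1 - y ^ (4 * r%:Z + 4)) = w r * (1 - y ^ (2 * r%:Z + 1)).
Proof.
have E1 : qpoch_inf (y ^+ (2 * r).+1) x = (1 - y ^ (2 * r%:Z + 1)) * qpoch_inf (y ^+ (2 * r.+1).+1) x.
  rewrite (@qpoch_infD _ (y ^+ (2 * r).+1) x 1 x1) qpochS qpoch0 expr0 expr1 mul1r mulr1.
  rewrite -exprD; congr ((1 - _) * qpoch_inf (y ^+ _) x); last by lia.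
  by rewrite exprnP; congr (y ^ _); lia.
have E2 : qpoch (x ^+ 2) (x ^+ 2) r.+1 = qpoch (x ^+ 2) (x ^+ 2) r * (1 - y ^ (4 * r%:Z + 4)).
  rewrite qpochS; have -> // : x ^+ 2 * (x ^+ 2) ^+ r = y ^ (4 * r%:Z + 4).
  by rewrite -(exprS (x ^+ 2) r) -(exprM x 2 r.+1) (sqr_nomeX y (2 * r.+1)); congr (y ^ _); lia.
rewrite /w E2 E1.
have n1 : 1 - y ^ (2 * r%:Z + 1) != 0.
  apply: subr_neq0_norm; rewrite norm_expz -[X in _ ^ X]/((2 * r + 1)%N%:Z) -exprnP exprn_ilt1 //.
  by rewrite addn1.
have n2 : 1 - y ^ (4 * r%:Z + 4) != 0.
  apply: subr_neq0_norm; rewrite norm_expz -[X in _ ^ X]/((4 * r + 4)%N%:Z) -exprnP exprn_ilt1 //.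
  by rewrite addn4.
move: (1 - _) (1 - _) n1 n2 (qpoch_inf _ _) (qpoch _ _ _) => u v u0 v0 Q P.
by rewrite mulrA invfM mulfVK // -(mulrA v Q P) [RHS]mulrC (invfM v) mulVKf.
Qed.

Let w_bounded : bounded_family w.
Proof.
have ny1 : `|- y| < 1 by rewrite normrN.
have b1 := bounded_qpoch_infV ny1 (e := fun r => (2 * r).+1) (fun _ => isT).
have b2 := bounded_qfactV x1.
have [m hm] := boundedM b1 b2; exists m => r; have := hm r.
by rewrite /w invfM exprNn sqrrN -signr_odd /= oddM /= expr1 mulN1r opprK.
Qed.

Lemma sums_to_parity (F : int -> R[i]) (r : int) s :
  sums_to F s -> sums_to (fun n => F (r - 2 * n) + F (r + 1 - 2 * n)) s.
Proof.
move=> hF; apply: (sums_to_fibres (p := fun v => ((r + 1 - v) %/ 2)%Z) hF) => n.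
have := sums_to_fin (fun b : bool => F (r + b%:Z - 2 * n)).
rewrite big_bool /= addrC addr0.
apply: (@sums_to_fibre _ _ _ _ _ _ _ (fun b : bool => r + b%:Z - 2 * n)).
- by move=> [] [] //=; lia.
- by move=> [] /=; lia.
- move=> v vn; exists (v != r - 2 * n); case: eqP => /=; lia.
Qed.

(** The summand of [telescoped_sum] is [M (r, n) + T (r, n) - T (r + 1, n)], where
    [T (0, n) = 0]. *)
Let M (z : nat * int) := y ^ (-1) * ((-1) ^+ z.1 * w z.1 * y ^ (z.1%:Z * z.1%:Z + 2 * z.1%:Z)) *
  (y ^ ((z.1%:Z - 2 * z.2) * (z.1%:Z - 2 * z.2)) + y ^ ((z.1%:Z + 1 - 2 * z.2) * (z.1%:Z + 1 - 2 * z.2))).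
Let T (z : nat * int) := (-1) ^+ z.1 * w z.1 * (1 - y ^ (4 * z.1%:Z)) *
  y ^ (z.1%:Z * z.1%:Z - 2 * z.1%:Z - 1 + (z.1%:Z - 2 * z.2) * (z.1%:Z - 2 * z.2)).
Let abs_summable_shift (a b : int) :
  abs_summable (fun z : nat * int => y ^ (z.1%:Z * z.1%:Z + a * z.1%:Z) *
    y ^ ((z.1%:Z + b - 2 * z.2) * (z.1%:Z + b - 2 * z.2) + 0 * (z.1%:Z + b - 2 * z.2))).
Proof.
have gI : injective (fun z : nat * int => (z.1%:Z, z.1%:Z + b - 2 * z.2)).
  by move=> [r n] [r' n'] [] /= -> e; congr (_, _); lia.
exact: (abs_summable_inj gI (abs_summable_prod (abs_summable_quadratic a y0 y1)
  (abs_summable_quadratic 0 y0 y1))).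
Qed.

Let bsign : bounded_family (fun z : nat * int => (-1) ^+ z.1 * w z.1).
Proof.
exact: (boundedM (bounded_sign R (fun z : nat * int => z.1))
  (bounded_comp (fun z : nat * int => z.1) w_bounded)).
Qed.

Let abs_summable_T : abs_summable T.
Proof.
have b2 : bounded_family (fun z : nat * int => 1 - y ^ (4 * z.1%:Z)).
  have : bounded_family (fun z : nat * int => y ^ (4 * z.1%:Z)) by apply: (bounded_expz y0 y1).
  move=> [m hm]; exists (1 + m) => z; apply: le_trans (ler_normB _ _) _.
  by rewrite normr1 lerD2l.
have := abs_summableZ (y ^ (-1)) (abs_summableM (boundedM bsign b2) (abs_summable_shift (- 2) 0)).
apply: eq_abs_summable => -[r n]; rewrite /T /=.
have -> : y ^ (r%:Z * r%:Z - 2 * r%:Z - 1 + (r%:Z - 2 * n) * (r%:Z - 2 * n)) =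
   y ^ (-1) * (y ^ (r%:Z * r%:Z + -2 * r%:Z) *
     y ^ ((r%:Z + 0 - 2 * n) * (r%:Z + 0 - 2 * n) + 0 * (r%:Z + 0 - 2 * n))).
  by rewrite -!expfzDr ?hn0 //; congr (_ ^ _); ring.
by ring.
Qed.

Let abs_summable_M : abs_summable M.
Proof.
have := abs_summableZ (y ^ (-1)) (abs_summableM bsign
  (abs_summableD (abs_summable_shift 2 0) (abs_summable_shift 2 1))).
apply: eq_abs_summable => -[r n]; rewrite /M /= !mul0r !addr0.
by ring.
Qed.

(** After the telescoping, both exponents share the factor of the mod 6 sum in [r], and
    the squares of [r - 2 n] and [r + 1 - 2 n] together make a full theta series. *)
Lemma telescoped_sum (A B : R[i]) :
  sums_to (fun t : int => y ^ (3 * (t * t) + 2 * t)) A ->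
  sums_to (fun v : int => y ^ (v * v)) B ->
  sums_to (fun z : nat * int => (-1) ^+ z.1 / (qpoch_inf (y ^+ (2 * z.1).+1) x *
    qpoch (x ^+ 2) (x ^+ 2) z.1) *
    (y ^ (z.1%:Z * z.1%:Z - 2 * z.1%:Z - 1 + (z.1%:Z - 2 * z.2) * (z.1%:Z - 2 * z.2)) +
     y ^ (z.1%:Z * z.1%:Z - 2 + (z.1%:Z + 1 - 2 * z.2) * (z.1%:Z + 1 - 2 * z.2))))
   (y ^ (-1) * (A * B / qpoch_inf x x)).
Proof.
move=> hA hB.
have hM : sums_to M (y ^ (-1) * (A * B / qpoch_inf x x)).
  apply: (@sums_to_pair _ _ _ _ (fun r : nat => y ^ (-1) *
      ((-1) ^+ r * w r * y ^ (r%:Z * r%:Z + 2 * r%:Z)) * B)) => // [r|].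
    have := sums_toZ (y ^ (-1) * ((-1) ^+ r * w r * y ^ (r%:Z * r%:Z + 2 * r%:Z)))
      (sums_to_parity r%:Z hB).
    by apply: eq_sums_to.
  have ny0 : 0 < `|- y| by rewrite normrN.
  have ny1 : `|- y| < 1 by rewrite normrN.
  have hA' : sums_to (fun t : int => (-1) ^ t * (- y) ^ (3 * (t * t) + 2 * t)) A.
    apply: eq_sums_to hA => t; rewrite expNz.
    have [k tk] := mulz_self_parity t.
    have e : (-1) ^ t * (-1) ^ (3 * (t * t) + 2 * t) = 1 :> R[i].
      rewrite -expfzDr ?oppr_eq0 ?oner_neq0 // -(expr0z (-1)).
      by apply: (@signz_mod2 _ _ _ (3 * t + 3 * k)); rewrite tk; ring.
    by rewrite (mulrA ((-1) ^ t)) e mul1r.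
  have := sums_toZ (y ^ (-1) * B) (mod_six_sum ny0 ny1 hA').
  rewrite sqrrN; have -> : y ^ (-1) * B * (A / qpoch_inf x x) = y ^ (-1) * (A * B / qpoch_inf x x).
    by ring.
  apply: eq_sums_to => r; rewrite /w expNz.
  have -> : - (- y) ^+ (2 * r).+1 = y ^+ (2 * r).+1.
    by rewrite exprNn -signr_odd /= oddM /= expr1 mulN1r opprK.
  have -> : (-1) ^ (r%:Z * r%:Z + 2 * r%:Z) = (-1) ^+ r :> R[i].
    have [k rk] := mulz_self_parity r%:Z.
    by rewrite (@signz_mod2 _ _ r%:Z (k + r%:Z)) // rk; ring.
  by ring.
have [t hT] := abs_summable_sums_to abs_summable_T.
have SI : injective (fun z : nat * int => (z.1.+1, z.2)).
  by move=> [r n] [r' n'] [] -> ->.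
have [t' hT'] := abs_summable_sums_to (abs_summable_inj SI abs_summable_T).
have tt : t' = t.
  apply: sums_to_uniq hT; apply: (sums_to_inj SI) hT' => -[[|r] n] ne.
    by rewrite /T mulr0 expr0z subrr mulr0 mul0r.
  by case: (ne (r, n)).
have := sums_toD hM (sums_toB hT hT'); rewrite tt subrr addr0.
apply: eq_sums_to => -[r n].
rewrite /M /T [(r, n).1]/= [(r, n).2]/= [(r.+1, n).1]/= [(r.+1, n).2]/=.
have e1 : 4 * r.+1%:Z = 4 * r%:Z + 4 by lia.
have e2 : (-1) ^+ r.+1 * w r.+1 * (1 - y ^ (4 * r.+1%:Z)) =
    - ((-1) ^+ r * (w r * (1 - y ^ (2 * r%:Z + 1)))) by rewrite -wS e1 exprS; ring.
rewrite e2 -/(w r).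
pose a := y ^ (r%:Z * r%:Z - 2 * r%:Z - 1 + (r%:Z - 2 * n) * (r%:Z - 2 * n)).
pose b := y ^ (r%:Z * r%:Z - 2 + (r%:Z + 1 - 2 * n) * (r%:Z + 1 - 2 * n)).
have -> : y ^ (r.+1%:Z * r.+1%:Z - 2 * r.+1%:Z - 1 + (r.+1%:Z - 2 * n) * (r.+1%:Z - 2 * n)) = b.
  by rewrite -addn1 PoszD /b; congr (y ^ _); ring.
have F1 : y ^ (-1) * y ^ (r%:Z * r%:Z + 2 * r%:Z) * y ^ ((r%:Z - 2 * n) * (r%:Z - 2 * n)) =
    y ^ (4 * r%:Z) * a by rewrite -!expfzDr ?hn0 //; congr (y ^ _); ring.
have F2 : y ^ (-1) * y ^ (r%:Z * r%:Z + 2 * r%:Z) * y ^ ((r%:Z + 1 - 2 * n) * (r%:Z + 1 - 2 * n)) =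
    y ^ (2 * r%:Z + 1) * b by rewrite -!expfzDr ?hn0 //; congr (y ^ _); ring.
rewrite -/a -/b.
move: F1 F2; clearbody a b; clear.
move: (w r) ((-1) ^+ r) (y ^ _) (y ^ _) (y ^ _) (y ^ _) (y ^ _) (y ^ _).
move=> u S d V c U P Y F1 F2.
transitivity (S * u * (Y * P * U + Y * P * V) + (S * u * (1 - c) * a + S * (u * (1 - d)) * b)).
  by ring.
by rewrite F1 F2; ring.
Qed.

End Telescoping.

Section FirstSum.
Variables (R : realType) (h s : R[i]).
Hypotheses (h0 : 0 < `|h|) (h1 : `|h| < 1) (hs : s ^+ 2 = - h).
Local Notation x := (h ^+ 2).
Local Notation x0 := (norm_sqr_nome_gt0 h0).
Local Notation x1 := (norm_sqr_nome_lt1 h1).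
Local Notation hn0 := (nome_neq0 h0).

Let c := 3 * qpoch_inf (x ^+ 3) (x ^+ 3) ^+ 3 / qpoch_inf x x.

Let s2 : `|s| ^+ 2 = `|h|. Proof. by rewrite -normrX hs normrN. Qed.
Let s0 : 0 < `|s|.
Proof.
rewrite normr_gt0; apply/eqP => sz; have := s2; rewrite sz normr0 expr0n /= => e.
by move: h0; rewrite -e ltxx.
Qed.
Let s1 : `|s| < 1. Proof. by rewrite -(@expr_lt1 _ 2) // s2. Qed.
Let sn0 : s != 0 := nome_neq0 s0.
Let ns0 : 0 < `|- s|. Proof. by rewrite normrN. Qed.
Let ns1 : `|- s| < 1. Proof. by rewrite normrN. Qed.

Let s4 : (s ^+ 2) ^+ 2 = x. Proof. by rewrite hs sqrrN. Qed.
Let hz (k : int) : h ^ k = (-1) ^ k * s ^ (2 * k).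
Proof. by rewrite -{1}[h]opprK -hs expNz (sqr_nomez s). Qed.

Let P := qpoch_inf (s ^+ 2) (s ^+ 2).
Let P0 : P != 0. Proof. exact: (qfact_inf_neq0 s1). Qed.

Let Wsum (y : R[i]) (z : nat * int) := (-1) ^+ z.1 / (qpoch_inf (y ^+ (2 * z.1).+1) (s ^+ 2) *
    qpoch x x z.1) *
    (y ^ (z.1%:Z * z.1%:Z - 2 * z.1%:Z - 1 + (z.1%:Z - 2 * z.2) * (z.1%:Z - 2 * z.2)) +
     y ^ (z.1%:Z * z.1%:Z - 2 + (z.1%:Z + 1 - 2 * z.2) * (z.1%:Z + 1 - 2 * z.2))).

(** Averaging over the two square roots of [- h] keeps the pairs [(t, v)] with [t + v] odd.
    They are the pairs [(- (m + n + 1), m - n)], and the exponent becomes that of the cubic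
    theta series. *)
Lemma averaged_sum :
  sums_to (fun z => 2^-1 * (Wsum s z + Wsum (- s) z)) (c / P).
Proof.
have qs (y : R[i]) : 0 < `|y| -> `|y| < 1 ->
    exists A B, sums_to (fun t : int => y ^ (3 * (t * t) + 2 * t)) A /\ sums_to (fun v : int => y ^ (v * v)) B /\
     sums_to (fun tv : int * int => y ^ (3 * (tv.1 * tv.1) + 2 * tv.1) * y ^ (tv.2 * tv.2)) (A * B).
  move=> y0 y1.
  have aA : abs_summable (fun t : int => y ^ (3 * (t * t) + 2 * t)).
    apply: abs_summable_le (abs_summable_quadratic 0 y0 y1) => t.
    rewrite !norm_expz ler_expz_int // mul0r addr0.
    exact: mulz_self_le_pentagonal.
  have aB : abs_summable (fun v : int => y ^ (v * v)).
    by apply: eq_abs_summable (abs_summable_quadratic 0 y0 y1) => v; rewrite mul0r addr0.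
  have [A hA] := abs_summable_sums_to aA; have [B hB] := abs_summable_sums_to aB.
  exists A, B; split=> //; split=> //; exact: (sums_to_prod aA aB hA hB).
have [A [B [hA [hB hAB]]]] := qs s s0 s1.
have [A' [B' [hA' [hB' hAB']]]] := qs (- s) ns0 ns1.
have W1 := telescoped_sum s0 s1 hA hB; have W2 := telescoped_sum ns0 ns1 hA' hB'.
rewrite s4 in W1; rewrite sqrrN s4 in W2.
have := sums_toZ 2^-1 (sums_toD W1 W2); rewrite -/P.
set v := _ * (_ + _); suff -> : v = c / P by [].
pose F (y : R[i]) (tv : int * int) := y ^ (3 * (tv.1 * tv.1) + 2 * tv.1) * y ^ (tv.2 * tv.2).
suff E : s ^ (-1) * (A * B) + (- s) ^ (-1) * (A' * B') = 2 * c.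
  rewrite /v; transitivity (2^-1 * (s ^ (-1) * (A * B) + (- s) ^ (-1) * (A' * B')) / P).
    by ring.
  by rewrite E mulKf // pnatr_eq0.
have hF := sums_toD (sums_toZ (s ^ (-1)) hAB) (sums_toZ ((- s) ^ (-1)) hAB').
apply: sums_to_uniq hF _.
have hc := sums_toZ 2 (cubic_theta h0 h1).
have FE (t v' : int) : s ^ (-1) * F s (t, v') + (- s) ^ (-1) * F (- s) (t, v') =
    (1 - (-1) ^ (t + v')) * s ^ (3 * (t * t) + 2 * t + v' * v' - 1).
  have [k tk] := mulz_self_parity t; have [l vl] := mulz_self_parity v'.
  rewrite /F /= !(expNz s).
  have -> : (-1) ^ (-1) * s ^ (-1) * ((-1) ^ (3 * (t * t) + 2 * t) * s ^ (3 * (t * t) + 2 * t) *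
      ((-1) ^ (v' * v') * s ^ (v' * v'))) =
    (-1) ^ (-1) * ((-1) ^ (3 * (t * t) + 2 * t) * (-1) ^ (v' * v')) *
    (s ^ (-1) * (s ^ (3 * (t * t) + 2 * t) * s ^ (v' * v'))) by ring.
  rewrite -(@expfzDr _ (-1) (3 * _ + _)) ?oppr_eq0 ?oner_neq0 //.
  have -> : (-1) ^ (3 * (t * t) + 2 * t + v' * v') = (-1) ^ (t + v') :> R[i].
    by apply: (@signz_mod2 _ _ _ (t + 3 * k + t + l)); rewrite tk vl; ring.
  have -> : (-1) ^ (-1) = -1 :> R[i] by rewrite -[_ ^ _]/((-1)^-1) invrN1.
  have -> : 3 * (t * t) + 2 * t + v' * v' - 1 = -1 + (3 * (t * t) + 2 * t + v' * v') by ring.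
  by rewrite (@expfzDr _ s (-1)) // (@expfzDr _ s (3 * _ + _)) //; ring.
apply: (@sums_to_inj _ _ _ _ (fun mn : int * int => (- (mn.1 + mn.2 + 1), mn.1 - mn.2))) => [||].
- by move=> [m n] [m' n'] [] /= e1 e2; clear -e1 e2; congr (_, _); lia.
- move=> [t v'] ne; rewrite FE.
  rewrite (@signz_mod2 _ _ 0 ((t + v') %/ 2)%Z) ?expr0z ?subrr ?mul0r //.
  have [e|e] : ((t + v') %% 2)%Z = 0 \/ ((t + v') %% 2)%Z = 1 by clear; lia.
    by rewrite add0r; clear -e; lia.
  case: (ne (((v' - t - 1) %/ 2)%Z, ((- t - 1 - v') %/ 2)%Z)) => /=.
  by congr (_, _); clear -e; lia.
apply: eq_sums_to hc => -[m n]; rewrite FE [(m, n).1]/= [(m, n).2]/=.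
rewrite (@signz_mod2 _ _ 1 (- n - 1)); last by ring.
rewrite expr1z opprK hz; congr (_ * _).
rewrite (@signz_mod2 _ _ 0 (m * m + m * n + n * n + m + n)); last by ring.
by rewrite expr0z mul1r; congr (s ^ _); ring.
Qed.

Let Q (y : R[i]) r := qpoch_inf (y ^+ (2 * r).+1) (s ^+ 2).
Let V r := 2^-1 * (s ^ (- (2 * r%:Z + 1)) * ((Q s r)^-1 - (Q (- s) r)^-1)).

Let opp_odd r : (- s) ^+ (2 * r).+1 = - s ^+ (2 * r).+1.
Proof. by rewrite exprNn -signr_odd /= oddM /= expr1 mulN1r. Qed.

(** The odd part of Euler's series for [1 / (z; s^2)_oo] at [z = s^(2 r + 1)]. *)
Lemma odd_euler r :
  sums_to (fun u : nat => s ^ (2 * (2 * r%:Z + 1) * u%:Z) / qpoch (s ^+ 2) (s ^+ 2) (2 * u).+1) (V r).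
Proof.
pose z := s ^+ (2 * r).+1.
have z1 : `|z| < 1 by rewrite normrX exprn_ilt1.
have nz1 : `|- z| < 1 by rewrite normrN.
have a1 := abs_summableD (abs_summable_euler_qpoch_infV s1 z1)
  (abs_summableN (abs_summable_euler_qpoch_infV s1 nz1)).
have e1 := sums_toB (euler_qpoch_infV s0 s1 z1) (euler_qpoch_infV s0 s1 nz1).
have oI : injective (fun u : nat => (2 * u).+1) by move=> u u' [/eqP]; rewrite eqn_pmul2l // => /eqP.
have [t ht] := abs_summable_sums_to (abs_summable_inj oI a1).
have te : t = (qpoch_inf z (s ^+ 2))^-1 - (qpoch_inf (- z) (s ^+ 2))^-1.
  apply: sums_to_uniq e1; apply: (sums_to_inj oI) ht => n no.
  have ne : ~~ odd n.
    by apply/negP => on; case: (no n./2); rewrite -[LHS]odd_double_half on mul2n.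
  by rewrite exprNn -signr_odd (negPf ne) mul1r subrr.
have := sums_toZ (2^-1 * s ^ (- (2 * r%:Z + 1))) ht; rewrite te.
have -> : 2^-1 * s ^ (- (2 * r%:Z + 1)) * ((qpoch_inf z (s ^+ 2))^-1 - (qpoch_inf (- z) (s ^+ 2))^-1) = V r.
  by rewrite /V /Q opp_odd mulrA.
apply: eq_sums_to => u.
have -> : (- z) ^+ (2 * u).+1 = - z ^+ (2 * u).+1.
  by rewrite exprNn -signr_odd /= oddM /= expr1 mulN1r.
have zE : z ^+ (2 * u).+1 = s ^ (2 * r%:Z + 1) * s ^ (2 * (2 * r%:Z + 1) * u%:Z).
  rewrite /z -exprM exprnP -expfzDr //; congr (s ^ _).
  by rewrite PoszM !PoszS2; ring.
rewrite zE -invr_expz.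
have := expfz_neq0 (2 * r%:Z + 1) sn0.
move: (s ^ _) (s ^ _) (qpoch _ _ _) => a b d a0.
transitivity (2^-1 * 2 * (b^-1 * b) * (a / d)); first by ring.
by rewrite !mulVf ?pnatr_eq0 // !mul1r.
Qed.

(** Heine's transformation leaves [(x; x)_u (- h; x)_(u + 1)] in the denominator; since
    [h = - s^2], this is the single product [(s^2; s^2)_(2 u + 1)] of [odd_euler]. *)
Lemma odd_lebesgue r :
  sums_to (fun t : nat => qpoch (- h) x (r + t) * h ^ (t%:Z * t%:Z + 2 * t%:Z) / qpoch x x t)
    (qpoch_inf (- h) x ^+ 2 * V r).
Proof.
have a1 : `|- h * x ^+ r| < 1 by apply: (norm_mulX_lt1 h1); rewrite normrN.
have hx1 : `|h * x| <= 1.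
  by rewrite (normrM h x) mulr_ile1 // ltW // x1.
have nh1 : `|- h| < 1 by rewrite normrN.
have H0 := qpoch_inf_neq0 nh1 x1.
have hS : sums_to (fun u : nat => (- h * x ^+ r) ^+ u * qpoch_inf (- (h * (x * x ^+ u))) x / qpoch x x u)
    (qpoch_inf (- h) x * V r).
  apply: eq_sums_to (sums_toZ (qpoch_inf (- h) x) (odd_euler r)) => u.
  have -> : - h * x ^+ r = s ^ (2 * (2 * r%:Z + 1)).
    rewrite -hs -s4 -(exprM (s ^+ 2) 2 r) (sqr_nomeX s) -[s ^+ 2]/(s ^ 2) -expfzDr //.
    by congr (s ^ _); rewrite PoszM; ring.
  have -> : - (h * (x * x ^+ u)) = - h * x ^+ u.+1 by rewrite (exprS x) mulNr.
  rewrite expz_exprn (@qpoch_infD _ (- h) x u.+1 x1).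
  have -> : qpoch (s ^+ 2) (s ^+ 2) (2 * u).+1 = qpoch (- h) x u.+1 * qpoch x x u.
    by rewrite qpoch_split_odd -[s ^+ 2 * s ^+ 2]/((s ^+ 2) ^+ 2) s4 hs.
  have N0 : qpoch (- h) x u.+1 != 0 by exact: qpoch_neq0 nh1 (ltW x1).
  move: N0 (s ^ _) (qpoch_inf _ _) (qpoch x _ _) => N0 a b e.
  by move: (qpoch _ _ _) N0 => d d0; transitivity (d^-1 * d * (a * b / e)); [rewrite invfM; ring|rewrite mulVf ?mul1r].
have := sums_toZ (qpoch (- h) x r) (heine_euler h0 h1 a1 hx1 (ltW x1) hS).
have -> : qpoch (- h) x r * (qpoch_inf (- h * x ^+ r) x * (qpoch_inf (- h) x * V r)) =
    qpoch_inf (- h) x ^+ 2 * V r.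
  by rewrite (@qpoch_infD _ (- h) x r x1); ring.
apply: eq_sums_to => t; rewrite qpochD (sqr_nomeX h t) -expfzDr ?hn0 //.
by rewrite !mulrA.
Qed.

(** Back from [s] to [h]: [s^(2 k) = (-1)^k h^k], and the signs depend on [r] only. *)
Lemma first_pairs :
  sums_to (fun z : nat * int => V z.1 / qpoch x x z.1 *
      (h ^ ((z.1%:Z - z.2) * (z.1%:Z - z.2) + 2 * (z.1%:Z - z.2) + z.2 * z.2) +
       h ^ ((z.1%:Z - z.2) * (z.1%:Z - z.2) + z.2 * z.2))) (c / P).
Proof.
apply: eq_sums_to averaged_sum => -[r n].
have WE (y : R[i]) : y ^+ 2 = - h -> y != 0 -> Wsum y (r, n) =
    y ^ (- (2 * r%:Z + 1)) / (Q y r * qpoch x x r) *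
    (h ^ ((r%:Z - n) * (r%:Z - n) + 2 * (r%:Z - n) + n * n) +
     h ^ ((r%:Z - n) * (r%:Z - n) + n * n)).
  move=> y2 y0; rewrite /Wsum [(r, n).1]/= [(r, n).2]/= -/(Q y r).
  have hy (k : int) : h ^ k = (-1) ^ k * y ^ (2 * k).
    by rewrite -{1}[h]opprK -y2 expNz (sqr_nomez y).
  have [k rk] := mulz_self_parity r%:Z; have [l nl] := mulz_self_parity n.
  have [k' rnk] := mulz_self_parity (r%:Z - n).
  rewrite !hy.
  have -> : (-1) ^ ((r%:Z - n) * (r%:Z - n) + 2 * (r%:Z - n) + n * n) = (-1) ^+ r :> R[i].
    by apply: (@signz_mod2 _ _ r%:Z (k' + r%:Z - n + l)); rewrite rnk nl; ring.
  have -> : (-1) ^ ((r%:Z - n) * (r%:Z - n) + n * n) = (-1) ^+ r :> R[i].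
    by apply: (@signz_mod2 _ _ r%:Z (k' + l)); rewrite rnk nl; ring.
  have -> : r%:Z * r%:Z - 2 * r%:Z - 1 + (r%:Z - 2 * n) * (r%:Z - 2 * n) =
    - (2 * r%:Z + 1) + 2 * ((r%:Z - n) * (r%:Z - n) + n * n) by ring.
  have -> : r%:Z * r%:Z - 2 + (r%:Z + 1 - 2 * n) * (r%:Z + 1 - 2 * n) =
    - (2 * r%:Z + 1) + 2 * ((r%:Z - n) * (r%:Z - n) + 2 * (r%:Z - n) + n * n) by ring.
  by rewrite !(@expfzDr _ y (- _)) //; ring.
rewrite (WE s hs sn0) (WE (- s)) ?sqrrN ?oppr_eq0 // expNz.
have -> : (-1) ^ (- (2 * r%:Z + 1)) = -1 :> R[i].
  by rewrite (@signz_mod2 _ _ 1 (- r%:Z - 1)) ?expr1z //; ring.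
rewrite /V [(r, n).1]/= [(r, n).2]/=.
move: (Q s r) (Q (- s) r) (qpoch _ _ _) (s ^ _) (h ^ _ + _) => q1 q2 p0 a e.
by clear; rewrite !invfM; ring.
Qed.

Lemma first_triples :
  sums_to (fun w : nat * nat * int => let: (r, t, n) := w in
      (h ^ ((r%:Z - n) * (r%:Z - n) + 2 * (r%:Z - n) + (t%:Z * t%:Z + 2 * t%:Z) + (n * n + 0 * n)) +
       h ^ ((r%:Z - n) * (r%:Z - n) + 0 * (r%:Z - n) + (t%:Z * t%:Z + 2 * t%:Z) + (n * n + 0 * n))) *
      (qpoch (- h) x (r + t) / (qpoch x x r * qpoch x x t)))
    (qpoch_inf (- h) x ^+ 2 * (c / P)).
Proof.
pose f (w : nat * int * nat) :=
  (h ^ ((w.1.1%:Z - w.1.2) * (w.1.1%:Z - w.1.2) + 2 * (w.1.1%:Z - w.1.2) +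
    (w.2%:Z * w.2%:Z + 2 * w.2%:Z) + (w.1.2 * w.1.2 + 0 * w.1.2)) +
   h ^ ((w.1.1%:Z - w.1.2) * (w.1.1%:Z - w.1.2) + 0 * (w.1.1%:Z - w.1.2) +
    (w.2%:Z * w.2%:Z + 2 * w.2%:Z) + (w.1.2 * w.1.2 + 0 * w.1.2))) *
  (qpoch (- h) x (w.1.1 + w.2) / (qpoch x x w.1.1 * qpoch x x w.2)).
suff hf : sums_to f (qpoch_inf (- h) x ^+ 2 * (c / P)).
  have := @sums_to_bij _ _ _ _ (fun w : nat * nat * int => (w.1.1, w.2, w.1.2))
    (fun w => (w.1.1, w.2, w.1.2)) _ _ _ hf.
  by move=> /(_ _ _)H; apply: eq_sums_to (H _ _) => -[[]].
apply: (@sums_to_pair _ _ _ _ (fun z : nat * int => qpoch_inf (- h) x ^+ 2 *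
  (V z.1 / qpoch x x z.1 *
      (h ^ ((z.1%:Z - z.2) * (z.1%:Z - z.2) + 2 * (z.1%:Z - z.2) + z.2 * z.2) +
       h ^ ((z.1%:Z - z.2) * (z.1%:Z - z.2) + z.2 * z.2))))).
- pose g (w : nat * int * nat) := (w.1.1%:Z - w.1.2, w.2%:Z, w.1.2).
  have gI : injective g.
    move=> [[r n] t] [[r' n'] t'] [] e1 -> e2; rewrite e2 in e1 *.
    by congr (_, _, _); clear -e1; lia.
  have bV (e : nat * int * nat -> nat) : bounded_family (fun z => (qpoch x x (e z))^-1).
    exact: (bounded_comp e (bounded_qfactV h1)).
  have bN : bounded_family (fun w : nat * int * nat => qpoch (- h) x (w.1.1 + w.2)).
    exact: (bounded_comp (fun w : nat * int * nat => (w.1.1 + w.2)%N) (qpoch_bounded (- h) x1)).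
  have := abs_summableM (boundedM bN (boundedM (bV (fun w => w.1.1)) (bV (fun w => w.2))))
    (abs_summableD (abs_summable_inj gI (abs_summable_quadratic3 h0 h1 2 2 0))
      (abs_summable_inj gI (abs_summable_quadratic3 h0 h1 0 2 0))).
  by apply: eq_abs_summable => -[[r n] t]; rewrite /f /= !invfM; ring.
- move=> [r n]; have := sums_toZ ((h ^ ((r%:Z - n) * (r%:Z - n) + 2 * (r%:Z - n) + n * n) +
       h ^ ((r%:Z - n) * (r%:Z - n) + n * n)) / qpoch x x r) (odd_lebesgue r).
  rewrite [(r, n).1]/= [(r, n).2]/=.
  set v := _ * (_ * V r); set v' := _ * (_ * (_ + _)); have -> : v = v'.
    by rewrite /v /v'; ring.
  apply: eq_sums_to => t; rewrite /f /=.
  have -> : h ^ ((r%:Z - n) * (r%:Z - n) + 2 * (r%:Z - n) + (t%:Z * t%:Z + 2 * t%:Z) + (n * n + 0 * n)) =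
     h ^ ((r%:Z - n) * (r%:Z - n) + 2 * (r%:Z - n) + n * n) * h ^ (t%:Z * t%:Z + 2 * t%:Z).
    by rewrite -expfzDr ?hn0 //; congr (_ ^ _); ring.
  have -> : h ^ ((r%:Z - n) * (r%:Z - n) + 0 * (r%:Z - n) + (t%:Z * t%:Z + 2 * t%:Z) + (n * n + 0 * n)) =
     h ^ ((r%:Z - n) * (r%:Z - n) + n * n) * h ^ (t%:Z * t%:Z + 2 * t%:Z).
    by rewrite -expfzDr ?hn0 //; congr (_ ^ _); ring.
  by rewrite !invfM; ring.
- by have := sums_toZ (qpoch_inf (- h) x ^+ 2) first_pairs.
Qed.

(** The two terms are the two halves of the recursion [durfee_polyS]. *)
Lemma first_quadruple_sum :
  sums_to (fun w : nat * nat * nat * nat => let: (i, j, k, l) := w in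
      h ^ (i%:Z * i%:Z + 2 * (j%:Z * j%:Z) + 2 * (k%:Z * k%:Z) + 2 * (l%:Z * l%:Z)
        - 2 * i%:Z * j%:Z + 2 * i%:Z * k%:Z - 2 * j%:Z * k%:Z - 2 * j%:Z * l%:Z
        + 2 * i%:Z - 2 * j%:Z + 2 * k%:Z) /
      (qpoch x x i * qpoch x x j * qpoch x x k * qpoch x x l))
    (qpoch_inf (- h) x ^+ 2 * (c / P) / qpoch_inf x x).
Proof.
apply: (@sums_to_quadruple _ h h0 h1 _ (fun m n => h ^ (m%:Z * m%:Z + 2 * m%:Z + 2 * (n * n))) 1 1).
- move=> i j k l; rewrite expr1n mulr1 !PoszD.
  have -> : h ^ (i%:Z * i%:Z + 2 * (j%:Z * j%:Z) + 2 * (k%:Z * k%:Z) + 2 * (l%:Z * l%:Z)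
        - 2 * i%:Z * j%:Z + 2 * i%:Z * k%:Z - 2 * j%:Z * k%:Z - 2 * j%:Z * l%:Z
        + 2 * i%:Z - 2 * j%:Z + 2 * k%:Z) =
      h ^ ((i%:Z + k%:Z) * (i%:Z + k%:Z) + 2 * (i%:Z + k%:Z) +
        2 * ((j%:Z - l%:Z) * (j%:Z - l%:Z))) *
      h ^ (k%:Z * k%:Z) * h ^ (2 * (j%:Z * l%:Z) - 2 * ((i%:Z + k%:Z + 1) * j%:Z)).
    by rewrite -!expfzDr ?hn0 //; congr (_ ^ _); ring.
  by rewrite !invfM; ring.
- apply: eq_abs_summable (abs_summable_quadruple h0 h1 2 0 0 0) => -[[[i j] k] l].
  by congr (h ^ _ / _); ring.
- have := sums_toZr (qpoch_inf x x)^-1 (sums_to_antidiagonals first_triples).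
  apply: eq_sums_to => -[m n]; rewrite [(m, n).1]/= [(m, n).2]/= addn1 (mulr1 h).
  rewrite (durfee_polyS h0 h1) /durfee_poly.
  rewrite [LHS]mulrC [RHS]mulrCA; congr (_ * _).
  rewrite !mulr_sumr -big_split /= mulr_sumr; apply: eq_bigr => -[r /= rm] _; rewrite ltnS in rm.
  have hb : (m - r)%N%:Z = m%:Z - r%:Z by rewrite subzn.
  rewrite subnKC // hb /gauss.
  have -> : h ^ ((r%:Z - n) * (r%:Z - n) + 2 * (r%:Z - n) + ((m%:Z - r%:Z) * (m%:Z - r%:Z) +
      2 * (m%:Z - r%:Z)) + (n * n + 0 * n)) =
      h ^ (m%:Z * m%:Z + 2 * m%:Z + 2 * (n * n)) * (h ^ (- (2 * n)) *
      h ^ (2 * (r%:Z * r%:Z - m%:Z * r%:Z - n * r%:Z))).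
    by rewrite -!expfzDr ?hn0 //; congr (_ ^ _); ring.
  have -> : h ^ ((r%:Z - n) * (r%:Z - n) + 0 * (r%:Z - n) + ((m%:Z - r%:Z) * (m%:Z - r%:Z) +
      2 * (m%:Z - r%:Z)) + (n * n + 0 * n)) =
      h ^ (m%:Z * m%:Z + 2 * m%:Z + 2 * (n * n)) *
      h ^ (2 * (r%:Z * r%:Z - m%:Z * r%:Z - (n + 1) * r%:Z)).
    by rewrite -!expfzDr ?hn0 //; congr (_ ^ _); ring.
  have := qfact_neq0 h1 m.
  move: (qpoch x x m) (_ * qpoch x x _) (qpoch (- h) x m) => Pm D N Pm0.
  move: (h ^ _) (h ^ _) (h ^ _) (h ^ _) => E4 E3 E2 E1.
  transitivity ((E1 * (E2 * E3) + E1 * E4) * N / D * (Pm^-1 * Pm)); last by ring.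
  by rewrite mulVf //; ring.
Qed.

End FirstSum.

(** * Infinite products and the two identities *)

Lemma has_sum4_sums_to (R : realType) (f : nat -> nat -> nat -> nat -> R[i]) (s : R[i]) :
  sums_to (fun w : nat * nat * nat * nat => let: (i, j, k, l) := w in f i j k l) s ->
  has_sum4 f s.
Proof.
have F := @totally_filter (nat * nat * nat * nat)%type.
move=> hs; apply/cvgrPdist_lt => e e0; have [A hA] := hs e e0.
exists A => // B /= AB; rewrite distrC; have := hA B AB.
by rewrite big_seq_fsetE.
Qed.

Section Products.
Variables (R : realType) (q : R[i]).
Hypotheses (q0 : 0 < `|q|) (q1 : `|q| < 1).

Let q2 : `|q ^+ 2| < 1 := norm_sqr_nome_lt1 q1.

Lemma qpoch_infN_mulJ1 : qpoch_inf (- q) q * J q 1 = J q 2.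
Proof. by rewrite /J !expr1 mulrC qpoch_inf_sqr. Qed.

Lemma qpoch_infN_sqr_mulJ : qpoch_inf (- q) (q ^+ 2) * (J q 1 * J q 4) = J q 2 ^+ 2.
Proof.
have q4 : (q ^+ 2) ^+ 2 = q ^+ 4 by rewrite -exprM.
have qq : q ^+ 2 * q ^+ 2 = q ^+ 4 by rewrite -expr2 q4.
have E1 := qpoch_inf_split2 q q1; rewrite -expr2 in E1.
have E2 := qpoch_inf_split2 (q ^+ 2) q2; rewrite q4 qq in E2.
have E3 := qpoch_inf_sqr q q2; rewrite q4 in E3.
rewrite /J expr1; move: E1 E2 E3.
move: (qpoch_inf q q) (qpoch_inf (q ^+ 2) (q ^+ 2)) (qpoch_inf (q ^+ 4) (q ^+ 4)).
move: (qpoch_inf q (q ^+ 2)) (qpoch_inf (- q) (q ^+ 2)) (qpoch_inf (q ^+ 2) (q ^+ 4)).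
move=> a b d j1 j2 j4 -> E2 E3.
by transitivity (a * b * j4 * j2); [ring|rewrite E3 -E2 expr2].
Qed.

End Products.

Theorem theorem1p2 (R : realType) (q : R[i]) (q_gt0 : 0 < `|q|)
    (q_lt1 : `|q| < 1) :
  has_sum4 (fun i j k l : nat =>
      q ^ (i%:Z ^+ 2 + 2 * j%:Z ^+ 2 + 2 * k%:Z ^+ 2 + 2 * l%:Z ^+ 2
           - 2 * i%:Z * j%:Z + 2 * i%:Z * k%:Z - 2 * j%:Z * k%:Z
           - 2 * j%:Z * l%:Z + 2 * i%:Z - 2 * j%:Z + 2 * k%:Z)
      / (qpoch (q ^+ 2) (q ^+ 2) i * qpoch (q ^+ 2) (q ^+ 2) j
         * qpoch (q ^+ 2) (q ^+ 2) k * qpoch (q ^+ 2) (q ^+ 2) l))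
    (3 * (J q 6 ^+ 3 / (J q 1 * J q 2 * J q 4)))
  /\
  has_sum4 (fun i j k l : nat =>
      q ^ (((i%:Z ^+ 2 + i%:Z) %/ 2)%Z + j%:Z ^+ 2 + k%:Z ^+ 2 + l%:Z ^+ 2
           - i%:Z * j%:Z + i%:Z * k%:Z - j%:Z * k%:Z
           - j%:Z * l%:Z - j%:Z + k%:Z + l%:Z)
      / (qpoch q q i * qpoch q q j * qpoch q q k * qpoch q q l))
    (3 * (J q 2 * J q 3 ^+ 3 / J q 1 ^+ 4)).
Proof.
have J0 m : (0 < m)%N -> J q m != 0.
  move=> m0; have qm : `|q ^+ m| < 1 by rewrite normrX exprn_ilt1 // -lt0n.
  exact: qpoch_inf_neq0.
split.
- pose s := sqrtc (- q); have hs : s ^+ 2 = - q by exact: sqr_sqrtc.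
  apply: has_sum4_sums_to.
  have := first_quadruple_sum q_gt0 q_lt1 hs.
  have Nq1 : `|- q| < 1 by rewrite normrN.
  rewrite hs (qpoch_inf_split2 (- q) Nq1) mulrNN -expr2 sqrrN.
  have -> : qpoch_inf ((q ^+ 2) ^+ 3) ((q ^+ 2) ^+ 3) = J q 6 by rewrite -exprM.
  rewrite -/(J q 2).
  have E := qpoch_infN_sqr_mulJ q_lt1.
  have N0 : qpoch_inf (- q) (q ^+ 2) != 0.
    by apply: qpoch_inf_neq0 => //; exact: norm_sqr_nome_lt1.
  set v := _ / J q 2; have -> : v = 3 * (J q 6 ^+ 3 / (J q 1 * J q 2 * J q 4)).
    rewrite /v; move: E N0 (J0 1%N isT) (J0 2%N isT) (J0 4%N isT).
    move: (J q 1) (J q 2) (J q 4) (J q 6) (qpoch_inf _ _) => j1 j2 j4 j6 N E N0 j10 j20 j40.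
    transitivity (3 * j6 ^+ 3 * N / (j2 * j2 ^+ 2)); first by field; rewrite N0 j20.
    by rewrite -E; field; rewrite N0 j10 j20 j40.
  by apply: eq_sums_to => -[[[i j] k] l].
- pose h := sqrtc q; have hq : h ^+ 2 = q by exact: sqr_sqrtc.
  have h2 : `|h| ^+ 2 = `|q| by rewrite -normrX hq.
  have h0 : 0 < `|h|.
    rewrite normr_gt0; apply/eqP => hz; move: q_gt0.
    by rewrite -h2 hz normr0 expr0n ltxx.
  have h1 : `|h| < 1 by rewrite -(@expr_lt1 _ 2) // h2.
  apply: has_sum4_sums_to; have := second_quadruple_sum h0 h1; rewrite hq.
  rewrite -/(J q 3) -/(J q 2); have -> : qpoch_inf q q = J q 1 by rewrite /J expr1.
  have NE : qpoch_inf (- q) q = J q 2 / J q 1.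
    by rewrite -(qpoch_infN_mulJ1 q_lt1); apply/esym/mulfK; exact: J0.
  rewrite NE; set v := _ / (_ * _); have -> : v = 3 * (J q 2 * J q 3 ^+ 3 / J q 1 ^+ 4).
    rewrite /v; have := J0 1%N isT; have := J0 2%N isT.
    by move: (J q 1) (J q 2) (J q 3) => a b d b0 a0; field; rewrite a0 b0.
  apply: eq_sums_to => -[[[i j] k] l]; congr (_ / _).
  have [m im] := mulz_self_parity i%:Z.
  have -> : ((i%:Z ^+ 2 + i%:Z) %/ 2)%Z = i%:Z + m.
    rewrite expr2 im (_ : i%:Z + 2 * m + i%:Z = (i%:Z + m) * 2); last by ring.
    by rewrite mulzK.
  rewrite -[q in RHS]hq (sqr_nomez h); congr (h ^ _); rewrite im; ring.
Qed.
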